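(* Let $n\ge 1$. Let $G\subset\widehat{\mathrm{Diff}}(\mathbb{C}^n,0)$ be a unipotent solvable group. Then $l(G)\le 2n-1$. Moreover there exists a unipotent solvable group $G\subset\mathrm{Diff}(\mathbb{C}^n,0)$ such that $l(G)=2n-1$.
   Context: Let $\mathfrak m$ be the maximal ideal of $\mathbb{C}[[x_1,\dots,x_n]]$. $\widehat{\mathrm{Diff}}(\mathbb{C}^n,0)$ is the group, under composition, of formal diffeomorphisms: $n$-tuples $\varphi=(\varphi_1,\dots,\varphi_n)$ with each $\varphi_j\in\mathfrak m$ and invertible linear part $j^1\varphi\in GL(n,\mathbb{C})$. $\mathrm{Diff}(\mathbb{C}^n,0)$ is its subgroup of convergent elements, i.e. germs at $0$ of complex analytic diffeomorphisms of $\mathbb{C}^n$ fixing $0$. An element $\varphi$ is unipotent if $j^1\varphi$ is a unipotent linear map (i.e. $j^1\varphi-Id$ is nilpotent). A subgroup is unipotent if all its elements are unipotent. For a group $G$, the derived series is $G^{(0)}=G$, $G^{(k+1)}=[G^{(k)},G^{(k)}]$; the soluble length is $l(G)=\min\{k\ge 0: G^{(k)}=\{Id\}\}$ (with $\min\emptyset=\infty$), and $G$ is solvable if $l(G)<\infty$. *)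

(* Defs.v *)
From HB Require Import structures.
From mathcomp Require Import all_boot all_order all_algebra all_fingroup.
From mathcomp Require Import mpoly complex.
From mathcomp Require Import boolp classical_sets reals ereal esum.

Set Implicit Arguments.
Unset Strict Implicit.
Unset Printing Implicit Defensive.

Import Order.TTheory GRing.Theory Num.Theory.
Local Open Scope ring_scope.

(* Formal power series are coefficient functions on multi-indices. *)
Definition fps (K : fieldType) (n : nat) := 'X_{1..n} -> K.

Section Composition.
Variables (K : fieldType) (n : nat).
Implicit Types (f g : fps K n) (phi psi : 'I_n -> fps K n).

(* Taylor polynomial of degree at most d. *)
Definition jet (d : nat) f : {mpoly K[n]} :=
  \sum_(m : 'X_{1..n < d.+1}) f m *: 'X_[m].

(* f(phi_1, ..., phi_n), for phi_i without constant term: phi^k only involves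
   monomials of degree at least |k|, so the coefficient of x^m in
   \sum_k f_k phi^k is determined by the |m|-jets of f and of the phi_i;
   see fps_compE. *)
Definition fps_comp f phi : fps K n := fun m =>
  (jet (mdeg m) f \mPo [tuple jet (mdeg m) (phi i) | i < n])@_m.

Definition fps_var (i : 'I_n) : fps K n := fun m => (m == U_(i)%MM)%:R.

(* Linear part j^1 phi; U_(j) is the multi-index of the monomial x_j. *)
Definition lin_part phi : 'M[K]_n := \matrix_(i, j) phi i U_(j)%MM.

Definition in_max phi := forall i, phi i 0%MM = 0.

Definition ord_ge e (p : {mpoly K[n]}) := forall m, (mdeg m < e)%N -> p@_m = 0.

Definition ord1 (P : n.-tuple {mpoly K[n]}) := forall i, ord_ge 1 (tnth P i).

Lemma ord_ge0 e : ord_ge e 0. Proof. by move=> m _; rewrite mcoeff0. Qed.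

Lemma ord_ge_leq e e' p : (e' <= e)%N -> ord_ge e p -> ord_ge e' p.
Proof. by move=> le pO m lt; apply: pO; apply: leq_trans le. Qed.

Lemma ord_geD e p q : ord_ge e p -> ord_ge e q -> ord_ge e (p + q).
Proof. by move=> pO qO m lt; rewrite mcoeffD pO ?qO ?addr0. Qed.

Lemma ord_geZ e c p : ord_ge e p -> ord_ge e (c *: p).
Proof. by move=> pO m lt; rewrite mcoeffZ pO ?mulr0. Qed.

Lemma ord_ge_sum e (I : Type) (r : seq I) (P : pred I) (F : I -> {mpoly K[n]}) :
  (forall i, P i -> ord_ge e (F i)) -> ord_ge e (\sum_(i <- r | P i) F i).
Proof.
by move=> FO; elim/big_ind: _ => //; [exact: ord_ge0 | exact: ord_geD].
Qed.

Lemma ord_geM e1 e2 p q :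
  ord_ge e1 p -> ord_ge e2 q -> ord_ge (e1 + e2) (p * q).
Proof.
move=> pO qO m lt; rewrite mcoeffM big1 // => -[k1 k2] /= /eqP mE.
have [k1e|e1k] := ltnP (mdeg k1) e1; first by rewrite pO ?mul0r.
rewrite qO ?mulr0 // -(ltn_add2l e1); apply: leq_ltn_trans lt.
have /(congr1 mdeg) mdE := mE; rewrite mdegD in mdE.
by apply: leq_trans (eq_leq (esym mdE)); rewrite leq_add2r.
Qed.

Lemma mnm_indU (P : 'X_{1..n} -> Prop) :
  P 0%MM -> (forall i k, P k -> P (U_(i) + k)%MM) -> forall k, P k.
Proof.
move=> P0 PU k; move: {2}(mdeg k) (erefl (mdeg k)) => d.
elim: d k => [|d IHd] k kd; first by move/eqP: kd; rewrite mdeg_eq0 => /eqP->.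
have [i ki] : exists i, (0 < k i)%N.
  apply/existsP; rewrite -[[exists _, _]]negbK negb_exists; apply/negP.
  move=> /forallP k0; suff: mdeg k = 0%N by rewrite kd.
  by rewrite mdegE big1 // => i _; have:= k0 i; rewrite -eqn0Ngt => /eqP.
have kE : k = (U_(i) + (k - U_(i)))%MM.
  apply/mnmP => j; rewrite mnmDE mnmBE mnm1E subnKC //.
  by case: eqP => // <-.
rewrite kE; apply/PU/IHd/eqP.
by rewrite -eqSS -kd [in mdeg k]kE mdegD mdeg1 add1n.
Qed.

Lemma comp_mpolyXUD i k (P : n.-tuple {mpoly K[n]}) :
  'X_[(U_(i) + k)] \mPo P = tnth P i * ('X_[k] \mPo P).
Proof. by rewrite mpolyXD rmorphM /= comp_mpolyXU -tnth_nth. Qed.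

Lemma ord_ge_compX k P : ord1 P -> ord_ge (mdeg k) ('X_[k] \mPo P).
Proof.
move=> P1; elim/mnm_indU: k => [m|i k IHk]; first by rewrite mdeg0.
by rewrite comp_mpolyXUD mdegD mdeg1; apply: ord_geM.
Qed.

Lemma ord_ge_compXB d k P Q : (0 < d)%N -> ord1 P -> ord1 Q ->
    (forall i, ord_ge d (tnth P i - tnth Q i)) ->
  ord_ge (d + (mdeg k).-1) ('X_[k] \mPo P - ('X_[k] \mPo Q)).
Proof.
move=> d0 P1 Q1 PQ; elim/mnm_indU: k => [|i k IHk].
  by rewrite mpolyX0 !comp_mpoly1 subrr; apply: ord_ge0.
rewrite !comp_mpolyXUD mdegD mdeg1 add1n /=.
set p := tnth P i; set q := tnth Q i; set pk := _ \mPo P; set qk := _ \mPo Q.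
have -> : p * pk - q * qk = (p - q) * pk + q * (pk - qk).
  by rewrite mulrBl mulrBr addrA subrK.
apply: ord_geD; first by apply: ord_geM; [exact: PQ | exact: ord_ge_compX].
have [k0|k0] := posnP (mdeg k).
  move/eqP: k0; rewrite mdeg_eq0 /pk /qk => /eqP->.
  by rewrite mpolyX0 !comp_mpoly1 subrr mulr0; apply: ord_ge0.
by rewrite -[X in (_ + X)%N](prednK k0) addnS -add1n; apply: ord_geM (Q1 i) IHk.
Qed.

Lemma ord_ge_comp e p P : ord_ge e p -> ord1 P -> ord_ge e (p \mPo P).
Proof.
move=> pO P1; rewrite comp_mpolyEX; apply: ord_ge_sum => m _.
have [me|em] := ltnP (mdeg m) e; first by rewrite pO // scale0r; apply: ord_ge0.
by apply/ord_geZ/(ord_ge_leq em)/ord_ge_compX.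
Qed.

Lemma ord_ge_compB d e p P Q : (0 < d)%N -> ord_ge e p -> ord1 P -> ord1 Q ->
    (forall i, ord_ge d (tnth P i - tnth Q i)) ->
  ord_ge (d + e.-1) (p \mPo P - (p \mPo Q)).
Proof.
move=> d0 pO P1 Q1 PQ; rewrite !comp_mpolyEX -sumrB; apply: ord_ge_sum => m _.
rewrite -scalerBr.
have [me|em] := ltnP (mdeg m) e; first by rewrite pO // scale0r; apply: ord_ge0.
apply/ord_geZ/(@ord_ge_leq (d + (mdeg m).-1)); last exact: ord_ge_compXB.
by rewrite leq_add2l -!subn1 leq_sub2r.
Qed.

Lemma coef_jet d f m : (jet d f)@_m = if (mdeg m <= d)%N then f m else 0.
Proof.
have [md|dm] := leqP (mdeg m) d; first by rewrite [LHS]mcoeff_mpoly.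
rewrite /jet raddf_sum /= big1 // => k _; rewrite mcoeffZ mcoeffX.
by case: eqP (bmdeg k) => [->|_ _]; rewrite ?mulr0 // ltnNge dm.
Qed.

Definition jets d phi := [tuple jet d (phi i) | i < n].

Lemma tnth_jets d phi i : tnth (jets d phi) i = jet d (phi i).
Proof. by rewrite tnth_mktuple. Qed.

Lemma ord1_jets d phi : in_max phi -> ord1 (jets d phi).
Proof.
move=> phi0 i m; rewrite tnth_jets ltnS leqn0 mdeg_eq0 => /eqP->.
by rewrite coef_jet mdeg0 phi0.
Qed.

Lemma ord_ge_jetB d e f g :
    (forall m, (mdeg m < e)%N -> (mdeg m <= d)%N -> f m = g m) ->
  ord_ge e (jet d f - jet d g).
Proof.
move=> fg m me; rewrite mcoeffB !coef_jet.
by case: leqP => md; rewrite ?subrr // fg // subrr.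
Qed.

Lemma ord_ge_jetD d d' f : (d <= d')%N -> ord_ge d.+1 (jet d' f - jet d f).
Proof.
move=> dd m; rewrite ltnS => md.
by rewrite mcoeffB !coef_jet md (leq_trans md dd) subrr.
Qed.

(* The coefficient may be computed from jets of any sufficiently high order. *)
Lemma fps_compP d f phi m : in_max phi -> (mdeg m <= d)%N ->
  fps_comp f phi m = (jet d f \mPo jets d phi)@_m.
Proof.
move=> phi0 md; apply/esym/eqP; rewrite -subr_eq0 -mcoeffB.
have -> : (jet d f \mPo jets d phi)
          - (jet (mdeg m) f \mPo jets (mdeg m) phi) =
          (jet d f - jet (mdeg m) f) \mPo jets d phi +
    (jet (mdeg m) f \mPo jets d phi - (jet (mdeg m) f \mPo jets (mdeg m) phi)).
  by rewrite comp_mpolyB addrA subrK.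
apply/eqP; suff: ord_ge (mdeg m).+1
  ((jet d f - jet (mdeg m) f) \mPo jets d phi +
   (jet (mdeg m) f \mPo jets d phi - (jet (mdeg m) f \mPo jets (mdeg m) phi))).
  exact.
apply: ord_geD; first by apply: ord_ge_comp; [exact: ord_ge_jetD | exact: ord1_jets].
rewrite -[X in ord_ge X _]addn0; apply: (@ord_ge_compB _ 0) => //;
  try exact: ord1_jets.
by move=> i; rewrite !tnth_jets; apply: ord_ge_jetD.
Qed.

Lemma fps_compE f phi m : in_max phi -> fps_comp f phi m =
  \sum_(k : 'X_{1..n < (mdeg m).+1})
     f k * (\prod_(i < n) jet (mdeg m) (phi i) ^+ k i)@_m.
Proof.
move=> phi0; rewrite /fps_comp [X in X \mPo _]/jet.
rewrite [_ \mPo _]raddf_sum /= [LHS]raddf_sum /=.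
apply: eq_bigr => k _; rewrite comp_mpolyZ mcoeffZ comp_mpolyX.
by congr (_ * _@__); apply: eq_bigr => i _; rewrite tnth_mktuple.
Qed.

Lemma fps_comp0 f phi : in_max phi -> fps_comp f phi 0%MM = f 0%MM.
Proof.
move=> phi0; rewrite (@fps_compP 0) ?mdeg0 //.
have -> : jet 0 f = (f 0%MM)%:MP.
  apply/mpolyP => m; rewrite coef_jet mcoeffC leqn0 mdeg_eq0.
  by case: eqP => [->|]; rewrite ?mulr1 ?mulr0.
by rewrite comp_mpolyC mcoeffC eqxx mulr1.
Qed.

Lemma ord_ge_jet_comp d f phi : in_max phi ->
  ord_ge d.+1 (jet d (fps_comp f phi) - (jet d f \mPo jets d phi)).
Proof.
move=> phi0 m; rewrite ltnS => md.
by rewrite mcoeffB coef_jet md (@fps_compP d) ?subrr.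
Qed.

Lemma comp_mpolyA p (P Q : n.-tuple {mpoly K[n]}) :
  (p \mPo P) \mPo Q = p \mPo [tuple tnth P i \mPo Q | i < n].
Proof.
rewrite [p \mPo P]comp_mpolyE raddf_sum /= comp_mpolyE; apply: eq_bigr => m _.
rewrite comp_mpolyZ rmorph_prod /=; congr (_ *: _); apply: eq_bigr => i _.
by rewrite rmorphXn /= tnth_mktuple.
Qed.

Lemma fps_compA f phi psi : in_max phi -> in_max psi ->
  fps_comp (fps_comp f phi) psi = fps_comp f (fun i => fps_comp (phi i) psi).
Proof.
move=> phi0 psi0; apply: funext => m; set d := mdeg m.
have pp0 : in_max (fun i => fps_comp (phi i) psi).
  by move=> i; rewrite fps_comp0.
rewrite !(@fps_compP d) //.
transitivity ((jet d f \mPo jets d phi \mPo jets d psi)@_m).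
  apply/eqP; rewrite -subr_eq0 -mcoeffB -comp_mpolyB; apply/eqP.
  suff: ord_ge d.+1 ((jet d (fps_comp f phi) - (jet d f \mPo jets d phi))
    \mPo jets d psi) by exact.
  by apply: ord_ge_comp; [exact: ord_ge_jet_comp | exact: ord1_jets].
rewrite comp_mpolyA; apply/esym/eqP; rewrite -subr_eq0 -mcoeffB; apply/eqP.
suff: ord_ge d.+1 (jet d f \mPo jets d (fun i => fps_comp (phi i) psi)
  - (jet d f \mPo [tuple tnth (jets d phi) i \mPo jets d psi | i < n])) by exact.
rewrite -[X in ord_ge X _]addn0; apply: (@ord_ge_compB _ 0) => //.
- exact: ord1_jets.
- by move=> i; rewrite tnth_mktuple; apply: ord_ge_comp; exact: ord1_jets.
by move=> i; rewrite !tnth_mktuple; apply: ord_ge_jet_comp.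
Qed.

Lemma in_max_var : in_max fps_var.
Proof. by move=> i; rewrite /fps_var; case: eqP => // /(congr1 mdeg); rewrite mdeg0 mdeg1. Qed.

Lemma jet_var d i : (0 < d)%N -> jet d (fps_var i) = 'X_i.
Proof.
move=> d0; apply/mpolyP => m; rewrite coef_jet mcoeffX /fps_var eq_sym.
by case: eqP => [<-|]; rewrite ?mdeg1 ?d0 // if_same.
Qed.

Lemma fps_comp_idr f : fps_comp f fps_var = f.
Proof.
apply: funext => m; rewrite (@fps_compP (mdeg m).+1) //; last exact: in_max_var.
have -> : jets (mdeg m).+1 fps_var = [tuple 'X_i | i < n].
  by apply: eq_from_tnth => i; rewrite !tnth_mktuple jet_var.
by rewrite comp_mpoly_id coef_jet leqnSn.
Qed.

Lemma fps_comp_idl i phi : in_max phi -> fps_comp (fps_var i) phi = phi i.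
Proof.
move=> phi0; apply: funext => m; rewrite (@fps_compP (mdeg m).+1) //.
by rewrite jet_var // comp_mpolyXU -tnth_nth tnth_jets coef_jet leqnSn.
Qed.

Definition nonlin f : fps K n := fun m => if mdeg m == 1%N then 0 else f m.

Lemma fps_comp_split f phi m : in_max phi -> fps_comp f phi m =
  \sum_j f U_(j)%MM * phi j m + fps_comp (nonlin f) phi m.
Proof.
move=> phi0; set d := (mdeg m).+1.
have md : (mdeg m <= d)%N by [].
rewrite !(@fps_compP d) //.
have -> : jet d f = \sum_j f U_(j)%MM *: 'X_j + jet d (nonlin f).
  apply/mpolyP => k; rewrite mcoeffD !coef_jet raddf_sum /= /nonlin.
  have [k1|k1] := altP (mdeg1P k).
    case: k1 => i /eqP->; rewrite mdeg1 /= addr0 (bigD1 i) //=.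
    rewrite mcoeffZ mcoeffXU eqxx mulr1 big1 ?addr0 // => j ji.
    by rewrite mcoeffZ mcoeffXU (negPf ji) mulr0.
  rewrite big1 ?add0r // => j _; rewrite mcoeffZ mcoeffX.
  case: eqP => [jk|]; rewrite ?mulr0 //.
  by move: k1; rewrite -jk mdeg1.
rewrite comp_mpolyD mcoeffD; congr (_ + _).
rewrite [_ \mPo _]raddf_sum /= [LHS]raddf_sum /=; apply: eq_bigr => j _.
by rewrite comp_mpolyZ mcoeffZ comp_mpolyXU -tnth_nth tnth_jets coef_jet md.
Qed.

Lemma ord_ge_nonlin d f : f 0%MM = 0 -> ord_ge 2 (jet d (nonlin f)).
Proof.
move=> f0 m; rewrite coef_jet /nonlin ltnS leq_eqVlt ltnS leqn0 mdeg_eq0.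
by case/orP => /eqP->; rewrite ?mdeg0 ?f0 /= ?if_same.
Qed.

Lemma lin_part_comp phi psi : in_max phi -> in_max psi ->
  lin_part (fun i => fps_comp (phi i) psi) = lin_part phi *m lin_part psi.
Proof.
move=> phi0 psi0; apply/matrixP => i j; rewrite !mxE fps_comp_split //.
rewrite [X in _ + X](@fps_compP 1) ?mdeg1 //.
rewrite [X in _ + X](_ : _ = 0) ?addr0; first last.
  have /(_ U_(j)%MM) -> // : ord_ge 2 (jet 1 (nonlin (phi i)) \mPo jets 1 psi).
    by apply: ord_ge_comp; [exact: ord_ge_nonlin | exact: ord1_jets].
  by rewrite mdeg1.
by apply: eq_bigr => k _; rewrite !mxE.
Qed.

Lemma lin_part_var : lin_part fps_var = 1%:M.
Proof.
by apply/matrixP => i j; rewrite !mxE /fps_var eq_mnm1 eq_sym.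
Qed.

Lemma fps_comp_nonlin_eq d f phi psi m : f 0%MM = 0 -> (0 < d)%N ->
    in_max phi -> in_max psi ->
    (forall i k, (mdeg k < d)%N -> phi i k = psi i k) -> (mdeg m <= d)%N ->
  fps_comp (nonlin f) phi m = fps_comp (nonlin f) psi m.
Proof.
move=> f0 d0 phi0 psi0 pp md; rewrite !(@fps_compP d) //.
apply/eqP; rewrite -subr_eq0 -mcoeffB; apply/eqP.
suff: ord_ge (d + 2.-1) (jet d (nonlin f) \mPo jets d phi
  - (jet d (nonlin f) \mPo jets d psi)) by apply; rewrite addn1.
apply: ord_ge_compB; rewrite ?ord_ge_nonlin //; try exact: ord1_jets.
  exact: ord_ge_nonlin.
by move=> i; rewrite !tnth_jets; apply: ord_ge_jetB => k kd _; apply: pp.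
Qed.

(* The right inverse of phi is the fixed point of
   psi |-> L^-1 (id - (phi - L) o psi), where L is the linear part of phi. *)
Section Inverse.
Variable phi : 'I_n -> fps K n.
Hypotheses (phi0 : in_max phi) (phiU : lin_part phi \in unitmx).

Let step psi : 'I_n -> fps K n := fun i m =>
  \sum_j invmx (lin_part phi) i j *
    (fps_var j m - fps_comp (nonlin (phi j)) psi m).

Let approx k := iter k step (fun _ _ => 0).

Let in_max_step psi : in_max psi -> in_max (step psi).
Proof.
move=> psi0 i; rewrite /step big1 // => j _.
by rewrite in_max_var fps_comp0 // /nonlin mdeg0 /= phi0 subrr mulr0.
Qed.

Let in_max_approx k : in_max (approx k).
Proof. by elim: k => [//|k IHk]; apply: in_max_step. Qed.

Let step_eq d psi psi' : (0 < d)%N -> in_max psi -> in_max psi' ->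
    (forall i k, (mdeg k < d)%N -> psi i k = psi' i k) ->
  forall i m, (mdeg m <= d)%N -> step psi i m = step psi' i m.
Proof.
move=> d0 psi0 psi0' eqd i m md; apply: eq_bigr => j _.
by congr (_ * (_ - _)); apply: (@fps_comp_nonlin_eq d).
Qed.

Let approxS k i m : (mdeg m <= k)%N -> approx k.+1 i m = approx k i m.
Proof.
elim: k i m => [|k IHk] i m mk.
  move: mk; rewrite leqn0 mdeg_eq0 => /eqP->.
  exact: (in_max_approx 1).
apply: (step_eq (isT : (0 < k.+1)%N) (in_max_approx k.+1) (in_max_approx k) _ i mk).
by move=> j l; rewrite ltnS; apply: IHk.
Qed.

Let approx_stable k l i m : (mdeg m <= k)%N -> (k <= l)%N ->
  approx l i m = approx k i m.
Proof.
move=> mk; elim: l => [|l IHl]; first by rewrite leqn0 => /eqP->.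
rewrite leq_eqVlt => /predU1P[->//|kl]; rewrite approxS ?IHl //.
exact: leq_trans mk _.
Qed.

Let psi : 'I_n -> fps K n := fun i m => approx (mdeg m) i m.

Let psi0 : in_max psi.
Proof. by move=> i; apply: in_max_approx. Qed.

Let psi_fix i m : psi i m = step psi i m.
Proof.
transitivity (approx (mdeg m).+2 i m).
  exact/esym/(approx_stable i (leqnn _))/leqW/leqnSn.
have md : (mdeg m <= (mdeg m).+1)%N by exact: leqnSn.
apply: (step_eq (isT : (0 < (mdeg m).+1)%N) (in_max_approx (mdeg m).+1) psi0 _ i md).
by move=> j k; rewrite ltnS => km; exact: (approx_stable j (leqnn _) (leqW km)).
Qed.

Lemma fps_right_inverse : exists2 psi, in_max psi &
  forall i, fps_comp (phi i) psi = fps_var i.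
Proof.
exists psi => // i; apply: funext => m; rewrite fps_comp_split //.
under eq_bigr => j _ do rewrite psi_fix /step mulr_sumr.
rewrite exchange_big /=.
under eq_bigr => j _.
  under eq_bigr => k _ do rewrite mulrA.
  rewrite -mulr_suml.
  have -> : \sum_k phi i U_(k)%MM * invmx (lin_part phi) k j = (i == j)%:R.
    have /matrixP/(_ i j) := mulmxV phiU; rewrite !mxE => <-.
    by apply: eq_bigr => k _; rewrite !mxE.
  over.
rewrite (bigD1 i) //= eqxx mul1r big1 ?addr0 ?subrK // => j ji.
by rewrite eq_sym (negPf ji) mul0r.
Qed.

End Inverse.

End Composition.

Record fdiff (K : fieldType) (n : nat) := FDiff {
  fdiff_val :> 'I_n -> fps K n;
  fdiff_max : forall i, fdiff_val i 0%MM = 0;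
  fdiff_lin : lin_part fdiff_val \in unitmx }.

Section FormalDiff.
Variables (K : fieldType) (n : nat).
Implicit Types phi psi chi : fdiff K n.

Lemma fdiffP phi psi : (forall i, phi i = psi i) -> phi = psi.
Proof.
case: phi psi => [p p0 pU] [q q0 qU] /= /funext pq; move: q0 qU.
by rewrite -pq => q0 qU; congr FDiff; apply: Prop_irrelevance.
Qed.

Lemma fdiff_comp_max phi psi i : fps_comp (phi i) psi 0%MM = 0.
Proof. by rewrite fps_comp0; [exact: fdiff_max | exact: fdiff_max]. Qed.

Lemma fdiff_comp_lin phi psi :
  lin_part (fun i => fps_comp (phi i) psi) \in unitmx.
Proof.
by rewrite lin_part_comp ?unitmx_mul ?fdiff_lin //; exact: fdiff_max.
Qed.

Definition fdiff_comp phi psi : fdiff K n :=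
  FDiff (fdiff_comp_max phi psi) (fdiff_comp_lin phi psi).

Lemma fdiff_id_lin : lin_part (@fps_var K n) \in unitmx.
Proof. by rewrite lin_part_var unitmx1. Qed.

Definition fdiff_id : fdiff K n := FDiff (@in_max_var K n) fdiff_id_lin.

Lemma fdiff_compA : associative fdiff_comp.
Proof.
move=> phi psi chi; apply: fdiffP => i /=.
by rewrite fps_compA //; exact: fdiff_max.
Qed.

Lemma fdiff_comp1l : left_id fdiff_id fdiff_comp.
Proof. by move=> phi; apply: fdiffP => i; apply/fps_comp_idl/fdiff_max. Qed.

Lemma fdiff_comp1r : right_id fdiff_id fdiff_comp.
Proof. by move=> phi; apply: fdiffP => i; apply: fps_comp_idr. Qed.

Lemma fdiff_right_inverse phi : {psi | fdiff_comp phi psi = fdiff_id}.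
Proof.
apply: cid.
have [psi psi0 phiK] := fps_right_inverse (@fdiff_max _ _ phi) (fdiff_lin phi).
have psiU : lin_part psi \in unitmx.
  have : lin_part phi *m lin_part psi = 1%:M.
    rewrite -lin_part_comp //; last exact: fdiff_max.
    by rewrite -lin_part_var; congr lin_part; apply: funext.
  by case/mulmx1_unit.
by exists (FDiff psi0 psiU); apply: fdiffP => i; apply: phiK.
Qed.

Definition fdiff_inv phi : fdiff K n := sval (fdiff_right_inverse phi).

Lemma fdiff_compV : right_inverse fdiff_id fdiff_inv fdiff_comp.
Proof. by move=> phi; apply: svalP (fdiff_right_inverse phi). Qed.

Lemma fdiff_compVl : left_inverse fdiff_id fdiff_inv fdiff_comp.
Proof.
move=> phi; rewrite -[LHS]fdiff_comp1r -(fdiff_compV (fdiff_inv phi)).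
rewrite -fdiff_compA [X in fdiff_comp _ X]fdiff_compA fdiff_compV.
by rewrite fdiff_comp1l.
Qed.

End FormalDiff.

HB.instance Definition _ (K : fieldType) (n : nat) := gen_eqMixin (fdiff K n).
HB.instance Definition _ (K : fieldType) (n : nat) :=
  gen_choiceMixin (fdiff K n).
HB.instance Definition _ (K : fieldType) (n : nat) :=
  isGroup.Build (fdiff K n) (@fdiff_compA K n) (@fdiff_comp1l K n)
    (@fdiff_comp1r K n) (@fdiff_compVl K n) (@fdiff_compV K n).

Section SolubleLength.
Variable gT : groupType.
Implicit Types G H : set gT.
Local Open Scope group_scope.
Local Open Scope classical_set_scope.

Definition is_subgroup G :=
  [/\ G 1, forall x y, G x -> G y -> G (x * y) & forall x, G x -> G x^-1].

Definition derived_subgroup G : set gT :=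
  smallest is_subgroup [set [~ x, y] | x in G & y in G].

Definition derived (k : nat) G : set gT := iter k derived_subgroup G.

Definition terminates G :=
  exists k : nat, `[< derived k G = [set 1] >].

(* The value None stands for infinite length. *)
Definition soluble_length G : option nat :=
  if pselect (terminates G) is left ex then Some (ex_minn ex) else None.

Definition is_solvable G := soluble_length G <> None.

Lemma soluble_lengthP G k : soluble_length G = Some k <->
  derived k G = [set 1] /\ forall j : nat, derived j G = [set 1] -> (k <= j)%N.
Proof.
rewrite /soluble_length; case: pselect => [ex|nex]; last first.
  by split=> // -[Gk _]; case: nex; exists k; apply/asboolP.
case: ex_minnP => l /asboolP Gl lmin; split=> [[<-]|[Gk kmin]].
  by split=> // j Gj; apply/lmin/asboolP.
congr Some; apply/eqP; rewrite eqn_leq; apply/andP; split; last exact: kmin.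
exact/lmin/asboolP.
Qed.

End SolubleLength.

Definition unipotent (K : fieldType) (n : nat) (phi : fdiff K n) :=
  exists k : nat, (lin_part phi - 1%:M) ^+ k = 0.

Definition unipotent_set (K : fieldType) (n : nat) (G : set (fdiff K n)) :=
  forall phi, G phi -> unipotent phi.

(* Unordered (absolute) summability at every point of some open polydisc. *)
Definition convergent_fps (R : realType) (n : nat) (f : fps R[i] n) :=
  exists2 r : R, 0 < r & forall z : 'I_n -> R[i], (forall i, Normc.normc (z i) < r) ->
    summable [set: 'X_{1..n}]
      (fun m => (Normc.normc (f m * \prod_i z i ^+ m i))%:E).

(* Diff(C^n, 0), as a subset of the group of formal diffeomorphisms *)
Definition convergent_diff (R : realType) (n : nat) : set (fdiff R[i] n) :=
  [set phi | forall i, convergent_fps (phi i)]%classic.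

(* Main.v *)
Require Import Defs.
From HB Require Import structures.
From mathcomp Require Import all_boot all_order all_algebra all_fingroup ring zify.
From mathcomp Require Import mpoly complex generic_quotient.
From mathcomp Require Import boolp classical_sets reals ereal esum.
From mathcomp Require Import cardinality fsbigop.

Set Implicit Arguments.
Unset Strict Implicit.
Unset Printing Implicit Defensive.

Import Order.TTheory GRing.Theory Num.Theory.
Local Open Scope ring_scope.

(** Both halves go through the Lie algebra of formal vector fields vanishing at
    the origin.

    Upper bound, over any field [F] of characteristic zero.  Substitution by a
    unipotent [phi] is unipotent on every jet space, so the coefficients of
    [f o phi^t] are polynomial in the exponent [t], and their derivative at
    [t = 0] is a derivation of the ring of power series: the logarithm of [phi], a
    vector field ([log_vf]).  A solvable unipotent group [G] acts on each jet space
    by matrices that a flag makes simultaneously unitriangular ([kolchin_flag]),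
    so exponential, logarithm and Campbell-Hausdorff series are finite there.  The
    logarithm of the commutator of [g^t] and [h^s] is polynomial in [s] and [t]
    with the bracket of the logarithms as coefficient of [s t] ([log_br]); hence
    the logarithms of [G] span a solvable Lie algebra.  Conversely the
    Campbell-Hausdorff formula puts the logarithms of the [k]-th derived group in
    the [k]-th term of the derived series of that algebra ([log_derived]).  The
    bound is therefore a statement on a solvable Lie algebra [S] of vector fields,
    [vf_solvable_length], proved over the field of fractions [K] of the power
    series.

    Let [V] be the [K]-span of [S], let [j] be the first index at which the span
    [W] of the [j]-th derived algebra is smaller than [V], and let [Y_1, ..., Y_e]
    in the previous term of the series be a basis of [V] modulo [W].  Modulo [W] an
    element [Z] of [S] is [f_1 Y_1 + ... + f_e Y_e], and the matrix of the
    [Y_k f_i] is annihilated by every element of [S]: thus [S] acts like a Lie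
    algebra of affine vector fields ([affine_modelP]).  The linear parts form a
    solvable Lie ring of matrices, whose commutators have a common nonzero kernel
    vector ([lie_mx_common_kernel]); the corresponding linear form in the [f_i]
    vanishes on the second derived algebra.  So two steps of the derived series
    lower the rank over [K] by at least one ([rank_drop]).  When the rank is [n],
    functions annihilated by [S] are constants, and topological nilpotency of the
    brackets makes the linear parts nilpotent; then one step is enough
    ([rank_drop_nil], [vfs_ad_nilpotent]).  The total is [1 + 2 (n - 1)].

    Example.  The group [triangular_group] consists of the maps
    [x_0 |-> x_0 / (1 - t x_0)] and [x_i |-> c_i x_i + a_i], where [c_i] and [a_i]
    are rational functions of [x_0, ..., x_(i-1)] regular at the origin and
    [c_i(0) = 1].  It is unipotent, it is solvable because each coordinate is acted
    upon by an affine group, and rational series converge.  Its derived length is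
    at least [2 n - 1] since the [2 i]-th derived group contains a nontrivial
    translation [T : x_i |-> x_i + b] ([derived_translation]): commutators of [T]
    with the scalings and the translations of [x_(i+1)] apply to their
    coefficients the multiplicative and the additive difference operator of [T],
    which [1 - x_i] and [1 / (1 - x_i)] survive any number of times, and the
    commutator of a scaling with a translation is the next translation. *)

(** * Lie rings *)

Section LieRing.
Variables (L : zmodType) (br : L -> L -> L).
Implicit Types (S I : set L) (u v w : L).

(** Additivity, antisymmetry and the Jacobi identity are all that is shared by
    matrices, by vector fields over [K] (whose bracket is not [K]-bilinear) and by
    their jets; the rest of the theory is for subsets closed under these
    operations. *)
Definition lie_axioms : Prop :=
  [/\ forall u v w, br (u + v) w = br u w + br v w,
      forall u v, br v u = - br u v &
      forall u v w, br u (br v w) = br (br u v) w + br v (br u w)].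

Definition lie_ring S :=
  [/\ S 0, forall u v, S u -> S v -> S (u - v) &
      forall u v, S u -> S v -> S (br u v)].

Inductive lie_der S : set L :=
| LieDer0 : lie_der S 0
| LieDerD u v w : S u -> S v -> lie_der S w -> lie_der S (br u v + w).

Definition lie_ser k S : set L := iter k lie_der S.

Definition lie_solvable S := exists k, forall u, lie_ser k S u -> u = 0.

Hypothesis brA : lie_axioms.

Lemma lie_brDl u v w : br (u + v) w = br u w + br v w.
Proof. by case: brA. Qed.

Lemma lie_brC u v : br v u = - br u v.
Proof. by case: brA. Qed.

Lemma lie_jacobi u v w : br u (br v w) = br (br u v) w + br v (br u w).
Proof. by case: brA. Qed.

Lemma lie_brDr u v w : br u (v + w) = br u v + br u w.
Proof. by rewrite lie_brC lie_brDl opprD -!lie_brC. Qed.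

Lemma lie_br0r u : br u 0 = 0.
Proof. by apply/(addrI (br u 0)); rewrite -lie_brDr !addr0. Qed.

Lemma lie_br0l u : br 0 u = 0.
Proof. by rewrite lie_brC lie_br0r oppr0. Qed.

Lemma lie_brNr u v : br u (- v) = - br u v.
Proof. by apply/(addrI (br u v)); rewrite -lie_brDr !subrr lie_br0r. Qed.

Lemma lie_brBr u v w : br u (v - w) = br u v - br u w.
Proof. by rewrite lie_brDr lie_brNr. Qed.

Lemma lie_ringN S u : lie_ring S -> S u -> S (- u).
Proof. by case=> S0 SB _ Su; rewrite -sub0r; apply: SB. Qed.

Lemma lie_ringD S u v : lie_ring S -> S u -> S v -> S (u + v).
Proof.
by move=> LS Su Sv; rewrite -[v]opprK; case: (LS) => _ SB _; apply: SB => //;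
   apply: lie_ringN.
Qed.

Lemma lie_der_br S u v : S u -> S v -> lie_der S (br u v).
Proof. by move=> Su Sv; rewrite -[br u v]addr0; apply: LieDerD => //; left. Qed.

Lemma lie_derD S u v : lie_der S u -> lie_der S v -> lie_der S (u + v).
Proof.
move=> + Sv; elim=> [|a b w Sa Sb _ IH]; first by rewrite add0r.
by rewrite -addrA; apply: LieDerD.
Qed.

Lemma lie_derN S u : lie_der S u -> lie_der S (- u).
Proof.
elim=> [|a b w Sa Sb _ IH]; first by rewrite oppr0; left.
by rewrite opprD -lie_brC; apply: LieDerD.
Qed.

Lemma lie_der_sub S u : lie_ring S -> lie_der S u -> S u.
Proof.
move=> LS; elim=> [|a b w Sa Sb _ IH]; first by case: LS.
by apply: lie_ringD => //; case: LS => _ _; apply.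
Qed.

Lemma lie_der_ring S : lie_ring S -> lie_ring (lie_der S).
Proof.
move=> LS; split=> [|u v Su Sv|u v Su Sv]; first by left.
  by apply: lie_derD => //; apply: lie_derN.
by apply: lie_der_br; apply: lie_der_sub.
Qed.

Lemma lie_ser_ring k S : lie_ring S -> lie_ring (lie_ser k S).
Proof. by move=> LS; elim: k => [//|k IHk]; apply: lie_der_ring. Qed.

Lemma lie_ser_sub k S u : lie_ring S -> lie_ser k S u -> S u.
Proof.
move=> LS; elim: k u => [//|k IHk] u Su; apply: IHk.
exact: (lie_der_sub (lie_ser_ring k LS)).
Qed.

Lemma lie_ser_leq j k S u : (j <= k)%N -> lie_ring S ->
  lie_ser k S u -> lie_ser j S u.
Proof.
move=> jk LS; rewrite -(subnK jk) /lie_ser iterD => Su.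
by move: (lie_ser_ring j LS) => LSj; apply: lie_ser_sub Su.
Qed.

Lemma lie_ser_ideal k S u v : lie_ring S -> S u -> lie_ser k S v ->
  lie_ser k S (br u v).
Proof.
move=> LS; elim: k u v => [|k IHk] u v Su; first by case: LS => _ _; apply.
move=> /=; elim=> [|a b w Sa Sb _ IH]; first by rewrite lie_br0r; left.
rewrite lie_brDr lie_jacobi; apply: lie_derD => //.
by apply: lie_derD; apply: lie_der_br => //; apply: IHk.
Qed.

End LieRing.

Lemma lie_ser_image (L L' : zmodType) br br' (S : set L) (f : L -> L') k y :
    lie_ring br S -> f 0 = 0 ->
    (forall u v, S u -> S v -> f (u + v) = f u + f v) ->
    (forall u v, S u -> S v -> f (br u v) = br' (f u) (f v)) ->
  lie_axioms br ->
  lie_ser br' k [set f u | u in S]%classic y <->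
    exists2 u, lie_ser br k S u & y = f u.
Proof.
move=> LS f0 fD fbr brA; elim: k y => [|k IHk] y /=.
  by split=> [[u Su <-]|[u Su ->]]; exists u.
split.
  elim=> [|a b w /IHk[u Su ->] /IHk[v Sv ->] _ [t St ->]].
    by exists 0; rewrite ?f0 //; left.
  have [Su' Sv'] : S u /\ S v by split; apply: (lie_ser_sub brA LS); eassumption.
  have St' : S t.
    apply: (@lie_ser_sub _ _ brA k.+1 S t LS); exact: St.
  exists (br u v + t); first by apply: LieDerD.
  by rewrite fD ?fbr //; case: LS => _ _; apply.
case=> u + ->; elim=> [|a b w Sa Sb Sw IH]; first by rewrite f0; left.
have [Sa' Sb'] : S a /\ S b by split; apply: (lie_ser_sub brA LS); eassumption.
have Sw' : S w by apply: (@lie_ser_sub _ _ brA k.+1 S w LS); exact: Sw.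
rewrite fD ?fbr //; last by case: LS => _ _; apply.
apply: LieDerD => //; apply/IHk; eexists; try reflexivity; eassumption.
Qed.

Definition comm_br (R : pzRingType) (x y : R) := x * y - y * x.

Lemma comm_br_lie (R : pzRingType) : lie_axioms (@comm_br R).
Proof.
rewrite /comm_br; split=> [u v w|u v|u v w].
- by rewrite mulrDl mulrDr opprD addrACA.
- by rewrite opprB.
rewrite !mulrBl !mulrBr !mulrA !opprB.
by rewrite [RHS]addrACA !addrA !subrK addrAC [RHS]addrAC; congr (_ + _); rewrite addrAC.
Qed.

(** * Solvable Lie rings of matrices *)

Section Subspaces.
Variable (F : fieldType).

(** Maximality gives the basis: a family of elements of [S] that is independent
    modulo [W] and cannot be extended spans [S] modulo [W]. *)
Lemma basis_mod n m (S : set 'rV[F]_n) (W : 'M[F]_(m, n)) :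
  exists e (Y : 'M[F]_(e, n)), [/\ forall k, S (row k Y),
    \rank (col_mx Y W) = (e + \rank W)%N &
    forall v, S v -> (v <= col_mx Y W)%MS].
Proof.
pose P e := `[< exists Y : 'M[F]_(e, n), (forall k, S (row k Y)) /\
    \rank (col_mx Y W) = (e + \rank W)%N >].
have P0 : exists e, P e.
  exists 0; apply/asboolP; exists 0; split=> [[]//|].
  by rewrite -addsmxE adds0mx.
have Pb e : P e -> (e <= n)%N.
  move=> /asboolP[Y [_ YW]]; apply: leq_trans (rank_leq_col (col_mx Y W)).
  by rewrite YW leq_addr.
case: (ex_maxnP P0 Pb) => e /asboolP[Y [SY YW]] emax.
exists e, Y; split=> // v Sv; apply: contrapT => /negP vY.
suff /emax : P (1 + e)%N by rewrite ltnn.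
apply/asboolP; exists (col_mx v Y); split.
  move=> k; case: (@split_ordP 1 e k) => j ->; last by rewrite rowKd.
  by rewrite rowKu (ord1 j) row_id.
have v0 : \rank v = 1%N.
  by rewrite rank_rV; case: eqP vY => // ->; rewrite sub0mx.
transitivity (\rank (col_mx v (col_mx Y W))).
  have sl m1 m2 (A : 'M[F]_(m1, n)) (B : 'M_(m2, n)) : (A <= col_mx A B)%MS.
    by rewrite -addsmxE addsmxSl.
  have sr m1 m2 (A : 'M[F]_(m1, n)) (B : 'M_(m2, n)) : (B <= col_mx A B)%MS.
    by rewrite -addsmxE addsmxSr.
  apply: eqmx_rank; rewrite !col_mx_sub !sl !sr.
  rewrite (submx_trans (sl _ _ v Y) (sl _ _ _ W)) (submx_trans (sr _ _ v Y) (sl _ _ _ W)).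
  rewrite (submx_trans (sl _ _ Y W) (sr _ _ v _)) (submx_trans (sr _ _ Y W) (sr _ _ v _)).
  by [].
rewrite -(addsmxE v) add1n addSn -YW; set U := col_mx Y W in vY *.
apply/eqP; rewrite eqn_leq; apply/andP; split.
  by rewrite (leq_trans (mxrank_adds_leqif _ _).1) // v0 add1n.
by apply: rank_ltmx; rewrite ltmxE addsmxSr addsmx_sub submx_refl andbT.
Qed.

Lemma subspace_mx n (P : set 'rV[F]_n) : P 0 ->
    (forall a u v, P u -> P v -> P (a *: u + v)) ->
  exists A : 'M[F]_n, forall v, P v <-> (v <= A)%MS.
Proof.
move=> P0 PD; have [e [Y [PY _ PsubY]]] := basis_mod P (0 : 'M[F]_(0, n)).
exists (<<Y>>)%MS => v; rewrite genmxE; split=> [/PsubY|/submxP[D ->]].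
  by rewrite -addsmxE addsmx0.
rewrite mulmx_sum_row; elim/big_ind: _ => // [u w Pu Pw|i _].
  by rewrite -[u]scale1r; apply: PD.
by rewrite -[_ *: _]addr0; apply: PD.
Qed.

Lemma min_stablemx n (s : set 'M[F]_n) : (0 < n)%N ->
  exists A : 'M[F]_n, [/\ A != 0, forall M, s M -> (A *m M <= A)%MS &
    forall U : 'M[F]_n, U != 0 -> (forall M, s M -> (U *m M <= U)%MS) ->
      (U <= A)%MS -> (A <= U)%MS].
Proof.
move=> n0; pose P r := `[< exists A : 'M[F]_n, [/\ A != 0,
  forall M, s M -> (A *m M <= A)%MS & \rank A = r] >].
have exP : exists r, P r.
  exists n; apply/asboolP; exists 1%:M; split=> [|M _|]; last exact: mxrank1.
    by rewrite -mxrank_eq0 mxrank1 -lt0n.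
  exact: submx1.
case: (ex_minnP exP) => r /asboolP[A [A0 sA rA]] rmin; exists A; split=> //.
move=> U U0 sU UA; rewrite -(geq_leqif (mxrank_leqif_sup UA)) rA.
by apply: rmin; apply/asboolP; exists U.
Qed.

(** The last nonzero image of [A] under the powers of [b] is killed by [b]. *)
Lemma mx_nil_stable n (A b : 'M[F]_n.+1) : A != 0 -> (A *m b <= A)%MS ->
  (exists k, b ^+ k = 0) -> (A :&: kermx b)%MS != 0.
Proof.
move=> A0 Ab [k bk]; have ex : exists k, A *m b ^+ k == 0.
  by exists k; rewrite bk mulmx0.
case: (ex_minnP ex) => -[|m]; first by rewrite expr0 mulmx1 (negPf A0).
move=> Am mmin; have: A *m b ^+ m != 0.
  by apply/negP => /mmin; rewrite ltnn.
apply: contraNneq => cap0; rewrite -submx0 -cap0 sub_capmx; apply/andP; split.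
  elim: m {Am mmin} => [|m IHm]; first by rewrite expr0 mulmx1.
  by rewrite exprSr mulmxA (submx_trans (submxMr _ IHm)).
by apply/sub_kermxP; rewrite -mulmxA -[_ *m b]/(_ * b) -exprSr (eqP Am).
Qed.

(** A minimal subspace stable under commuting nilpotents is killed by each of
    them, since the kernel of one is stable under the others. *)
Lemma comm_nil_kill n (s : set 'M[F]_n.+1) (A : 'M[F]_n.+1) :
    A != 0 -> (forall M, s M -> (A *m M <= A)%MS) ->
    (forall U : 'M[F]_n.+1, U != 0 -> (forall M, s M -> (U *m M <= U)%MS) ->
      (U <= A)%MS -> (A <= U)%MS) ->
    (forall a b, s a -> s b -> a * b = b * a) ->
    forall b, s b -> (exists k, b ^+ k = 0) -> A *m b = 0.
Proof.
move=> A0 sA Amin sC b sb bnil; apply/sub_kermxP.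
have /Amin : (A :&: kermx b)%MS != 0 by apply: mx_nil_stable => //; apply: sA.
move=> H; apply: submx_trans (H _ (capmxSl _ _)) (capmxSr _ _) => M sM.
rewrite sub_capmx (submx_trans (submxMr _ (capmxSl _ _)) (sA _ sM)) /=.
apply/sub_kermxP; rewrite -mulmxA.
have -> : M *m b = b *m M by apply: (sC M b).
rewrite mulmxA; have /sub_kermxP -> : (A :&: kermx b <= kermx b)%MS.
  exact: capmxSr.
by rewrite mul0mx.
Qed.

End Subspaces.

Section CommBracket.
Variable (R : nzRingType).
Implicit Types (x a c : R).

Lemma comm_brXn x a c k : comm_br x a = c -> c * a = a * c ->
  x * a ^+ k.+1 = a ^+ k.+1 * x + a ^+ k * c *+ k.+1.
Proof.
move=> xa ca; have xaE : x * a = a * x + c by rewrite -xa addrC subrK.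
elim: k => [|k IHk]; first by rewrite !expr1 expr0 mul1r xaE.
rewrite exprSr mulrA IHk mulrDl -mulrA xaE mulrDr mulrA -exprSr -addrA.
by rewrite mulrnAl -mulrA ca mulrA -exprSr -mulrS.
Qed.

End CommBracket.

Section CommBracketHorner.
Variables (F : fieldType) (n : nat).
Implicit Types (x a c : 'M[F]_n.+1).

(** If [c = [x, a]] commutes with [a], then the bracket with [x] acts on
    polynomials in [a] as the derivation [c d/da]. *)
Lemma comm_br_horner x a c (p : {poly F}) : comm_br x a = c -> c * a = a * c ->
  x * horner_mx a p = horner_mx a p * x + horner_mx a p^`() * c.
Proof.
move=> xa ca; have xaE : x * a = a * x + c by rewrite -xa addrC subrK.
elim/poly_ind: p => [|p e IHp]; first by rewrite deriv0 !rmorph0 mulr0 !mul0r addr0.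
rewrite derivD derivM derivX derivC addr0 mulr1 !rmorphD !rmorphM /=.
rewrite !horner_mx_X !horner_mx_C.
set P := horner_mx a p; set P' := horner_mx a p^`() in IHp *.
have xe : x * e%:M = e%:M * x by rewrite -!mulmxE scalar_mxC.
rewrite mulrDr xe mulrA IHp [(_ + P' * c) * a]mulrDl -!mulrA xaE ca !mulrDl.
by rewrite mulrDr !mulrA -!addrA; congr (_ + _); rewrite addrCA [RHS]addrCA [X in _ + X]addrC.
Qed.

End CommBracketHorner.

Section Irreducible.
Variables (F : fieldType) (n : nat).
Hypothesis F0 : [pchar F] =i pred0.
Local Notation M := 'M[F]_n.+1.
Variable s : set M.
Local Notation br := (@comm_br M).
Hypotheses (sL : lie_ring br s) (sS : lie_solvable br s).
Hypothesis sI : forall U : M, U != 0 -> (forall x, s x -> (U *m x <= U)%MS) ->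
  (1%:M <= U)%MS.

Let brA := comm_br_lie M.

Let nat0 k : (k%:R == 0 :> F) = (k == 0%N).
Proof. exact: (pcharf0P F).1 F0 k. Qed.

(** The limit of the kernels of the powers of [b] is stable under [s]: moving [x]
    across a power of [b] costs the bracket of [x] with [b] and one factor [b].
    Irreducibility leaves the two extreme cases. *)
Lemma irr_nil_or_unit (b : M) :
  (forall x, s x -> comm_br x b * b = b * comm_br x b) ->
  (exists k, b ^+ k = 0) \/ b \is a GRing.unit.
Proof.
move=> sb; pose P r := `[< exists k, \rank (kermx (b ^+ k)) = r >].
have exP : exists r, P r by exists (\rank (kermx (b ^+ 0))); apply/asboolP; exists 0%N.
have Pb r : P r -> (r <= n.+1)%N by case/asboolP => k <-; apply: rank_leq_row.
case: (ex_maxnP exP Pb) => r /asboolP[k kr] rmax.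
have kerS : (kermx (b ^+ k.+1) <= kermx (b ^+ k))%MS.
  have le : (kermx (b ^+ k) <= kermx (b ^+ k.+1))%MS.
    by apply/sub_kermxP; rewrite exprSr -mulmxE mulmxA mulmx_ker mul0mx.
  rewrite -(geq_leqif (mxrank_leqif_sup le)) kr; apply: rmax.
  by apply/asboolP; exists k.+1.
have [k0|k0] := eqVneq (kermx (b ^+ k)) 0; last first.
  left; exists k; rewrite -[LHS]mul1mx; apply/sub_kermxP; apply: sI => // x sx.
  apply: submx_trans kerS; apply/sub_kermxP.
  have E : x * b ^+ k.+1 = b ^+ k * (b * x + comm_br x b *+ k.+1).
    by rewrite (comm_brXn _ erefl (sb _ sx)) [RHS]mulrDr mulrnAr exprSr mulrA.
  by rewrite -mulmxA mulmxE E -mulmxE mulmxA mulmx_ker mul0mx.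
right; rewrite -[_ \is a _]/(b \in unitmx) -row_free_unit -kermx_eq0 -submx0 -k0.
apply: submx_trans kerS; apply/sub_kermxP.
by rewrite exprS -mulmxE mulmxA mulmx_ker mul0mx.
Qed.

(** A derivation of a commutative algebra of matrices cannot send [a] to an
    invertible element: it would send [P(a) = 0], for the minimal polynomial
    [P] of [a], to the product of that element by [P'(a)]. *)
Lemma comm_br_nonunit (x a : M) :
  comm_br x a * a = a * comm_br x a -> comm_br x a \isn't a GRing.unit.
Proof.
move=> ca; apply/negP => cU; have := comm_br_horner (mxminpoly a) (erefl _) ca.
rewrite mx_root_minpoly mulr0 mul0r add0r => /esym/(congr1 ( *%R^~ (comm_br x a)^-1)).
rewrite mul0r mulrK // => /mxminpoly_min dv.
have p1 : (1 < size (mxminpoly a))%N by rewrite size_mxminpoly ltnS mxminpoly_nonconstant.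
have d0 : (mxminpoly a)^`() != 0.
  apply/negP => /eqP /(congr1 (fun q : {poly F} => q`_(degree_mxminpoly a).-1)).
  rewrite coef_deriv coef0 prednK ?mxminpoly_nonconstant //.
  have /monicP := mxminpoly_monic a; rewrite lead_coefE size_mxminpoly /= => ->.
  move/eqP; rewrite nat0.
  by have := mxminpoly_nonconstant a; rewrite lt0n => /negPf ->.
have := dvdp_leq d0 dv; apply/negP; rewrite -ltnNge.
by apply: lt_size_deriv; rewrite -size_poly_eq0 -lt0n (ltn_trans _ p1).
Qed.

(** [[x, y] c = [x, y c]] when [c] commutes with [x]. *)
Lemma mxtrace_lie_der (T : set M) (c : M) w :
  (forall x, T x -> c * x = x * c) -> lie_der br T w -> \tr (w * c) = 0.
Proof.
move=> Tc; elim=> [|x y w' Tx Ty _ IH]; first by rewrite mul0r mxtrace0.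
rewrite mulrDl mxtraceD IH addr0 mulrBl raddfB /= -!mulrA -(Tc _ Tx).
apply/eqP; rewrite subr_eq0; apply/eqP.
by rewrite [LHS](mxtrace_mulC x (y * c)) mulmxE mulrA.
Qed.

(** Otherwise the last nonzero term of the derived series is abelian and consists
    of sums of brackets.  The brackets of its elements with those of [s] commute
    and none is invertible by [comm_br_nonunit]; so they are nilpotent and have a
    common kernel, stable under [s]: they vanish.  A nonzero element [a] of that
    term is thus central, hence invertible by irreducibility, and [a a^-1 = 1] has
    trace zero because [a] is a sum of brackets. *)
Lemma irr_solvable_abelian x y : s x -> s y -> comm_br x y = 0.
Proof.
have ex : exists k, `[< forall u, lie_ser br k s u -> u = 0 >].
  by case: sS => k sk; exists k; apply/asboolP.
case: (ex_minnP ex) => -[|[|k]] /asboolP sk kmin sx sy.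
- by rewrite (sk x) // (sk y) // /comm_br mulr0 subrr.
- by apply: sk; apply: lie_der_br.
have kL := lie_ser_ring brA k sL; have k1L := lie_ser_ring brA k.+1 sL.
have ks u : lie_ser br k.+1 s u -> s u by apply: lie_ser_sub.
have aC a b : lie_ser br k.+1 s a -> lie_ser br k.+1 s b -> a * b = b * a.
  move=> sa sb; apply/eqP; rewrite -subr_eq0; apply/eqP.
  by apply: sk; apply: lie_der_br.
have aI z a : s z -> lie_ser br k.+1 s a -> lie_ser br k.+1 s (comm_br z a).
  by move=> sz sa; apply: (lie_ser_ideal brA).
have bnil z a : s z -> lie_ser br k.+1 s a -> exists j, comm_br z a ^+ j = 0.
  move=> sz sa.
  have zaC x' : s x' -> comm_br x' (comm_br z a) * comm_br z a =
      comm_br z a * comm_br x' (comm_br z a).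
    by move=> sx'; apply: (aC _ _ (aI _ _ sx' (aI _ _ sz sa)) (aI _ _ sz sa)).
  have [//|U] := irr_nil_or_unit zaC.
  by have := comm_br_nonunit (aC _ _ (aI _ _ sz sa) sa); rewrite U.
pose t := [set b | exists2 z, s z & exists2 a, lie_ser br k.+1 s a & b = comm_br z a]%classic.
have [A [A0 tA Amin]] := @min_stablemx F n.+1 t isT.
have tC a b : t a -> t b -> a * b = b * a.
  by move=> [z sz [a' sa' ->]] [z' sz' [b' sb' ->]]; apply: aC; apply: aI.
have tK b : t b -> A *m b = 0.
  move=> tb; apply: (comm_nil_kill A0 tA Amin tC tb).
  by case: tb => z sz [a sa ->]; apply: bnil.
have [C CP] : exists C : M, forall v : 'rV[F]_n.+1, (forall b, t b -> v *m b = 0) <-> (v <= C)%MS.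
  apply: (@subspace_mx F n.+1 (fun v => forall b, t b -> v *m b = 0)).
    by move=> b _; apply: mul0mx.
  by move=> a u v Pu Pv b tb; rewrite mulmxDl -scalemxAl Pu // Pv // scaler0 addr0.
have AC : (A <= C)%MS.
  by apply/row_subP => i; apply/CP => b tb; rewrite -row_mul tK // row0.
have C1 : (1%:M <= C)%MS.
  apply: sI => [|z sz]; first by apply: contraNneq A0 => C0; rewrite -submx0 -C0.
  apply/row_subP => i; apply/CP => b tb; rewrite row_mul.
  have rC : forall b, t b -> row i C *m b = 0 by apply/CP/row_sub.
  have zb : z *m b = b *m z + comm_br z b by rewrite /comm_br -!mulmxE addrC subrK.
  rewrite -mulmxA zb mulmxDr mulmxA rC // mul0mx add0r; apply: rC.
  by exists z => //; exists b => //; case: tb => z' sz' [b' sb' ->]; apply: aI.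
have central z a : s z -> lie_ser br k.+1 s a -> a * z = z * a.
  move=> sz sa; apply/eqP; rewrite eq_sym -subr_eq0; apply/eqP.
  rewrite -[LHS]mul1mx; apply/row_matrixP => i; rewrite row_mul row0.
  have /CP -> // : (row i 1%:M <= C)%MS by apply: submx_trans (row_sub _ _) C1.
  by exists z => //; exists a.
exfalso; suff: (k.+2 <= k.+1)%N by rewrite ltnn.
apply: kmin; apply/asboolP => a sa; apply/eqP/negPn/negP => a0.
have aU : a \is a GRing.unit.
  rewrite -[_ \is a _]/(a \in unitmx) -row_free_unit -kermx_eq0.
  apply/negPn/negP => /sI K; case/negP: a0; rewrite -[a]mul1mx.
  apply/eqP/sub_kermxP/K => z sz; apply/sub_kermxP.
  by rewrite -mulmxA [z *m a](esym (central _ _ sz sa)) mulmxA mulmx_ker mul0mx.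
have cV z : lie_ser br k s z -> a^-1 * z = z * a^-1.
  move=> /(lie_ser_sub brA sL) sz; apply: (can_inj (mulKr aU)).
  by rewrite mulVKr // mulrA (central z a sz sa) mulrK.
have := mxtrace_lie_der cV sa; rewrite divrr // mxtrace1 => /eqP.
by rewrite nat0.
Qed.

(** The identity matrix is a minimal stable subspace, to which [comm_nil_kill]
    applies since [s] is commutative. *)
Lemma irr_nil_zero x : (forall y, s y -> exists k, y ^+ k = 0) -> s x -> x = 0.
Proof.
move=> snil sx; rewrite -[LHS]mul1mx.
apply: (@comm_nil_kill F n s 1%:M _ _ _ _ x) => //.
- by rewrite -mxrank_eq0 mxrank1.
- by move=> y _; apply: submx1.
- by move=> U U0 sU _; apply: sI.
- by move=> a b sa sb; apply/eqP; rewrite -subr_eq0; apply/eqP/irr_solvable_abelian.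
exact: snil.
Qed.

End Irreducible.

(** A substitute for Lie's theorem over a field that need not be algebraically
    closed: on a minimal stable subspace the action is irreducible, hence
    abelian. *)
Lemma lie_mx_common_kernel (F : fieldType) n (s : set 'M[F]_n.+1) :
    [pchar F] =i pred0 ->
    lie_ring (@comm_br _) s -> lie_solvable (@comm_br _) s ->
  exists v : 'rV[F]_n.+1, [/\ v != 0,
    forall x, lie_der (@comm_br _) s x -> v *m x = 0 &
    (forall y, s y -> exists k, y ^+ k = 0) -> forall x, s x -> v *m x = 0].
Proof.
move=> F0 sL sS; have [A [A0 sA Amin]] := min_stablemx s (ltn0Sn n).
have [d [B [Bfree BA]]] : exists d (B : 'M[F]_(d.+1, n.+1)),
    row_free B /\ (B :=: A)%MS.
  have: \rank A != 0 by rewrite mxrank_eq0.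
  move: (row_base A) (row_base_free A) (eq_row_base A).
  by case: (\rank A) => // d B Bf BA _; exists d, B.
pose f (x : 'M[F]_n.+1) : 'M_d.+1 := B *m x *m pinvmx B.
have fB x : s x -> f x *m B = B *m x.
  by move=> sx; apply: mulmxKpV; rewrite (eqmxMr _ BA) BA sA.
have f0 : f 0 = 0 by rewrite /f mulmx0 mul0mx.
have fD x y : f (x + y) = f x + f y by rewrite /f mulmxDr mulmxDl.
have fN x : f (- x) = - f x by rewrite /f mulmxN mulNmx.
have fM x y : s x -> s y -> f (x * y) = f x * f y.
  move=> sx sy; transitivity (f x *m (B *m y *m pinvmx B)); last by [].
  by rewrite !mulmxA fB // /f -[x * y]/(x *m y) !mulmxA.
have fbr x y : s x -> s y -> f (comm_br x y) = comm_br (f x) (f y).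
  by move=> sx sy; rewrite /comm_br fD fN !fM.
pose s' := [set f x | x in s]%classic.
have brA := comm_br_lie 'M[F]_n.+1.
have s'L : lie_ring (@comm_br _) s'.
  case: (sL) => s0 sB sbr; split=> [|_ _ [x sx <-] [y sy <-]|_ _ [x sx <-] [y sy <-]].
  - by exists 0.
  - by exists (x - y); [apply: sB | rewrite fD fN].
  - by exists (comm_br x y); [apply: sbr | rewrite fbr].
have s'E k y := @lie_ser_image _ _ _ (@comm_br _) s f k y sL f0 (fun x y _ _ => fD x y) fbr brA.
have s'S : lie_solvable (@comm_br _) s'.
  by case: sS => k sk; exists k => y /s'E[x /sk -> ->].
have s'I (U : 'M[F]_d.+1) : U != 0 -> (forall x, s' x -> (U *m x <= U)%MS) ->
    (1%:M <= U)%MS.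
  move=> U0 sU; have AUB : (A <= <<U *m B>>)%MS.
    apply: Amin => [|x sx|].
    - by rewrite -mxrank_eq0 genmxE mxrank_eq0 (mulmx_free_eq0 _ Bfree).
    - rewrite (eqmxMr _ (genmxE _)) genmxE -mulmxA -fB // mulmxA.
      by apply: submxMr; apply: sU; exists x.
    - by rewrite genmxE -BA submxMl.
  have : (B <= U *m B)%MS by rewrite BA -(genmxE (U *m B)).
  case/submxP => D BE; apply/submxP; exists D; apply: (row_free_inj Bfree).
  by rewrite mul1mx -mulmxA.
have [i Bi] : exists i, row i B != 0.
  exists 0; apply/eqP => Bi0; have : delta_mx 0 0 *m B == 0 :> 'rV_n.+1.
    by rewrite -rowE Bi0.
  rewrite (mulmx_free_eq0 _ Bfree) => /eqP/matrixP/(_ 0 0).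
  by rewrite !mxE !eqxx => /eqP; rewrite oner_eq0.
exists (row i B); split=> //.
- move=> x0; elim=> [|x y w sx sy _ IH]; first by rewrite mulmx0.
  rewrite mulmxDr IH addr0 -row_mul -fB; last by case: sL => _ _; apply.
  rewrite fbr // (irr_solvable_abelian F0 s'L s'S s'I) ?mul0mx ?row0 //.
    by exists x.
  by exists y.
move=> snil x sx; rewrite -row_mul -fB //.
rewrite (irr_nil_zero F0 s'L s'S s'I _ (x := f x)) ?mul0mx ?row0 //; last by exists x.
move=> _ [y sy <-]; have [k yk] := snil y sy; exists k.
apply: (row_free_inj Bfree); rewrite mul0mx.
suff -> : f y ^+ k *m B = B *m y ^+ k by rewrite yk mulmx0.
elim: k {yk} => [|k IHk]; first by rewrite !expr0 mulmx1 mul1mx.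
by rewrite !exprSr -!mulmxE -mulmxA fB // mulmxA IHk mulmxA.
Qed.

(** * Solvable Lie rings of vector fields over a differential field *)

Section VectorFields.
Variables (K : fieldType) (n : nat) (d : 'I_n -> K -> K).
Hypothesis K0 : [pchar K] =i pred0.
Hypothesis dD : forall i f g, d i (f + g) = d i f + d i g.
Hypothesis dM : forall i f g, d i (f * g) = d i f * g + f * d i g.
Hypothesis dC : forall i j f, d i (d j f) = d j (d i f).
Implicit Types (u v w : 'rV[K]_n) (f g : K) (S : set 'rV[K]_n).

(** A row vector [u] stands for the vector field [sum_i u_i d_i]; the derivations
    [d_i] of [K] are abstract and commute. *)
Definition vf_act u f := \sum_i u 0 i * d i f.
Definition vf_br u v := \row_j (vf_act u (v 0 j) - vf_act v (u 0 j)).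

Lemma vf_actD u f g : vf_act u (f + g) = vf_act u f + vf_act u g.
Proof. by rewrite /vf_act -big_split; apply: eq_bigr => i _; rewrite dD mulrDr. Qed.

Lemma vf_act0 u : vf_act u 0 = 0.
Proof. by apply: (addrI (vf_act u 0)); rewrite -vf_actD !addr0. Qed.

Lemma vf_actN u f : vf_act u (- f) = - vf_act u f.
Proof. by apply: (addrI (vf_act u f)); rewrite -vf_actD !subrr vf_act0. Qed.

Lemma vf_actB u f g : vf_act u (f - g) = vf_act u f - vf_act u g.
Proof. by rewrite vf_actD vf_actN. Qed.

Lemma vf_act_sum u I (r : seq I) (G : I -> K) :
  vf_act u (\sum_(i <- r) G i) = \sum_(i <- r) vf_act u (G i).
Proof.
by elim: r => [|i r IHr]; rewrite ?big_nil ?vf_act0 // !big_cons vf_actD IHr.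
Qed.

Lemma vf_actM u f g : vf_act u (f * g) = vf_act u f * g + f * vf_act u g.
Proof.
rewrite /vf_act mulr_suml mulr_sumr -big_split; apply: eq_bigr => i _ /=.
by rewrite dM mulrDr mulrA mulrCA.
Qed.

Lemma vf_actDl u v f : vf_act (u + v) f = vf_act u f + vf_act v f.
Proof. by rewrite /vf_act -big_split; apply: eq_bigr => i _; rewrite mxE mulrDl. Qed.

Lemma vf_actZl a u f : vf_act (a *: u) f = a * vf_act u f.
Proof. by rewrite /vf_act mulr_sumr; apply: eq_bigr => i _; rewrite mxE mulrA. Qed.

Lemma vf_act_suml I (r : seq I) (G : I -> 'rV_n) f :
  vf_act (\sum_(i <- r) G i) f = \sum_(i <- r) vf_act (G i) f.
Proof.
elim: r => [|i r IHr]; last by rewrite !big_cons vf_actDl IHr.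
by rewrite !big_nil -(scale0r 0) vf_actZl mul0r.
Qed.

Lemma vf_act_br u v f :
  vf_act (vf_br u v) f = vf_act u (vf_act v f) - vf_act v (vf_act u f).
Proof.
have E a b : vf_act a (vf_act b f) =
    \sum_i vf_act a (b 0 i) * d i f + \sum_i \sum_j a 0 i * (b 0 j * d i (d j f)).
  rewrite {2}/vf_act vf_act_sum.
  under eq_bigr do rewrite vf_actM; rewrite big_split; congr (_ + _) => /=.
  rewrite exchange_big; apply: eq_bigr => j _; rewrite mulr_sumr.
  by apply: eq_bigr => i _; rewrite mulrCA.
rewrite !E [X in _ - (_ + X)]exchange_big /=.
rewrite [X in _ - (_ + X)](_ : _ = \sum_i \sum_j u 0 i * (v 0 j * d i (d j f))).
  rewrite opprD addrACA subrr addr0 -sumrB; apply: eq_bigr => i _.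
  by rewrite !mxE mulrBl.
by apply: eq_bigr => i _; apply: eq_bigr => j _; rewrite dC mulrCA.
Qed.

Lemma vf_br_lie : lie_axioms vf_br.
Proof.
split=> [u v w|u v|u v w]; apply/rowP => j; rewrite !mxE.
- by rewrite vf_actDl vf_actD opprD addrACA.
- by rewrite opprB.
by rewrite !vf_act_br !vf_actB; ring.
Qed.

Let brA := vf_br_lie.

Lemma vf_brZr u a v : vf_br u (a *: v) = vf_act u a *: v + a *: vf_br u v.
Proof.
apply/rowP => j; rewrite !mxE vf_actM vf_actZl; ring.
Qed.

Lemma vf_br_sumr u I (r : seq I) (G : I -> 'rV_n) :
  vf_br u (\sum_(i <- r) G i) = \sum_(i <- r) vf_br u (G i).
Proof.
elim: r => [|i r IHr]; last by rewrite !big_cons (lie_brDr brA) IHr.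
by rewrite !big_nil (lie_br0r brA).
Qed.

Lemma vf_br_mulmx u e (x : 'rV_e) (Y : 'M_(e, n)) :
  vf_br u (x *m Y) = (\row_i vf_act u (x 0 i)) *m Y +
    \sum_i x 0 i *: vf_br u (row i Y).
Proof.
rewrite !mulmx_sum_row vf_br_sumr -big_split; apply: eq_bigr => i _ /=.
by rewrite vf_brZr mxE.
Qed.

Lemma vf_act_mulmx e (x : 'rV_e) (Y : 'M_(e, n)) f :
  vf_act (x *m Y) f = \sum_i x 0 i * vf_act (row i Y) f.
Proof.
rewrite mulmx_sum_row vf_act_suml; apply: eq_bigr => i _.
by rewrite vf_actZl.
Qed.

(** The rows of [Y] complement a subspace of vector fields and [C] computes
    coordinates along them; the entries are the derivatives of the coordinates of
    [Z] along the [Y k], that is the linear part of [Z] as an affine vector field. *)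
Definition vf_lin e (Y : 'M[K]_(e, n)) (C : 'M_(n, e)) (Z : 'rV_n) : 'M_e :=
  \matrix_(k, i) vf_act (row k Y) ((Z *m C) 0 i).

(** [S] acts on its span modulo [W] by affine vector fields: [C] reads off the
    coordinates [f] of [Z] along [Y], which behave as affine functions whose linear
    part [vf_lin Y C Z] is annihilated by [S] and depends on [Z] through a morphism
    of Lie rings. *)
Record affine_model S e (Y : 'M[K]_(e, n)) m (W : 'M[K]_(m, n)) (C : 'M_(n, e)) :=
  AffineModel {
  am_mem : forall k, S (row k Y);
  am_free : forall a : 'rV_e, (a *m Y <= W)%MS -> a = 0;
  am_coord : forall Z, S Z -> (Z - Z *m C *m Y <= W)%MS;
  am_stable : forall Z w, S Z -> (w <= W)%MS -> (vf_br Z w <= W)%MS;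
  am_br : forall Z k, S Z ->
    (vf_br (row k Y) Z - row k (vf_lin Y C Z) *m Y <= W)%MS;
  am_const : forall Z k i u, S Z -> S u -> vf_act u (vf_lin Y C Z k i) = 0;
  am_brC : forall Z Z', S Z -> S Z' ->
    vf_br Z Z' *m C = Z *m C *m vf_lin Y C Z' - Z' *m C *m vf_lin Y C Z;
  am_lin_br : forall Z Z', S Z -> S Z' -> vf_lin Y C (vf_br Z Z') =
    vf_lin Y C Z *m vf_lin Y C Z' - vf_lin Y C Z' *m vf_lin Y C Z }.

Lemma span_ind S m (W : 'M[K]_(m, n)) (Q : set 'rV_n) :
    (forall k, S (row k W)) -> Q 0 -> (forall a u v, Q u -> Q v -> Q (a *: u + v)) ->
    (forall u, S u -> Q u) ->
  forall w, (w <= W)%MS -> Q w.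
Proof.
move=> SW Q0 QD SQ w /submxP[D ->]; rewrite mulmx_sum_row.
elim/big_ind: _ => // [u v Qu Qv|i _]; first by rewrite -[u]scale1r; apply: QD.
by rewrite -[_ *: _]addr0; apply: QD => //; apply: SQ.
Qed.

(** [W] is the span of the first derived algebra whose span is not that of [S],
    and [Y] is taken in the previous one, [S_j].  Brackets of two elements of [S_j]
    lie in [W], and [W] is stable under [S] because derived algebras are ideals.
    Comparing coefficients of [Y] in [[Y_k, Z]] shows that [W] annihilates the
    coordinates of elements of [S] and that elements of [S_j] have zero linear
    part; since [[Y_k, Z]] is in [S_j], the linear part of [Z] is annihilated by
    [S]. *)
Lemma affine_modelP S : lie_ring vf_br S -> lie_solvable vf_br S ->
    (exists2 u, S u & u != 0) ->
  exists e (Y : 'M[K]_(e.+1, n)) m (W : 'M[K]_(m, n)) C, affine_model S Y W C.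
Proof.
move=> SL [l Sl] [u0 Su0 u0N].
pose spans k := forall m (B : 'M[K]_(m, n)),
  (forall v, lie_ser vf_br k S v -> (v <= B)%MS) -> forall u, S u -> (u <= B)%MS.
have ex : exists k, ~~ `[< spans k >].
  exists l; apply/negP => /asboolP/(_ 0%N 0)H; case/negP: u0N.
  by rewrite -submx0; apply: submx_trans (H _ _ Su0) (sub0mx _ _) => v /Sl ->; apply: sub0mx.
case: (ex_minnP ex) => -[|j] /asboolPn nsp jmin; first by case: nsp => m B; apply.
have sp : spans j by apply/asboolP/negPn/negP => /jmin; rewrite ltnn.
have [m [W [SW _ subW]]] := basis_mod (lie_ser vf_br j.+1 S) (0 : 'M[K]_(0, n)).
have {}subW v : lie_ser vf_br j.+1 S v -> (v <= W)%MS.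
  by move=> /subW; rewrite -addsmxE addsmx0.
have [e [Y [SY YW subY]]] := basis_mod (lie_ser vf_br j S) W.
have jS v : lie_ser vf_br j S v -> S v by apply: (lie_ser_sub brA).
have j1S v : lie_ser vf_br j.+1 S v -> S v by apply: (lie_ser_sub brA).
have {}SL := SL; have [S0 SB Sbr] := SL.
case: e Y YW SY subY => [|e] Y YW SY subY.
  case: nsp => k B jB; apply: sp => v /subY.
  rewrite -addsmxE (flatmx0 Y) adds0mx => /submx_trans; apply.
  by apply/row_subP => i; apply: jB.
have free (a : 'rV_e.+1) : (a *m Y <= W)%MS -> a = 0.
  move=> aYW; have := mxrank_sum_cap Y W; rewrite addsmxE YW => H.
  have rY : \rank Y = e.+1.
    apply/eqP; rewrite eqn_leq rank_leq_row /= -(leq_add2r (\rank W)) -H leq_addr //.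
  move/eqP: H; rewrite rY -[X in _ == X]addn0 eqn_add2l mxrank_eq0 => /eqP cap0.
  have : (a *m Y <= (Y :&: W))%MS by rewrite sub_capmx submxMl.
  rewrite cap0 submx0 mulmx_free_eq0; first by move/eqP.
  by rewrite /row_free rY.
pose C := lsubmx (pinvmx (col_mx Y W)); exists e, Y, m, W, C.
have coord Z : S Z -> (Z - Z *m C *m Y <= W)%MS.
  move=> /(sp _ _ subY)/mulmxKpV; rewrite -{1}[Z *m _]hsubmxK mul_row_col.
  rewrite -mulmx_lsub; set r := rsubmx _ => E.
  have -> : Z - Z *m C *m Y = r *m W by rewrite -{1}E addrC addKr.
  exact: submxMl.
have stable Z w : S Z -> (w <= W)%MS -> (vf_br Z w <= W)%MS.
  move=> SZ wW; suff [] : (w <= W)%MS /\ (vf_br Z w <= W)%MS by [].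
  move: w wW; apply: (@span_ind (lie_ser vf_br j.+1 S)) => //.
  - by rewrite (lie_br0r brA) sub0mx.
  - move=> a u v [uW bu] [vW bv]; rewrite (lie_brDr brA) vf_brZr.
    by rewrite !(addmx_sub, scalemx_sub).
  by move=> u Su; split; apply: subW => //; apply: (lie_ser_ideal brA).
(* brackets modulo [W]: only the coefficients along [Y] get differentiated *)
have key u Z : S u -> S Z -> (vf_br u Z - (\row_i vf_act u ((Z *m C) 0 i)) *m Y -
    \sum_i (Z *m C) 0 i *: vf_br u (row i Y) <= W)%MS.
  move=> Su SZ; rewrite -addrA -opprD -vf_br_mulmx -(lie_brBr brA).
  by apply: stable => //; apply: coord.
have uniq a u : (u - a *m Y <= W)%MS -> (u <= W)%MS -> a = 0.
  move=> auW uW; apply: free; rewrite -[_ *m _](subKr u).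
  by rewrite addmx_sub // -scaleN1r scalemx_sub.
have actW w Z i : (w <= W)%MS -> S Z -> vf_act w ((Z *m C) 0 i) = 0.
  move=> wW SZ; move: w wW i; apply: (@span_ind (lie_ser vf_br j.+1 S)) => //.
  - by move=> i; rewrite -(scale0r 0) vf_actZl mul0r.
  - by move=> a u v Hu Hv i; rewrite vf_actDl vf_actZl Hu Hv mulr0 addr0.
  move=> u Su i; have uS := j1S u Su; have := key u Z uS SZ.
  set a := \row_i _; move=> H; suff /rowP/(_ i) : a = 0 by rewrite !mxE.
  apply: (uniq a (vf_br u Z)); last first.
    by rewrite (lie_brC brA) -scaleN1r scalemx_sub // subW //; apply: (lie_ser_ideal brA).
  rewrite -[X in (X <= _)%MS](subrK (\sum_i (Z *m C) 0 i *: vf_br u (row i Y))).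
  rewrite addmx_sub // summx_sub // => k _; rewrite scalemx_sub //.
  rewrite (lie_brC brA) -scaleN1r scalemx_sub // subW //.
  by apply: (lie_ser_ideal brA) => //; apply: jS.
have br Z k : S Z -> (vf_br (row k Y) Z - row k (vf_lin Y C Z) *m Y <= W)%MS.
  move=> SZ; have := key (row k Y) Z (jS _ (SY k)) SZ.
  have -> : row k (vf_lin Y C Z) = \row_i vf_act (row k Y) ((Z *m C) 0 i).
    by apply/rowP => i; rewrite !mxE.
  move=> H; rewrite -[X in (X <= _)%MS](subrK (\sum_i (Z *m C) 0 i *: vf_br (row k Y) (row i Y))).
  rewrite addmx_sub // summx_sub // => i _; rewrite scalemx_sub // subW //.
  by apply: lie_der_br; apply: SY.
have coordE a u : S u -> (u - a *m Y <= W)%MS -> u *m C = a.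
  move=> Su au; apply/eqP; rewrite -subr_eq0; apply/eqP/free.
  rewrite mulmxBl -[X in (X <= _)%MS](subrKA u).
  rewrite addmx_sub //.
  by rewrite -opprB -scaleN1r scalemx_sub // coord.
have jlin Z : lie_ser vf_br j S Z -> vf_lin Y C Z = 0.
  move=> SZ; apply/row_matrixP => k; rewrite row0.
  by apply: uniq (br Z k (jS _ SZ)) _; apply: subW; apply: lie_der_br; first exact: SY.
(* a function annihilated by [Y] and [W] is annihilated by [S] *)
have act0 u f : S u -> (forall k, vf_act (row k Y) f = 0) ->
    (forall w, (w <= W)%MS -> vf_act w f = 0) -> vf_act u f = 0.
  move=> Su Yf Wf; rewrite -[u](subrK (u *m C *m Y)) vf_actDl Wf ?coord // add0r.
  by rewrite vf_act_mulmx big1 // => k _; rewrite Yf mulr0.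
have linC Z k i : S Z -> vf_lin Y C Z k i = (vf_br (row k Y) Z *m C) 0 i.
  move=> SZ; have Sb : S (vf_br (row k Y) Z) by apply: (Sbr _ _ (jS _ (SY k)) SZ).
  by rewrite (coordE _ _ Sb (br Z k SZ)) [RHS]mxE.
have const Z k i u : S Z -> S u -> vf_act u (vf_lin Y C Z k i) = 0.
  move=> SZ Su; have jZ : lie_ser vf_br j S (vf_br (row k Y) Z).
    by rewrite (lie_brC brA); apply: (lie_ringN (lie_ser_ring brA j SL));
       apply: (lie_ser_ideal brA).
  rewrite linC //; apply: act0 => // [k'|w wW].
    by have /matrixP/(_ k' i) := jlin _ jZ; rewrite !mxE.
  by apply: actW => //; apply: jS.
have actlin Z Z' i : S Z -> S Z' ->
    vf_act Z ((Z' *m C) 0 i) = (Z *m C *m vf_lin Y C Z') 0 i.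
  move=> SZ SZ'; rewrite -{1}[Z](subrK (Z *m C *m Y)) vf_actDl actW ?coord // add0r.
  by rewrite vf_act_mulmx !mxE; apply: eq_bigr => k _; rewrite !mxE.
have brC Z Z' : S Z -> S Z' ->
    vf_br Z Z' *m C = Z *m C *m vf_lin Y C Z' - Z' *m C *m vf_lin Y C Z.
  move=> SZ SZ'; apply: coordE; first exact: Sbr.
  have aE : \row_i vf_act Z ((Z' *m C) 0 i) = Z *m C *m vf_lin Y C Z'.
    by apply/rowP => i; rewrite mxE actlin.
  have bE : ((\sum_i (Z' *m C) 0 i *: vf_br Z (row i Y) +
      Z' *m C *m vf_lin Y C Z *m Y)%R <= W)%MS.
    rewrite -(mulmxA (Z' *m C)) [X in _ + X]mulmx_sum_row -big_split.
    apply: summx_sub => i _ /=; rewrite row_mul -scalerDr scalemx_sub //.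
    rewrite (lie_brC brA (row i Y) Z) addrC -opprB -scaleN1r scalemx_sub //.
    exact: br.
  have := addmx_sub (key Z Z' SZ SZ') bE; rewrite aE addrA subrK.
  by rewrite mulmxBl opprB addrA addrAC.
have lin_br Z Z' : S Z -> S Z' -> vf_lin Y C (vf_br Z Z') =
    vf_lin Y C Z *m vf_lin Y C Z' - vf_lin Y C Z' *m vf_lin Y C Z.
  move=> SZ SZ'; apply/matrixP => k i; rewrite mxE brC // !mxE vf_actB !vf_act_sum.
  rewrite -[in RHS]sumrN -!big_split -sumrB /=; apply: eq_bigr => a _.
  have YS := jS _ (SY k).
  by rewrite !vf_actM !const // !mulr0 !addr0 !mxE.
by split=> // k; apply/jS/SY.
Qed.

Definition rank_le S r :=
  exists2 B : 'M[K]_n, (\rank B <= r)%N & forall v, S v -> (v <= B)%MS.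

Lemma vf_linD e (Y : 'M[K]_(e, n)) C Z Z' :
  vf_lin Y C (Z + Z') = vf_lin Y C Z + vf_lin Y C Z'.
Proof. by apply/matrixP => k i; rewrite [LHS]mxE mulmxDl [X in vf_act _ X]mxE vf_actD [RHS]mxE; congr (_ + _); rewrite [RHS]mxE. Qed.

Lemma vf_lin0 e (Y : 'M[K]_(e, n)) C : vf_lin Y C 0 = 0.
Proof. by apply/matrixP => k i; rewrite [LHS]mxE mul0mx [X in vf_act _ X]mxE vf_act0 mxE. Qed.

(** The coordinates along [Y] are independent on the span of [S], so a nonzero
    linear relation between them lowers the rank. *)
Lemma affine_hyperplane S T e (Y : 'M[K]_(e.+1, n)) m (W : 'M[K]_(m, n)) C r
    (l : 'cV_e.+1) :
    lie_ring vf_br S -> affine_model S Y W C -> l != 0 -> rank_le S r.+1 ->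
    (forall Z, T Z -> S Z /\ Z *m C *m l = 0) ->
  rank_le T r.
Proof.
move=> SL AM l0 [B rB SB] Tl; exists (B :&: kermx (C *m l))%MS; last first.
  move=> Z /Tl[SZ Zl]; rewrite sub_capmx SB //=; apply/sub_kermxP.
  by rewrite mulmxA.
have YC : Y *m C = 1%:M.
  apply/row_matrixP => k; apply/eqP; rewrite -subr_eq0; apply/eqP/(am_free AM).
  have -> : (row k (Y *m C) - row k 1%:M) *m Y = -1 *: (row k Y - row k Y *m C *m Y).
    by rewrite scaleN1r opprB mulmxBl !row_mul row1 -rowE.
  exact/scalemx_sub/(am_coord AM (am_mem AM k)).
rewrite -ltnS; apply: leq_trans rB; apply: rank_ltmx; rewrite ltmxE capmxSl.
apply/negP => H; case/eqP: l0; rewrite -[l]mul1mx -YC -mulmxA.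
apply/sub_kermxP/(submx_trans _ (capmxSr B _))/(submx_trans _ H).
by apply/row_subP => k; apply/SB/(am_mem AM).
Qed.

Lemma rank_le_sub S T r : (forall u, T u -> S u) -> rank_le S r -> rank_le T r.
Proof. by move=> TS [B rB SB]; exists B => // v /TS/SB. Qed.

Lemma rank_le_zero S r : (forall u, S u -> u = 0) -> rank_le S r.
Proof. by move=> S0; exists 0; rewrite ?mxrank0 // => v /S0 ->; rewrite sub0mx. Qed.

Lemma zero_or S : (exists2 u, S u & u != 0) \/ (forall u, S u -> u = 0).
Proof.
have [[u Su u0]|H] := pselect (exists2 u, S u & u != 0); first by left; exists u.
by right=> u Su; apply/eqP/negPn/negP => u0; apply: H; exists u.
Qed.

(** [Z |-> - (vf_lin Y C Z)^T] is a morphism of Lie rings, to which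
    [lie_mx_common_kernel] applies; transposing turns row kernels into column
    kernels. *)
Lemma affine_kernel S e (Y : 'M[K]_(e.+1, n)) m (W : 'M[K]_(m, n)) C :
    lie_ring vf_br S -> lie_solvable vf_br S -> affine_model S Y W C ->
  exists l : 'cV_e.+1, [/\ l != 0,
    forall Z, lie_der vf_br S Z -> vf_lin Y C Z *m l = 0 &
    (forall Z, S Z -> exists k, vf_lin Y C Z ^+ k = 0) ->
      forall Z, S Z -> vf_lin Y C Z *m l = 0].
Proof.
move=> SL SS AM; pose f Z := - (vf_lin Y C Z)^T.
have f0 : f 0 = 0 by rewrite /f vf_lin0 trmx0 oppr0.
have fD u v : S u -> S v -> f (u + v) = f u + f v.
  by rewrite /f vf_linD linearD opprD.
have fN u : S u -> f (- u) = - f u.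
  move=> Su; apply: (addrI (f u)); rewrite -fD ?subrr //.
  exact: (lie_ringN SL).
have fbr u v : S u -> S v -> f (vf_br u v) = comm_br (f u) (f v).
  move=> Su Sv; rewrite /f (am_lin_br AM Su Sv) linearB /= !trmx_mul opprB.
  by rewrite /comm_br -!mulmxE !mulNmx !mulmxN !opprK.
have fE k y := @lie_ser_image _ _ _ (@comm_br _) S f k y SL f0 fD fbr brA.
have [||v [v0 vder vnil]] := @lie_mx_common_kernel K e [set f Z | Z in S]%classic K0.
- case: (SL) => S0 SB Sbr.
  split=> [|_ _ [x sx <-] [y sy <-]|_ _ [x sx <-] [y sy <-]].
  + by exists 0.
  + exists (x - y); first exact: SB.
    by rewrite fD ?fN //; apply: (lie_ringN SL).
  + by exists (vf_br x y); [apply: Sbr | rewrite fbr].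
- by case: SS => k Sk; exists k => y /fE[x /Sk -> ->].
have tr Z : v *m f Z = 0 -> vf_lin Y C Z *m v^T = 0.
  rewrite /f mulmxN => /eqP; rewrite oppr_eq0 => /eqP H; apply: trmx_inj.
  by rewrite trmx_mul trmxK trmx0.
exists v^T; split.
- by apply: contraNneq v0 => /(congr1 trmx); rewrite trmxK trmx0 => ->.
- by move=> Z SZ; apply: tr; apply: vder; apply/(fE 1%N); exists Z.
move=> Znil Z SZ; apply/tr/vnil; last by exists Z.
move=> _ [Z' SZ' <-]; have [k Zk] := Znil _ SZ'; exists k.
rewrite /f -scaleN1r exprZn; suff -> : (vf_lin Y C Z')^T ^+ k = (vf_lin Y C Z' ^+ k)^T.
  by rewrite Zk trmx0 scaler0.
elim: k {Zk} => [|k IHk]; first by rewrite !expr0 trmx1.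
by rewrite exprS exprSr IHk -!mulmxE trmx_mul.
Qed.

(** A solvable Lie ring of vector fields acts on a quotient of its span through
    affine maps.  A linear form that is killed by the commutators of the linear
    parts vanishes on the second derived ring, whose span is thus smaller. *)
Lemma rank_drop S r : lie_ring vf_br S -> lie_solvable vf_br S ->
  rank_le S r.+1 -> rank_le (lie_ser vf_br 2 S) r.
Proof.
move=> SL SS rS; have [/(affine_modelP SL SS)[e [Y [m [W [C AM]]]]]|S0] := zero_or S; last first.
  by apply: rank_le_zero => u /(lie_ser_sub brA SL)/S0.
have [l [l0 lder _]] := affine_kernel SL SS AM.
apply: (affine_hyperplane SL AM l0 rS) => Z SZ; split; first exact: (lie_ser_sub brA SL SZ).
elim: SZ => [|u v w Su Sv _ IH]; first by rewrite !mul0mx.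
have [Su' Sv'] : S u /\ S v by split; apply: (lie_der_sub SL).
rewrite !mulmxDl IH addr0 (am_brC AM Su' Sv') mulmxBl -!mulmxA.
by rewrite !lder // !mulmx0 subrr.
Qed.

(** Nilpotency of the adjoint action on the finite-dimensional quotients whose
    structure constants are constants of the differential field. *)
Definition ad_nilpotent S := forall e (Y : 'M[K]_(e.+1, n)) m (W : 'M[K]_(m, n)) Z
    (L : 'M[K]_e.+1),
  S Z -> (forall k, S (row k Y)) -> (forall a : 'rV_e.+1, (a *m Y <= W)%MS -> a = 0) ->
  (forall w, (w <= W)%MS -> (vf_br Z w <= W)%MS) ->
  (forall k, (vf_br Z (row k Y) - row k L *m Y <= W)%MS) ->
  (forall k i j, d j (L k i) = 0) -> exists k, L ^+ k = 0.

(** At rank [n] the elements of [S] span all derivations, so whatever they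
    annihilate is constant.  This makes the linear parts eligible for
    [ad_nilpotent]; being nilpotent, they have a common kernel vector themselves,
    not just their commutators. *)
Lemma rank_drop_nil S r : lie_ring vf_br S -> lie_solvable vf_br S ->
    ad_nilpotent S -> n = r.+1 ->
  rank_le (lie_ser vf_br 1 S) r.
Proof.
move=> SL SS SN nr.
have [/(affine_modelP SL SS)[e [Y [m [W [C AM]]]]]|S0] := zero_or S; last first.
  by apply: rank_le_zero => u /(lie_ser_sub brA SL)/S0.
have [b [B [SB rB subB]]] := basis_mod S (0 : 'M[K]_(0, n)).
have {}rB : \rank B = b by rewrite -[RHS]addn0 -(mxrank0 K 0 n) -rB -addsmxE addsmx0.
have {}subB v : S v -> (v <= B)%MS by move=> /subB; rewrite -addsmxE addsmx0.
have [br|br] := leqP b r.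
  apply: (@rank_le_sub S) => [u|]; first exact: (@lie_ser_sub _ _ brA 1).
  by exists (<<B>>)%MS => [|v /subB]; rewrite genmxE ?rB.
have Bfull u : (u <= B)%MS.
  by apply: submx_full; rewrite /row_full rB eqn_leq nr br -{1}rB -nr rank_leq_col.
have rS : rank_le S r.+1.
  by exists (<<B>>)%MS => [|v /subB]; rewrite genmxE // -nr rank_leq_col.
have const f : (forall u, S u -> vf_act u f = 0) -> forall i, d i f = 0.
  move=> Sf i; have <- : vf_act (delta_mx 0 i) f = d i f.
    rewrite /vf_act (bigD1 i) //= mxE !eqxx mul1r big1 ?addr0 // => j ji.
    by rewrite mxE (negPf ji) andbF mul0r.
  move: (delta_mx 0 i) (Bfull (delta_mx 0 i)).
  apply: (@span_ind S) => //; first by rewrite -(scale0r 0) vf_actZl mul0r.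
  by move=> a u v Hu Hv; rewrite vf_actDl vf_actZl Hu Hv mulr0 addr0.
have [l [l0 _ lnil]] := affine_kernel SL SS AM.
have {}lnil Z : S Z -> vf_lin Y C Z *m l = 0.
  apply: lnil => {}Z SZ; have [|||||k Lk] := SN e Y m W Z (- vf_lin Y C Z) SZ.
  - exact: am_mem AM.
  - exact: am_free AM.
  - by move=> w; apply: (am_stable AM).
  - move=> k; rewrite linearN /= mulNmx opprK (lie_brC brA) addrC -opprB.
    by rewrite -scaleN1r scalemx_sub // (am_br AM).
  - move=> k i j; apply: const => u Su; rewrite mxE vf_actN.
    by rewrite (am_const AM) ?oppr0.
  by exists k; rewrite -[vf_lin _ _ _]opprK -scaleN1r exprZn Lk scaler0.
apply: (affine_hyperplane SL AM l0 rS) => Z SZ; split; first exact: (lie_der_sub SL SZ).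
elim: SZ => [|u v w Su Sv _ IH]; first by rewrite !mul0mx.
by rewrite !mulmxDl IH addr0 (am_brC AM Su Sv) mulmxBl -!mulmxA !lnil // !mulmx0 subrr.
Qed.

Lemma lie_ser_add j k S : lie_ser vf_br j (lie_ser vf_br k S) = lie_ser vf_br (j + k) S.
Proof. by rewrite /lie_ser iterD. Qed.

(** Either the rank is at most [n - 1] from the start or it is after one step;
    then two steps for each further unit of rank. *)
Theorem vf_solvable_length S : (0 < n)%N -> lie_ring vf_br S ->
    lie_solvable vf_br S -> ad_nilpotent S ->
  forall u, lie_ser vf_br (2 * n - 1) S u -> u = 0.
Proof.
move=> n0 SL SS SN u.
have ser_solv k : lie_solvable vf_br (lie_ser vf_br k S).
  case: SS => l Sl; exists l => v; rewrite lie_ser_add => Sv; apply: Sl.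
  exact: (lie_ser_leq brA (leq_addr k l) SL Sv).
have drop k r : rank_le (lie_ser vf_br k S) r ->
    rank_le (lie_ser vf_br (2 * r + k) S) 0.
  elim: r k => [|r IHr] k; first by rewrite muln0.
  move=> /(rank_drop (lie_ser_ring brA k SL) (ser_solv k)).
  by rewrite lie_ser_add => /IHr; rewrite mulnSr addnA.
have nr : n = n.-1.+1 by rewrite prednK.
have := drop 1%N _ (rank_drop_nil SL SS SN nr).
have -> : (2 * n.-1 + 1 = 2 * n - 1)%N by rewrite {2}nr mulnS -addnBAC // addnC.
case=> B; rewrite leqn0 mxrank_eq0 => /eqP -> BS /BS; by rewrite submx0 => /eqP.
Qed.

End VectorFields.

(** * Exponential, logarithm and the Campbell-Hausdorff formula *)

(** A decreasing multiplicative filtration with [P N = 0] and the inverses of the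
    positive integers, as given by a flag on matrices: [P 1] consists of nilpotent
    elements and every series below is a finite sum.  [q k] is the inverse of
    [k + 1]; only these scalars enter the series, so that the same statements apply
    to a ring and to the polynomials over it. *)
Record nilfilter (R : nzRingType) (q : nat -> R) (P : nat -> set R) (N : nat) :=
  NilFilter {
  nf_q : forall k, q k * k.+1%:R = 1;
  nf_qC : forall k x, q k * x = x * q k;
  nf_q0 : forall k, P 0%N (q k);
  nf_1 : P 0%N 1;
  nf_0 : forall d, P d 0;
  nf_D : forall d x y, P d x -> P d y -> P d (x + y);
  nf_N : forall d x, P d x -> P d (- x);
  nf_M : forall d e x y, P d x -> P e y -> P (d + e)%N (x * y);
  nf_S : forall d x, P d.+1 x -> P d x;
  nf_nil : forall x, P N x -> x = 0 }.

Lemma sum_conv (R : nzRingType) N (a b : nat -> R) :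
    (forall i j, (N <= i + j)%N -> a i * b j = 0) ->
  (\sum_(i < N) a i) * (\sum_(j < N) b j) =
    \sum_(k < N) \sum_(i < k.+1) a i * b (k - i)%N.
Proof.
move=> ab0; pose p (c : nat -> R) := \poly_(i < N) c i.
have ev (c : nat -> R) : \sum_(i < N) c i = (p c).[1].
  by rewrite horner_poly; apply: eq_bigr => i _; rewrite expr1n mulr1.
have c1 : comm_poly (p b) 1 by rewrite /comm_poly mulr1 mul1r.
rewrite !ev -hornerM_comm //.
have -> : p a * p b = \poly_(k < N) \sum_(i < k.+1) a i * b (k - i)%N.
  apply/polyP => k; rewrite coefM coef_poly.
  have [kN|Nk] := ltnP k N.
    apply: eq_bigr => i _; rewrite !coef_poly (leq_ltn_trans (leq_subr _ _) kN).
    by rewrite (leq_ltn_trans _ kN) // -ltnS.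
  apply: big1 => i _; rewrite !coef_poly.
  case: ifP => _; last by rewrite mul0r.
  case: ifP => _; last by rewrite mulr0.
  by rewrite ab0 // subnKC // -ltnS.
by rewrite horner_poly; apply: eq_bigr => k _; rewrite expr1n mulr1.
Qed.

Section Exponential.
Variables (R : nzRingType) (q : nat -> R) (P : nat -> set R) (N : nat).
Hypothesis NF : nilfilter q P N.
Implicit Types (x y z u : R).

Fixpoint ifact k : R := if k is k'.+1 then q k' * ifact k' else 1.

Definition ex x : R := \sum_(k < N) ifact k * x ^+ k.

Lemma ifactS k : ifact k.+1 = q k * ifact k. Proof. by []. Qed.

Lemma ifactC k x : ifact k * x = x * ifact k.
Proof.
elim: k => [|k IHk] /=; first by rewrite mul1r mulr1.
by rewrite -mulrA IHk !mulrA (nf_qC NF).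
Qed.

Lemma ifactE k : ifact k * k`!%:R = 1.
Proof.
elim: k => [|k IHk] /=; first by rewrite mulr1.
by rewrite factS natrM mulrA -[q k * _ * _]mulrA ifactC mulrA (nf_q NF) mul1r.
Qed.

Lemma ifact_bin k j : (j <= k)%N -> ifact k *+ 'C(k, j) = ifact j * ifact (k - j).
Proof.
move=> jk; rewrite -[RHS]mulr1 -(ifactE k) -(bin_fact jk) !natrM -[LHS]mulr_natr.
have E : ifact j * ifact (k - j) * (j`!%:R * (k - j)`!%:R) = 1.
  rewrite mulrA -[_ * _ * j`!%:R]mulrA [ifact (k - j) * _]ifactC mulrA ifactE mul1r.
  exact: ifactE.
set A := ifact j * _ in E *; set B := j`!%:R * _ in E *.
have AC x : A * x = x * A by rewrite /A -!mulrA ifactC -mulrA ifactC mulrA.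
clearbody A B.
by rewrite [RHS]AC -!mulrA -(AC B) E mulr1.
Qed.

Lemma nf_leq d e x : (d <= e)%N -> P e x -> P d x.
Proof.
move=> /subnK <-; elim: (e - d)%N => [//|k IHk]; rewrite addSn => /(nf_S NF).
exact: IHk.
Qed.

Lemma nf_X d x k : P d x -> P (k * d)%N (x ^+ k).
Proof.
move=> Px; elim: k => [|k IHk]; first by rewrite expr0; apply: (nf_1 NF).
by rewrite exprS mulSn; apply: (nf_M NF).
Qed.

Lemma nf_X1 x k : P 1%N x -> P k (x ^+ k).
Proof. by move=> Px; rewrite -[k in P k]muln1; apply: nf_X. Qed.

Lemma nf_ifact k : P 0%N (ifact k).
Proof.
elim: k => [|k IHk] /=; first exact: (nf_1 NF).
exact: (@nf_M _ _ _ _ NF 0 0 _ _ (nf_q0 NF k) IHk).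
Qed.

Lemma nf_cM d c x : P 0%N c -> P d x -> P d (c * x).
Proof. exact: (@nf_M _ _ _ _ NF 0 d). Qed.

Lemma nf_sum d I (r : seq I) (Q : pred I) (G : I -> R) :
  (forall i, Q i -> P d (G i)) -> P d (\sum_(i <- r | Q i) G i).
Proof. by move=> PG; elim/big_ind: _ => //; [apply: (nf_0 NF) | apply: (nf_D NF)]. Qed.

Lemma nf_big0 d x : (N <= d)%N -> P d x -> x = 0.
Proof. by move=> Nd Px; apply/(nf_nil NF)/(nf_leq Nd). Qed.

Lemma nf_N0 : (0 < N)%N.
Proof.
rewrite lt0n; apply/negP => /eqP N0; have := nf_1 NF; rewrite -{1}N0 => /(nf_nil NF)/eqP.
by rewrite oner_eq0.
Qed.

Lemma ex0 : ex 0 = 1.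
Proof.
rewrite /ex; case: N nf_N0 => // M _; rewrite big_ord_recl expr0 mulr1 big1 ?addr0 //.
by move=> i _; rewrite expr0n mulr0.
Qed.

Lemma ex_pad x : P 1%N x -> ex x = \sum_(k < N.+2) ifact k * x ^+ k.
Proof.
move=> Px; have xz k : (N <= k)%N -> x ^+ k = 0.
  by move=> Nk; apply: (@nf_big0 k) => //; apply: nf_X1.
by rewrite !big_ord_recr /= !xz // ?mulr0 ?addr0 // exprS xz ?mulr0.
Qed.

(** The terms of degree at least two have depth at least [2 (d + 1)]. *)
Lemma ex1 x d : P d.+1 x -> P (d.+1 + d.+1)%N (ex x - 1 - x).
Proof.
move=> Px; rewrite ex_pad; last exact: nf_leq Px.
rewrite !big_ord_recl /= expr0 mulr1 [q 0]((_ : _ = 1)); last first.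
  by rewrite -[LHS]mulr1 (nf_q NF 0).
rewrite !mul1r expr1 [1 + _]addrC addrK addrC addKr.
apply: nf_sum => i _; apply: nf_cM; first exact: (nf_ifact i.+2).
apply: (@nf_leq _ (i.+2 * d.+1)); last exact: (nf_X i.+2 Px).
by rewrite !mulSn addnA leq_addr.
Qed.

Lemma ex_sub1 x d : P d.+1 x -> P d.+1 (ex x - 1).
Proof.
move=> Px; rewrite -[_ - 1](subrK x); apply: (nf_D NF) => //.
by apply: nf_leq (ex1 Px); rewrite leq_addr.
Qed.

Lemma ex_add x y : P 1%N x -> P 1%N y -> x * y = y * x -> ex (x + y) = ex x * ex y.
Proof.
move=> Px Py xy; rewrite /ex (@sum_conv _ N (fun k => ifact k * x ^+ k) (fun k => ifact k * y ^+ k));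
  last first.
  move=> i j Nij; rewrite -mulrA [x ^+ i * _]mulrA -[x ^+ i * ifact j]ifactC -!mulrA.
  rewrite (_ : x ^+ i * y ^+ j = 0) ?mulr0 //.
  by apply: nf_big0 Nij _; apply: (nf_M NF); apply: nf_X1.
apply: eq_bigr => k _; rewrite addrC exprDn_comm // mulr_sumr; apply: eq_bigr => i _.
have ik : (i <= k)%N by rewrite -ltnS.
rewrite mulrnAr -mulrnAl ifact_bin // -!mulrA; congr (_ * _).
rewrite [RHS]mulrA -[x ^+ i * _]ifactC -!mulrA; congr (_ * _).
by apply/commrX/commr_sym/commrX.
Qed.

Lemma ex_N x : P 1%N x -> ex x * ex (- x) = 1.
Proof.
by move=> Px; rewrite -ex_add ?subrr ?ex0 ?mulrN ?mulNr //; apply: (nf_N NF).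
Qed.

Lemma ex_Nl x : P 1%N x -> ex (- x) * ex x = 1.
Proof.
by move=> Px; rewrite -ex_add ?addNr ?ex0 ?mulrN ?mulNr //; apply: (nf_N NF).
Qed.

Lemma ex_comm x y : x * y = y * x -> ex x * y = y * ex x.
Proof.
move=> xy; rewrite /ex mulr_suml mulr_sumr; apply: eq_bigr => k _.
rewrite -mulrA -(commrX k (esym xy : GRing.comm y x)) !mulrA.
by rewrite ifactC.
Qed.

(** Since [ex x - 1 - x] has twice the depth of [x], the depth of [x] would
    increase without end. *)
Lemma ex_eq1 x : P 1%N x -> ex x = 1 -> x = 0.
Proof.
move=> Px x1; have step d : P d.+1 x -> P d.+2 x.
  move=> /ex1; rewrite x1 subrr sub0r => /(nf_N NF); rewrite opprK.
  by apply: nf_leq; rewrite addSnnS leq_addl.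
apply: (nf_nil NF); case: N nf_N0 => // M _.
by elim: M => // M; apply: step.
Qed.

(** Every element of [1 + P 1] is an exponential: multiplying by [ex (- r)]
    the element [1 + r] replaces [r] by something of twice its depth.  The
    logarithm so built commutes with whatever commutes with its exponential. *)
Lemma ex_surj u : P 1%N (u - 1) ->
  exists z, [/\ P 1%N z, forall y, y * u = u * y -> y * z = z * y & ex z = u].
Proof.
move=> Pu; suff [z [Pz zC]] : exists z, [/\ P 1%N z,
    forall y, y * u = u * y -> y * z = z * y & P N.+1 (u * ex (- z) - 1)].
  move=> /(nf_S NF)/(nf_nil NF)/eqP; rewrite subr_eq0 => /eqP H.
  by exists z; split=> //; rewrite -[RHS]mulr1 -(ex_Nl Pz) mulrA H mul1r.
elim: N => [|k [z [Pz zC Pk]]].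
  exists 0; split; [exact: (nf_0 NF) | by move=> y _; rewrite mulr0 mul0r|].
  by rewrite oppr0 ex0 mulr1.
set r := _ - 1 in Pk; have uE : u * ex (- z) = 1 + r by rewrite addrC subrK.
have rC y : y * u = u * y -> y * r = r * y.
  move=> yu; rewrite /r mulrBr mulrBl mulr1 mul1r; congr (_ - _).
  rewrite mulrA yu -!mulrA; congr (_ * _); apply/esym/ex_comm.
  by rewrite mulNr mulrN zC.
have Pr1 : P 1%N r by apply: nf_leq Pk.
exists (z + r); split.
- exact: (nf_D NF).
- by move=> y yu; rewrite mulrDr mulrDl zC // rC.
have zr : z * r = r * z by apply: rC; rewrite zC.
rewrite opprD ex_add; [|exact: (nf_N NF)..|]; last by rewrite !mulrNN.
rewrite mulrA uE; have := ex1 (nf_N NF Pk).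
set s := (X in P _ X -> _) => Ps.
have exr : ex (- r) = s - r + 1 by rewrite /s !subrK.
clearbody s; rewrite exr {exr}.
have -> : (1 + r) * (s - r + 1) - 1 = (1 + r) * s - r * r.
  rewrite -addrA mulrDr -addrA; congr (_ + _).
  rewrite mulrDl mul1r mulrDr mulr1 mulrN [- (r * r) + r]addrC addrACA addNr add0r.
  by rewrite [1 + _]addrC addrK.
apply: (nf_D NF).
  apply: (@nf_leq _ (k.+1 + k.+1)); first by rewrite addSnnS leq_addl.
  apply: nf_cM => //; apply: (nf_D NF); first exact: (nf_1 NF).
  exact: nf_leq Pr1.
apply/(nf_N NF)/(@nf_leq _ (k.+1 + k.+1)); first by rewrite addSnnS leq_addl.
exact: (nf_M NF).
Qed.

Lemma ex_inj x y : P 1%N x -> P 1%N y -> ex x = ex y -> x = y.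
Proof.
suff H z : P 1%N z -> forall z', P 1%N z' ->
    (forall t, t * ex z = ex z * t -> t * z' = z' * t) -> ex z' = ex z -> z = z'.
  move=> Px Py xy; have [z [Pz zC zx]] := ex_surj (ex_sub1 Px).
  by rewrite (H x Px z Pz zC zx) (H y Py z Pz) // -?xy.
move=> Pz z' Pz' zC zz; apply/eqP; rewrite -subr_eq0; apply/eqP/ex_eq1.
  by apply: (nf_D NF) => //; apply: (nf_N NF).
have zz' : z * z' = z' * z by apply/zC/esym/ex_comm.
rewrite ex_add //; first by rewrite -zz ex_N.
  exact: (nf_N NF).
by rewrite mulrN mulNr zz'.
Qed.

(** Chosen as the inverse of the exponential, which avoids any computation with
    the logarithmic series. *)
Definition lg u : R :=
  if pselect (exists z, P 1%N z /\ ex z = u) is left e then sval (cid e) else 0.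

Lemma lgP u : P 1%N (u - 1) -> P 1%N (lg u) /\ ex (lg u) = u.
Proof.
move=> Pu; rewrite /lg; case: pselect => [e|[]]; first by case: (cid e).
by have [z [Pz _ zu]] := ex_surj Pu; exists z.
Qed.

Lemma ex_lg u : P 1%N (u - 1) -> ex (lg u) = u.
Proof. by case/lgP. Qed.

Lemma nf_lg u : P 1%N (u - 1) -> P 1%N (lg u).
Proof. by case/lgP. Qed.

Lemma lg_ex z : P 1%N z -> lg (ex z) = z.
Proof.
move=> Pz; have [Pl le] := lgP (ex_sub1 Pz); exact: ex_inj.
Qed.

End Exponential.

Arguments ifact : simpl never.

Lemma nf_1M (R : nzRingType) q (P : nat -> set R) N u v :
  nilfilter q P N -> P 1%N (u - 1) -> P 1%N (v - 1) -> P 1%N (u * v - 1).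
Proof.
move=> NF Pu Pv; have -> : u * v - 1 = (u - 1) * (v - 1) + (u - 1) + (v - 1).
  by rewrite mulrBr mulr1 subrK mulrBl mul1r addrA subrK.
apply: (nf_D NF) => //; apply: (nf_D NF) => //.
by apply: (nf_S NF); apply: (@nf_M _ _ _ _ NF 1 1).
Qed.

Section ExpMorphism.
Variables (R R' : nzRingType) (q : nat -> R) (q' : nat -> R') (N : nat).
Variables (P : nat -> set R) (P' : nat -> set R') (f : R -> R').
Hypotheses (NF : nilfilter q P N) (NF' : nilfilter q' P' N).
Hypotheses (f1 : f 1 = 1) (fB : {morph f : x y / x - y}).
Hypotheses (fM : {morph f : x y / x * y}) (fq : forall k, f (q k) = q' k).
Hypothesis fP : forall x, P 1%N x -> P' 1%N (f x).

Lemma morph_0 : f 0 = 0. Proof. by rewrite -(subrr 0) fB subrr. Qed.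

Lemma morph_D x y : f (x + y) = f x + f y.
Proof. by rewrite -[y in LHS]opprK fB -sub0r fB morph_0 sub0r opprK. Qed.

Lemma ex_morph x : f (ex q N x) = ex q' N (f x).
Proof.
have fI k : f (ifact q k) = ifact q' k.
  by elim: k => [//|k IHk]; rewrite !ifactS fM fq IHk.
have fX k y : f (y ^+ k) = f y ^+ k.
  by elim: k => [|k IHk]; rewrite ?expr0 // !exprS fM IHk.
rewrite /ex (big_morph f morph_D morph_0); apply: eq_bigr => k _.
by rewrite fM fI fX.
Qed.

Lemma lg_morph u : P 1%N (u - 1) -> f (lg q P N u) = lg q' P' N (f u).
Proof.
move=> Pu; have [Pl lu] := lgP NF Pu; rewrite -[in RHS]lu ex_morph.
by rewrite (lg_ex NF') //; apply: fP.
Qed.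

End ExpMorphism.

(** Polynomial coefficients let a parameter [t] enter the exponentials. *)
Lemma nilfilter_poly (R : nzRingType) q (P : nat -> set R) N : nilfilter q P N ->
  nilfilter (fun k => (q k)%:P) (fun d (p : {poly R}) => forall i, P d p`_i) N.
Proof.
move=> NF; split.
- by move=> k; rewrite -[_%:R](rmorph_nat polyC) -polyCM (nf_q NF).
- move=> k p; apply/polyP => i; rewrite coefCM coefMC; exact: (nf_qC NF).
- by move=> k i; rewrite coefC; case: ifP => _; [apply: (nf_q0 NF) | apply: (nf_0 NF)].
- by move=> i; rewrite coefC; case: ifP => _; [apply: (nf_1 NF) | apply: (nf_0 NF)].
- by move=> d i; rewrite coef0; apply: (nf_0 NF).
- by move=> d x y Px Py i; rewrite coefD; apply: (nf_D NF).
- by move=> d x Px i; rewrite coefN; apply: (nf_N NF).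
- move=> d e x y Px Py i; rewrite coefM; apply: (nf_sum NF) => j _.
  exact: (nf_M NF).
- by move=> d x Px i; apply: (nf_S NF).
by move=> x Px; apply/polyP => i; rewrite coef0; apply: (nf_nil NF).
Qed.

Lemma nf_Mn (R : nzRingType) q (P : nat -> set R) N d x k :
  nilfilter q P N -> P d x -> P d (x *+ k).
Proof.
move=> NF Px; elim: k => [|k IHk]; first by rewrite mulr0n; apply: (nf_0 NF).
by rewrite mulrS; apply: (nf_D NF).
Qed.

Section ExpHorner.
Variables (R : nzRingType) (q : nat -> R) (P : nat -> set R) (N : nat).
Hypothesis NF : nilfilter q P N.
Local Notation qp := (fun k => (q k)%:P).
Local Notation Pp := (fun d (p : {poly R}) => forall i, P d p`_i).

Lemma hornerM_nat (k : nat) : {morph (fun p : {poly R} => p.[k%:R]) : u v / u * v}.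
Proof. by move=> u v; apply: hornerM_comm; rewrite /comm_poly mulr_natr mulr_natl. Qed.

Lemma nf_horner d (p : {poly R}) k : Pp d p -> P d p.[k%:R].
Proof.
move=> Pd; rewrite horner_coef; apply: (nf_sum NF) => i _.
by rewrite -natrX mulr_natr; apply: (nf_Mn _ NF).
Qed.

Lemma ex_horner (p : {poly R}) k : (ex qp N p).[k%:R] = ex q N p.[k%:R].
Proof.
apply: (@ex_morph _ _ qp q N (fun r : {poly R} => r.[k%:R])).
- by rewrite hornerC.
- by move=> u v; rewrite hornerD hornerN.
- exact: hornerM_nat.
- by move=> j; rewrite hornerC.
Qed.

Lemma lg_horner (p : {poly R}) k : Pp 1%N (p - 1) ->
  (lg qp Pp N p).[k%:R] = lg q P N p.[k%:R].
Proof.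
apply: (@lg_morph _ _ qp q N Pp P (fun r : {poly R} => r.[k%:R])) => //.
- exact: nilfilter_poly.
- by rewrite hornerC.
- by move=> u v; rewrite hornerD hornerN.
- exact: hornerM_nat.
- by move=> j; rewrite hornerC.
- by move=> x; apply: nf_horner.
Qed.

Lemma ex_coef0 (p : {poly R}) : (ex qp N p)`_0 = ex q N p`_0.
Proof.
apply: (@ex_morph _ _ qp q N (fun r : {poly R} => r`_0)).
- by rewrite coefC.
- by move=> u v; rewrite coefB.
- by move=> u v; rewrite coefM big_ord1.
- by move=> j; rewrite coefC.
Qed.

Lemma ex_coef1 (p : {poly R}) : Pp 1%N p -> p`_0 = 0 -> (ex qp N p)`_1 = p`_1.
Proof.
move=> Pd p0; rewrite (ex_pad (nilfilter_poly NF) Pd) coef_sum.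
have pX k : (p ^+ k.+1)`_0 = 0 by rewrite exprS coefM big_ord1 p0 mul0r.
have IC k : ifact qp k = (ifact q k)%:P.
  by elim: k => [//|k IHk]; rewrite !ifactS IHk polyCM.
rewrite !big_ord_recl big1 ?addr0 => [|i _].
  rewrite expr0 mulr1 coefC add0r expr1 ifactS mulr1.
  by have := nf_q (nilfilter_poly NF) 0; rewrite mulr1 => ->; rewrite mul1r.
rewrite IC coefCM exprS exprS.
rewrite coefM !big_ord_recl big_ord0 /= p0 mul0r add0r addr0.
by rewrite -exprS pX !mulr0.
Qed.

End ExpHorner.

Section DExp.
Variables (R : nzRingType) (q : nat -> R) (P : nat -> set R) (N : nat).
Hypothesis NF : nilfilter q P N.
Variable D : R -> R.
Hypotheses (DD : {morph D : x y / x + y}).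
Hypotheses (DM : forall x y, D (x * y) = D x * y + x * D y).
Hypothesis Dq : forall k, D (q k) = 0.

Lemma der_0 : D 0 = 0.
Proof. by apply: (addrI (D 0)); rewrite -DD !addr0. Qed.

Lemma der_1 : D 1 = 0.
Proof. by apply: (addrI (D 1)); rewrite addr0 -{3}[1]mulr1 DM mulr1 mul1r. Qed.

(** Moving all brackets to the left: [D (z^m)] is the sum over [j] of
    [binom(m, j + 1) ad_z^j(D z) z^(m - 1 - j)]. *)
Lemma der_expr z k : D (z ^+ k.+1) =
  \sum_(j < k.+1) (iter j (comm_br z) (D z) * z ^+ (k - j)) *+ 'C(k.+1, j.+1).
Proof.
elim: k => [|k IHk]; first by rewrite big_ord1 expr1 expr0 mulr1 /= mulr1n.
rewrite exprS DM IHk mulr_sumr; set w := D z.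
under [X in _ = X]eq_bigr do rewrite binS mulrnDr.
rewrite big_split [X in _ = X + _]big_ord_recr /= bin_small // mulr0n addr0.
rewrite [X in _ = _ + X]big_ord_recl /= bin0 mulr1n subn0 addrCA; congr (_ + _).
rewrite -big_split; apply: eq_bigr => j _ /=.
have jk : (j <= k)%N by rewrite -ltnS.
rewrite mulrnAr mulrA subSS -mulrnDl; congr (_ *+ _).
rewrite subSn // exprS mulrA -mulrDl; congr (_ * _).
by rewrite addrC /comm_br subrK.
Qed.

(** [D (exp z)] is the product of [((exp (ad z) - 1) / ad z) (D z)] and [exp z]. *)
Lemma der_ex z : P 1%N z -> P 1%N (D z) ->
  D (ex q N z) =
    (\sum_(j < N) ifact q j.+1 * iter j (comm_br z) (D z)) * ex q N z.
Proof.
move=> Pz Pw; have Dc k x : D (ifact q k * x) = ifact q k * D x.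
  rewrite DM; suff -> : D (ifact q k) = 0 by rewrite mul0r add0r.
  by elim: k => [|k IHk]; rewrite ?der_1 // ifactS DM Dq IHk mul0r mulr0 addr0.
pose a j := ifact q j.+1 * iter j (comm_br z) (D z).
pose b i := ifact q i * z ^+ i.
have Pa j : P j.+1 (a j).
  apply: (nf_cM NF); first exact: (nf_ifact NF).
  elim: j => [//|j IHj] /=; rewrite /comm_br; apply: (nf_D NF).
    exact: (@nf_M _ _ _ _ NF 1 j.+1).
  by apply: (nf_N NF); rewrite -[j.+2]addn1; apply: (nf_M NF).
have Pb i : P i (b i).
  by apply: (nf_cM NF); [apply: (nf_ifact NF) | apply: (nf_X1 NF)].
have ab0 i j : (N <= i.+1 + j)%N -> a i * b j = 0.
  by move=> Nij; apply: (nf_big0 NF Nij); apply: (nf_M NF).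
have DE : D (ex q N z) = \sum_(k < N) D (b k).
  by rewrite /ex (big_morph D DD der_0).
rewrite {}DE /ex (@sum_conv _ N a b) => [|i j Nij]; last first.
  by apply: ab0; rewrite addSn; apply: leqW.
move: ab0 (nf_N0 NF); case: N => // M ab0 _.
rewrite big_ord_recl {1}/b expr0 mulr1 /= der_1 add0r big_ord_recr /=.
rewrite [X in _ = _ + X]big1 => [|i _]; last first.
  by apply: ab0; rewrite addSn subnKC // -ltnS.
rewrite addr0; apply: eq_bigr => k _.
rewrite [D _]Dc der_expr mulr_sumr; apply: eq_bigr => i _.
have ik : (i <= k)%N by rewrite -ltnS.
rewrite mulrnAr -mulrnAl (ifact_bin NF) // subSS /a /b -!mulrA.
by rewrite [ifact q (k - i) * _]mulrA [ifact q (k - i) * _](ifactC NF) -mulrA.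
Qed.

End DExp.

Section CampbellHausdorff.
Variables (B : nzRingType) (q : nat -> B) (P : nat -> set B) (N : nat).
Hypothesis NF : nilfilter q P N.
Variable S : set B.
Hypotheses (SL : lie_ring (@comm_br B) S) (Sq : forall k x, S x -> S (q k * x)).
Hypothesis SP : forall x, S x -> P 1%N x.
Local Notation br := (@comm_br B).
Local Notation T := (lie_der br S).

Let qp k : {poly B} := (q k)%:P.
Let Pp d : set {poly B} := fun p => forall i, P d p`_i.

Let NFp : nilfilter qp Pp N. Proof. exact: nilfilter_poly. Qed.

Let brA := comm_br_lie B.

Let Tq k x : T x -> T (q k * x).
Proof.
elim=> [|u v w Su Sv _ IH]; first by rewrite mulr0; left.
rewrite mulrDr (_ : q k * br u v = br (q k * u) v); first by right=> //; apply: Sq.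
by rewrite /comm_br mulrBr !mulrA -[v * q k](nf_qC NF) -mulrA.
Qed.

Let TS x : T x -> S x. Proof. exact: lie_der_sub. Qed.

Let Pq x : Pp 1%N x -> Pp 1%N x^`().
Proof.
move=> Px i; rewrite coef_deriv; move: (x`_i.+1) (Px i.+1) => c Pc.
elim: i.+1 => [|m IHm]; first by rewrite mulr0n; apply: (nf_0 NF).
by rewrite mulrS; apply: (nf_D NF).
Qed.

Let ifactp k : ifact qp k = (ifact q k)%:P.
Proof. by elim: k => [//|k IHk]; rewrite !ifactS IHk polyCM. Qed.

(** [Z = log (ex (t x) ex y)] solves [x = sum_j ad_Z^j Z' / (j + 1)!], an
    equation that determines its coefficients one after the other and keeps them
    in every Lie ring containing [x] and [y]. *)
Section ODE.
Variables (x : B) (Z : {poly B}).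
Hypotheses (Sx : S x) (PZ : Pp 1%N Z).
Hypothesis ode : x%:P = \sum_(j < N) ifact qp j.+1 * iter j (comm_br Z) Z^`().

Let nu (w : {poly B}) : {poly B} :=
  \sum_(j < N.-1) ifact qp j.+2 * iter j.+1 (comm_br Z) w.

Let odeE : Z^`() = x%:P - nu Z^`().
Proof.
have := ode; rewrite /nu; case: N (nf_N0 NF) => // M _; rewrite big_ord_recl /= => ->.
rewrite ifactS mulr1 -[_ * Z^`()]mul1r -/(qp 0); set s := \sum_(i < M) _.
have -> : qp 0 = 1 by rewrite -[LHS]mulr1 -[RHS](nf_q NFp 0).
by rewrite !mul1r [s](_ : _ = \sum_(j < M) ifact qp j.+2 * comm_br Z (iter j (comm_br Z) Z^`())) ?addrK.
Qed.

Let nuB v w : nu v - nu w = nu (v - w).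
Proof.
rewrite /nu -sumrB; apply: eq_bigr => j _; rewrite -mulrBr; congr (_ * _).
by elim: j.+1 => [//|m IHm] /=; rewrite -IHm (lie_brBr (comm_br_lie _)).
Qed.

Let nuP d w : Pp d w -> Pp d.+1 (nu w).
Proof.
move=> Pw; apply: (nf_sum NFp) => j _; apply: (nf_cM NFp); first exact: (nf_ifact NFp).
apply: (@nf_leq _ _ _ _ NFp _ (j.+1 + d)); first by rewrite addSn ltnS leq_addl.
elim: j.+1 => [//|m IHm] /=; rewrite /comm_br; apply: (nf_D NFp).
  exact: (@nf_M _ _ _ _ NFp 1 (m + d)).
by apply: (nf_N NFp); rewrite addSn -addn1; apply: (nf_M NFp).
Qed.

Let adT i (w : {poly B}) : (forall j, (j <= i)%N -> S Z`_j) -> (forall j, (j <= i)%N -> S w`_j) ->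
  forall j, (j <= i)%N -> T (comm_br Z w)`_j.
Proof.
move=> SZ Sw j ji; rewrite /comm_br coefB coefM coefMr -sumrB.
elim/big_ind: _ => [|u v|a _]; first by left.
  exact: lie_derD.
have aj : (a <= j)%N by rewrite -ltnS.
apply: lie_der_br; first by apply: SZ; apply: leq_trans ji.
by apply: Sw; apply: leq_trans (leq_subr _ _) ji.
Qed.

Let nuT i (w : {poly B}) : (forall j, (j <= i)%N -> S Z`_j) -> (forall j, (j <= i)%N -> S w`_j) ->
  forall j, (j <= i)%N -> T (nu w)`_j.
Proof.
move=> SZ Sw j ji; rewrite /nu coef_sum; elim/big_ind: _ => [|u v|a _]; first by left.
  exact: lie_derD.
rewrite ifactp coefCM.
have Tad : forall j, (j <= i)%N -> T (iter a.+1 (comm_br Z) w)`_j.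
  elim: (nat_of_ord a) => [|m IHm]; first exact: adT.
  by apply: adT => // l /IHm/TS.
move: (Tad _ ji); elim: a.+2 => [|m IHm] Ty; first by rewrite mul1r.
by rewrite ifactS -mulrA; apply/Tq/IHm.
Qed.

(** The operator [nu] raises the depth, so the equation [Z' = x - nu Z'] is solved
    by iteration starting from [x]; if the coefficients of [Z] up to [i] are in [S],
    each iterate keeps the coefficients of [Z' - x] up to [i] in the derived ring. *)
Lemma ode_coef i : (forall j, (j <= i)%N -> S Z`_j) ->
  forall j, (j <= i)%N -> T (Z^`()`_j - x%:P`_j).
Proof.
move=> SZ; suff [s Ts /(nf_nil NFp)/eqP] : exists2 s : {poly B},
    (forall j, (j <= i)%N -> T (s`_j - x%:P`_j)) & Pp N (Z^`() - s).
  by rewrite subr_eq0 => /eqP ->.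
have Sc j : S (x%:P)`_j by rewrite coefC; case: ifP => // _; case: SL.
elim: (N) => [|M [s Ts Ps]].
  exists x%:P => [j _|k]; first by rewrite subrr; left.
  have [Pw Px] := (Pq PZ k, SP (Sc k)).
  by rewrite coefB; apply/(nf_S NF)/(nf_D NF) => //; apply: (nf_N NF).
exists (x%:P - nu s) => [j ji|].
  rewrite coefB addrAC subrr add0r; apply: lie_derN => //.
  apply: nuT ji => // l li; rewrite -[s`_l](subrK (x%:P`_l)).
  by apply: (lie_ringD SL) => //; apply/TS/Ts.
rewrite {1}odeE opprB addrC addrA subrK -opprB nuB.
by apply/(nf_N NFp)/nuP.
Qed.

Lemma ode_S : S Z`_0 -> forall j, S Z`_j.
Proof.
move=> S0 j; suff : forall i, (i <= j)%N -> S Z`_i by apply.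
elim: j => [|j IHj] i; first by rewrite leqn0 => /eqP ->.
rewrite leq_eqVlt => /predU1P[->|]; last by rewrite ltnS; apply: IHj.
have := ode_coef IHj (leqnn j) => /TS H.
have {}H : S Z^`()`_j.
  rewrite -[_`_j](subrK (x%:P`_j)); apply: (lie_ringD SL) => //.
  by rewrite coefC; case: ifP => // _; case: SL.
have -> : Z`_j.+1 = q j * Z^`()`_j.
  by rewrite coef_deriv -mulr_natr (nf_qC NF) -mulrA -(nf_qC NF) (nf_q NF) mulr1.
exact: Sq.
Qed.

Lemma ode_sum : S Z`_0 -> T (Z.[1] - (x + Z`_0)).
Proof.
move=> S0; have SZ := ode_S S0.
have TZ j : T (Z^`()`_j - x%:P`_j) by apply: (@ode_coef j).
have Zq j : Z`_j.+1 = q j * Z^`()`_j.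
  by rewrite coef_deriv -mulr_natr (nf_qC NF) -mulrA -(nf_qC NF) (nf_q NF) mulr1.
have q0 : q 0 = 1 by rewrite -[LHS]mulr1 -[RHS](nf_q NF 0).
rewrite (@horner_coef_wide _ (size Z).+2); last by rewrite -addn2 leq_addr.
rewrite big_ord_recl expr0 mulr1 /= [x + _]addrC opprD addrACA subrr add0r.
rewrite big_ord_recl expr1n mulr1 /= addrAC; apply: lie_derD.
  by have := TZ 0%N; rewrite coefC eqxx Zq q0 mul1r.
elim/big_ind: _ => [|u v|a _]; first by left.
  exact: lie_derD.
rewrite expr1n mulr1 Zq; apply: Tq.
by have := TZ a.+1; rewrite coefC subr0.
Qed.

End ODE.

(** Campbell-Hausdorff: [z] is the value at [t = 1] of the logarithm [Z] of
    [ex (t x) ex y], which has value [y] at [t = 0] and whose other coefficients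
    are given by [ode_coef]. *)
Lemma campbell_hausdorff x y : S x -> S y ->
  exists z, [/\ S z, T (z - (x + y)) & ex q N z = ex q N x * ex q N y].
Proof.
move=> Sx Sy; have [Px Py] := (SP Sx, SP Sy).
have PC u : P 1%N u -> Pp 1%N u%:P.
  by move=> Pu i; rewrite coefC; case: ifP => // _; apply: (nf_0 NF).
pose a : {poly B} := x%:P * 'X.
have Pa : Pp 1%N a.
  by move=> i; rewrite coefMX; case: ifP => _; [apply: (nf_0 NF) | apply: PC].
pose E := ex qp N a * ex qp N y%:P.
have PE : Pp 1%N (E - 1).
  by apply: (nf_1M NFp); apply: (ex_sub1 NFp) => //; apply: PC.
have [PZ EZ] := lgP NFp PE; set Z := lg qp Pp N E in PZ EZ.
have derC u : (ex qp N u%:P)^`() = 0.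
  rewrite /ex raddf_sum big1 // => i _; rewrite ifactp -polyC_exp -polyCM.
  exact: derivC.
have da : a^`() = x%:P by rewrite /a derivM derivC derivX mul0r add0r mulr1.
have Dq k : (qp k)^`() = 0 by apply: derivC.
have ode : x%:P = \sum_(j < N) ifact qp j.+1 * iter j (comm_br Z) Z^`().
  have EV : E * (ex qp N (- y%:P) * ex qp N (- a)) = 1.
    by rewrite mulrA -[E * _]mulrA (ex_N NFp (PC _ Py)) mulr1 (ex_N NFp Pa).
  have := der_ex NFp (@derivD _) (@derivM _) Dq PZ (Pq PZ).
  rewrite EZ => /(congr1 ( *%R^~ (ex qp N (- y%:P) * ex qp N (- a)))).
  rewrite -[RHS]mulrA EV mulr1 => <-.
  rewrite {1}/E derivM derC mulr0 addr0.
  rewrite (der_ex NFp (@derivD _) (@derivM _) Dq Pa) ?da; last exact: PC.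
  have -> : \sum_(j < N) ifact qp j.+1 * iter j (comm_br a) x%:P = x%:P.
    case: N (nf_N0 NF) => // M _; rewrite big_ord_recl /= big1 ?addr0.
      rewrite ifactS mulr1 -[qp 0]mulr1 [qp 0 * 1](nf_q NFp 0) mul1r //.
    suff it m : iter m.+1 (comm_br a) x%:P = 0.
      by move=> i _; move: (it i); rewrite iterS => ->; rewrite mulr0.
    elim: m => [|m IHm]; last by rewrite iterS IHm (lie_br0r (comm_br_lie _)).
    by rewrite /= /comm_br /a -mulrA -[in LHS]commr_polyX mulrA subrr.
  by rewrite -!mulrA [ex qp N a * _]mulrA EV mulr1.
have Z0 : Z`_0 = y.
  apply: (ex_inj NF) => //.
  have m : {morph (fun p : {poly B} => p`_0) : u v / u * v}.
    by move=> u v; rewrite coefM big_ord1.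
  have f1 : (1 : {poly B})`_0 = 1 by rewrite coefC.
  have fB : {morph (fun p : {poly B} => p`_0) : u v / u - v} by move=> u v; rewrite coefB.
  have fq k : (qp k)`_0 = q k by rewrite coefC.
  have := congr1 (fun p : {poly B} => p`_0) EZ => /=.
  rewrite (@ex_morph _ _ qp q N (fun p : {poly B} => p`_0)) // => ->.
  rewrite m !(@ex_morph _ _ qp q N (fun p : {poly B} => p`_0)) //.
  by rewrite /a coefMX eqxx (ex0 NF) mul1r coefC.
have S0 : S Z`_0 by rewrite Z0.
have TZ := ode_sum Sx PZ ode S0; rewrite Z0 in TZ; exists Z.[1]; split=> //.
  rewrite -[Z.[1]](subrK (x + y)); apply: (lie_ringD SL); first exact: TS.
  exact: (lie_ringD SL).
have m : {morph (fun p : {poly B} => p.[1]) : u v / u * v}.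
  by move=> u v; apply: hornerM_comm; rewrite /comm_poly mulr1 mul1r.
have f1 : (1 : {poly B}).[1] = 1 by rewrite hornerC.
have fB : {morph (fun p : {poly B} => p.[1]) : u v / u - v}.
  by move=> u v; rewrite hornerD hornerN.
have fq k : (qp k).[1] = q k by rewrite hornerC.
have := congr1 (fun p : {poly B} => p.[1]) EZ => /=.
rewrite (@ex_morph _ _ qp q N (fun p : {poly B} => p.[1])) // => ->.
rewrite m !(@ex_morph _ _ qp q N (fun p : {poly B} => p.[1])) //.
by rewrite hornerMX mulr1 !hornerC.
Qed.

(** The logarithms of the four factors add up to zero, which leaves the
    brackets. *)
Lemma campbell_hausdorff_comm x y : S x -> S y -> exists2 z, T z &
  ex q N z = ex q N (- x) * ex q N (- y) * ex q N x * ex q N y.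
Proof.
move=> Sx Sy; have [Sx' Sy'] := (lie_ringN SL Sx, lie_ringN SL Sy).
have [z1 [Sz1 T1 E1]] := campbell_hausdorff Sx' Sy'.
have [z2 [Sz2 T2 E2]] := campbell_hausdorff Sx Sy.
have [z [Sz Tz E]] := campbell_hausdorff Sz1 Sz2; exists z; last first.
  by rewrite E E1 E2 !mulrA.
rewrite -[z](subrK (z1 + z2)); apply: lie_derD => //.
rewrite -[z1](subrK (- x + - y)) -[z2](subrK (x + y)) addrACA -opprD addNr addr0.
by rewrite -opprD in T1; apply: lie_derD.
Qed.

End CampbellHausdorff.

(** * Solvable groups of unipotent matrices *)

Section DerivedSubgroup.
Variable gT : groupType.
Implicit Types (G H : set gT) (x y : gT).
Local Open Scope group_scope.

Lemma derived_subgroup_group G : is_subgroup (derived_subgroup G).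
Proof.
split=> [H [[H1 _ _] _] //|x y Gx Gy H sH|x Gx H sH].
  by case: (sH) => -[_ HM _] _; apply: HM; [apply: Gx | apply: Gy].
by case: (sH) => -[_ _ HV] _; apply: HV; apply: Gx.
Qed.

Lemma derived_subgroup_comm G x y : G x -> G y -> derived_subgroup G [~ x, y].
Proof. by move=> Gx Gy H [_]; apply; exists x => //; exists y. Qed.

Lemma derived_subgroup_ind G (Q : set gT) : is_subgroup Q ->
  (forall x y, G x -> G y -> Q [~ x, y]) -> forall x, derived_subgroup G x -> Q x.
Proof.
move=> sQ QG x; apply; split=> // _ [y Gy [z Gz <-]]; exact: QG.
Qed.

Lemma commgE x y : [~ x, y] = x^-1 * (y^-1 * (x * y)).
Proof. by rewrite commgEl conjgE. Qed.

Lemma derived_subgroup_sub G x : is_subgroup G -> derived_subgroup G x -> G x.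
Proof.
move=> sG; have [_ GM GV] := sG; apply: derived_subgroup_ind => // {}x y Gx Gy.
by rewrite commgE; exact: (GM _ _ (GV _ Gx) (GM _ _ (GV _ Gy) (GM _ _ Gx Gy))).
Qed.

Lemma derived_group k G : is_subgroup G -> is_subgroup (derived k G).
Proof. by case: k => // k _; apply: derived_subgroup_group. Qed.

Lemma derived_sub k G x : is_subgroup G -> derived k G x -> G x.
Proof.
move=> sG; elim: k x => [//|k IHk] x Gx; apply: IHk.
exact: (derived_subgroup_sub (derived_group k sG)).
Qed.

Lemma mulg_swap x y : x * y = y * x * [~ x, y].
Proof. by rewrite commgE !mulgA mulgK mulgV mul1g. Qed.

End DerivedSubgroup.

Section Kolchin.
Variables (gT : groupType) (F : fieldType) (p : nat).
Variable rho : gT -> 'M[F]_p.+1.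
Hypothesis rhoM : forall x y, rho (x * y)%g = rho x * rho y.
Hypothesis rho1 : rho 1%g = 1.
Implicit Types (G H : set gT) (W A : 'M[F]_p.+1).

Let stable H W := forall g, H g -> (W *m rho g <= W)%MS.

Let fixed_mx H W : exists A : 'M[F]_p.+1,
  forall v : 'rV_p.+1, (forall g, H g -> (v *m (rho g - 1) <= W)%MS) <-> (v <= A)%MS.
Proof.
apply: (subspace_mx (P := fun v => forall g, H g -> (v *m (rho g - 1) <= W)%MS)).
  by move=> g _; rewrite mul0mx sub0mx.
move=> a u v Hu Hv g Hg; rewrite mulmxDl -scalemxAl.
by rewrite addmx_sub ?scalemx_sub ?Hu ?Hv.
Qed.

(** A minimal stable subspace strictly above [W] is fixed modulo [W], because the
    vectors that one unipotent element fixes modulo [W] form a stable subspace of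
    it. *)
Lemma commuting_fixed_mod H W (A : 'M[F]_p.+1) :
    (forall g, H g -> exists k, (rho g - 1) ^+ k = 0) ->
    stable H W -> stable H A -> (W <= A)%MS -> ~~ (A <= W)%MS ->
    (forall g h, H g -> H h -> (A *m (rho g * rho h - rho h * rho g) <= W)%MS) ->
  exists2 v : 'rV_p.+1, ~~ (v <= W)%MS & forall g, H g -> (v *m (rho g - 1) <= W)%MS.
Proof.
move=> nil sW sA WA AW HC.
pose Q r := `[< exists B : 'M[F]_p.+1, [/\ stable H B, (W <= B)%MS, (B <= A)%MS,
  ~~ (B <= W)%MS & \rank B = r] >].
have exQ : exists r, Q r by exists (\rank A); apply/asboolP; exists A.
case: (ex_minnP exQ) => r /asboolP[B [sB WB BA BW rB]] rmin.
suff Bfix g : H g -> (B *m (rho g - 1) <= W)%MS.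
  have [i Wi] : exists i, ~~ (row i B <= W)%MS.
    by apply/existsP; rewrite -negb_forall; apply: contra BW => /forallP BW; apply/row_subP.
  exists (row i B) => // g Hg.
  by apply: submx_trans (Bfix g Hg); rewrite -row_mul row_sub.
move=> Hg; have [K KP] : exists K : 'M[F]_p.+1, forall v : 'rV_p.+1,
    ((v <= B)%MS /\ (v *m (rho g - 1) <= W)%MS) <-> (v <= K)%MS.
  apply: (subspace_mx (P := fun v => (v <= B)%MS /\ (v *m (rho g - 1) <= W)%MS)).
    by rewrite mul0mx !sub0mx.
  move=> a u v [uB Hu] [vB Hv]; rewrite mulmxDl -scalemxAl.
  by rewrite !(addmx_sub, scalemx_sub).
have KB : (K <= B)%MS by apply/row_subP => i; case: ((KP (row i K)).2 (row_sub i K)).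
have Kg : (K *m (rho g - 1) <= W)%MS.
  by apply/row_subP => i; rewrite row_mul; case: ((KP (row i K)).2 (row_sub i K)).
have KI (C : 'M[F]_p.+1) : (C <= B)%MS -> (C *m (rho g - 1) <= W)%MS -> (C <= K)%MS.
  move=> CB Cg; apply/row_subP => i; apply/KP; split.
    exact: submx_trans (row_sub i C) CB.
  by rewrite -row_mul; apply: submx_trans (row_sub _ _) Cg.
suff BK : (B <= K)%MS by apply: submx_trans (submxMr _ BK) Kg.
have rK : (r <= \rank K)%N.
  apply: rmin; apply/asboolP; exists K; split=> //.
  - move=> h Hh; apply: KI.
      exact: submx_trans (submxMr _ KB) (sB _ Hh).
    have -> : K *m rho h *m (rho g - 1) =
        K *m (rho h * rho g - rho g * rho h) + K *m (rho g - 1) *m rho h.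
      by rewrite -!mulmxA -mulmxDr -!mulmxE mulmxBl mulmxBr mulmx1 mul1mx subrKA.
    apply: addmx_sub; last exact: submx_trans (submxMr _ Kg) (sW _ Hh).
    apply: submx_trans (HC _ _ Hh Hg); apply: submxMr; exact: submx_trans BA.
  - apply: KI => //; rewrite mulmxBr mulmx1 addmx_sub ?sW //.
    by rewrite -scaleN1r scalemx_sub.
  - exact: submx_trans BA.
  have ex : exists m, (B *m (rho g - 1) ^+ m <= W)%MS.
    by have [m gm] := nil g Hg; exists m; rewrite gm mulmx0 sub0mx.
  case: (ex_minnP ex) => -[|m]; first by rewrite expr0 mulmx1 (negPf BW).
  move=> Bm mmin; apply/negP => KW.
  suff /mmin : (B *m (rho g - 1) ^+ m <= W)%MS by rewrite ltnn.
  apply: submx_trans KW; apply: KI; last by rewrite -mulmxA mulmxE -exprSr.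
  elim: (m) => [|j IHj]; first by rewrite expr0 mulmx1.
  rewrite exprSr -mulmxE mulmxA; apply: submx_trans (submxMr _ IHj) _.
  by rewrite mulmxBr mulmx1 addmx_sub ?sB // -scaleN1r scalemx_sub.
by rewrite -(geq_leqif (mxrank_leqif_sup KB)) rB.
Qed.

(** Up the derived series: the vectors fixed modulo [W] by the commutator subgroup
    form a stable subspace on which the group acts, modulo [W], through commuting
    matrices. *)
Lemma solvable_fixed_mod G W l : is_subgroup G -> derived l G = [set 1%g]%classic ->
    (forall g, G g -> exists k, (rho g - 1) ^+ k = 0) ->
    stable G W -> ~~ (1%:M <= W)%MS ->
  exists2 v : 'rV_p.+1, ~~ (v <= W)%MS & forall g, G g -> (v *m (rho g - 1) <= W)%MS.
Proof.
move=> sG Gl nil sW W1.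
suff H k : (k <= l)%N -> exists2 v : 'rV_p.+1, ~~ (v <= W)%MS &
    forall g, derived (l - k) G g -> (v *m (rho g - 1) <= W)%MS.
  by have := H l (leqnn l); rewrite subnn.
elim: k => [_|k IHk kl].
  have [i Wi] : exists i, ~~ (row i (1%:M : 'M[F]_p.+1) <= W)%MS.
    by apply/existsP; rewrite -negb_forall; apply: contra W1 => /forallP W1; apply/row_subP.
  exists (row i 1%:M) => //; rewrite subn0 Gl => g ->.
  by rewrite rho1 subrr mulmx0 sub0mx.
have [v Wv fv] := IHk (ltnW kl); set H := derived (l - k.+1) G.
have HE : derived (l - k) G = derived_subgroup H.
  by rewrite /H /derived -iterS -subSn // subSS.
rewrite HE in fv; have sH : is_subgroup H by apply: derived_group.
have [H1 HM HV] := sH; have HG g : H g -> G g by apply: derived_sub.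
have [A AP] := fixed_mx (derived_subgroup H) W.
have Afix g : derived_subgroup H g -> (A *m (rho g - 1) <= W)%MS.
  by move=> Hg; apply/row_subP => i; rewrite row_mul; apply: (AP _).2 => //; apply: row_sub.
have AI (C : 'M[F]_p.+1) : (forall g, derived_subgroup H g -> (C *m (rho g - 1) <= W)%MS) -> (C <= A)%MS.
  move=> Cg; apply/row_subP => i; apply/AP => g Hg.
  by rewrite -row_mul; apply: submx_trans (row_sub _ _) (Cg g Hg).
have sWH : stable H W by move=> g /HG; apply: sW.
have sA : stable H A.
  move=> h Hh; apply: AI => g Hg.
  have -> : A *m rho h *m (rho g - 1) = A *m (rho (h * g * h^-1)%g - 1) *m rho h.
    rewrite -!mulmxA; congr (_ *m _); rewrite mulmxBr mulmxBl mulmx1 mul1mx.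
    by rewrite !mulmxE -!rhoM mulgVK.
  apply: submx_trans (submxMr _ _) (sWH _ Hh); apply: Afix.
  have Hg' : H g by apply: (derived_subgroup_sub sH).
  have -> : (h * g * h^-1 = g * [~ g, h^-1])%g by rewrite commgE invgK !mulgA mulgV mul1g.
  have [_ + _] := derived_subgroup_group H; apply=> //.
  by apply: derived_subgroup_comm => //; apply: HV.
apply: (@commuting_fixed_mod H W A) => //.
- by move=> g /HG/nil.
- by apply: AI => g /(derived_subgroup_sub sH) Hg; rewrite mulmxBr mulmx1 addmx_sub ?sWH // -scaleN1r scalemx_sub.
- by apply: contra Wv; apply: submx_trans; apply/AP.
move=> g h Hg Hh; rewrite -!rhoM (mulg_swap g h) rhoM -[X in _ - X]mulr1 -mulrBr -mulmxE mulmxA.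
apply: submx_trans (submxMr _ _) (Afix _ (derived_subgroup_comm Hg Hh)).
by rewrite rhoM -mulmxE mulmxA; apply: submx_trans (submxMr _ (sA _ Hh)) (sA _ Hg).
Qed.

(** Kolchin's theorem for solvable groups: each step of the flag consists of the
    vectors fixed modulo the previous one, and it is strictly larger until
    everything is reached. *)
Lemma kolchin_flag G l : is_subgroup G -> derived l G = [set 1%g]%classic ->
    (forall g, G g -> exists k, (rho g - 1) ^+ k = 0) ->
  exists U : nat -> 'M[F]_p.+1, [/\ U 0%N = 0,
    forall k, (U k <= U k.+1)%MS, (1%:M <= U p.+1)%MS &
    forall k g, G g -> (U k.+1 *m (rho g - 1) <= U k)%MS].
Proof.
move=> sG Gl nil; pose next W := sval (cid (fixed_mx G W)).
have nextP W := svalP (cid (fixed_mx G W)); rewrite -/(next _) in nextP.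
pose U k := iter k next 0; exists U.
have Ug k g : G g -> (U k.+1 *m (rho g - 1) <= U k)%MS.
  by move=> Gg; apply/row_subP => i; rewrite row_mul; apply: (nextP _ _).2 => //; apply: row_sub.
have H k : stable G (U k) /\ (U k <= U k.+1)%MS.
  elim: k => [|k [sU UU]]; first by split=> [g _|]; rewrite ?mul0mx sub0mx.
  have sUS : stable G (U k.+1).
    move=> g Gg; rewrite -[rho g](subrK 1) mulmxDr mulmx1 addmx_sub //.
    exact: submx_trans (Ug k g Gg) UU.
  split=> //; apply/row_subP => i; apply/nextP => g Gg; rewrite mulmxBr mulmx1.
  rewrite addmx_sub -?[- row _ _]scaleN1r ?scalemx_sub ?row_sub //.
  exact: submx_trans (submxMr _ (row_sub _ _)) (sUS g Gg).
split=> // [k|]; first by case: (H k).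
suff rk k : (k <= p.+1)%N -> (k <= \rank (U k))%N.
  by rewrite sub1mx /row_full eqn_leq rank_leq_col rk.
elim: k => [//|k IHk] kp; have [full|nfull] := boolP (1%:M <= U k)%MS.
  suff /eqP -> : row_full (U k.+1) by [].
  by rewrite -sub1mx; apply: submx_trans full (H k).2.
have [v vU fv] := solvable_fixed_mod sG Gl nil (H k).1 nfull.
apply: leq_ltn_trans (IHk (ltnW kp)) _; apply: rank_ltmx; rewrite ltmxE (H k).2 /=.
by apply: contra vU; apply: submx_trans; apply/nextP.
Qed.

End Kolchin.

Section UnipotentFilter.
Variables (F : fieldType) (p : nat).
Hypothesis F0 : [pchar F] =i pred0.

Definition invS k : 'M[F]_p.+1 := (k.+1%:R^-1)%:M.

(** The matrices that lower every step of a flag by [j] form the [j]-th term of a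
    filtration, for which unitriangular matrices are [1 + P 1]. *)
Lemma flag_nilfilter (U : nat -> 'M[F]_p.+1) N : U 0%N = 0 ->
    (forall k, (U k <= U k.+1)%MS) -> (1%:M <= U N)%MS ->
  nilfilter invS (fun j M => forall k, (U (k + j)%N *m M <= U k)%MS) N.
Proof.
move=> U0 US UN; split.
- move=> k; have -> : k.+1%:R = (k.+1%:R)%:M :> 'M[F]_p.+1.
    by rewrite (rmorph_nat (@scalar_mx F p.+1)).
  rewrite /invS -mulmxE -scalar_mxM mulVf //.
  by rewrite ((pcharf0P F).1 F0).
- by move=> k x; rewrite /invS -!mulmxE scalar_mxC.
- by move=> k i; rewrite addn0 mul_mx_scalar scalemx_sub.
- by move=> k; rewrite addn0 mulmx1.
- by move=> d k; rewrite mulmx0 sub0mx.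
- by move=> d x y Px Py k; rewrite mulmxDr addmx_sub.
- by move=> d x Px k; rewrite mulmxN -scaleN1r scalemx_sub.
- move=> d e x y Px Py k; rewrite -mulmxE mulmxA (addnC d) addnA.
  exact: submx_trans (submxMr _ (Px _)) (Py _).
- move=> d x Px k; apply: submx_trans (submxMr _ (US _)) _.
  by rewrite -addnS.
move=> x Px; have := Px 0%N; rewrite U0 submx0 add0n => /eqP H.
by case/submxP: UN => D E; rewrite -[x]mul1mx E -mulmxA H mulmx0.
Qed.

End UnipotentFilter.

(** * Logarithms of a unipotent group span a Lie algebra *)

Section Span.
Variables (F : fieldType) (V : lmodType F).

Inductive lspan (A : set V) : set V :=
| LSpan0 : lspan A 0
| LSpanD c a v : A a -> lspan A v -> lspan A (c *: a + v).

Lemma lspan_mem A a : A a -> lspan A a.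
Proof. by move=> Aa; rewrite -[a]addr0 -[a]scale1r; right=> //; left. Qed.

Lemma lspan_lin A c u v : lspan A u -> lspan A v -> lspan A (c *: u + v).
Proof.
move=> + Av; elim=> [|e a w Aa _ IH]; first by rewrite scaler0 add0r.
by rewrite scalerDr scalerA -addrA; right.
Qed.

Lemma lspan_ind_lin A (Q : set V) : Q 0 ->
  (forall c u v, Q u -> Q v -> Q (c *: u + v)) -> (forall a, A a -> Q a) ->
  forall v, lspan A v -> Q v.
Proof. by move=> Q0 QD AQ v; elim=> // c a w /AQ Qa _ Qw; apply: QD. Qed.

(** The coefficients are combinations of finitely many values, by inverting a
    Vandermonde matrix. *)
Lemma coef_interpolation (S : set V) m (c : 'I_m -> V) : [pchar F] =i pred0 ->
    S 0 -> (forall a u v, S u -> S v -> S (a *: u + v)) ->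
    (forall s : nat, S (\sum_(i < m) s%:R ^+ i *: c i)) ->
  forall i, S (c i).
Proof.
move=> F0 S0 SD Sc i; pose a : 'rV[F]_m := \row_j j%:R.
pose W := Vandermonde m a.
have WU : W \in unitmx.
  rewrite unitmxE unitfE det_Vandermonde; apply/prodf_neq0 => j _.
  apply/prodf_neq0 => k jk; rewrite !mxE subr_eq0; apply/negP => /eqP E.
  have /eqP : (k - j)%:R = 0 :> F by rewrite natrB ?E ?subrr // ltnW.
  by rewrite ((pcharf0P F).1 F0) subn_eq0 leqNgt jk.
have -> : c i = \sum_j invmx W j i *: \sum_(k < m) (j : nat)%:R ^+ k *: c k.
  under eq_bigr do rewrite scaler_sumr; rewrite exchange_big /=.
  have E (k : 'I_m) : \sum_j invmx W j i *: ((j : nat)%:R ^+ k *: c k) = (k == i)%:R *: c k.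
    under eq_bigr do rewrite scalerA mulrC; rewrite -scaler_suml; congr (_ *: _).
    have /matrixP/(_ k i) := mulmxV WU; rewrite !mxE => <-.
    by apply: eq_bigr => j _; rewrite !mxE.
  rewrite (eq_bigr _ (fun k _ => E k)) (bigD1 i) //= eqxx scale1r [X in _ + X]big1 ?addr0 //.
  by move=> k /negPf ->; rewrite scale0r.
elim/big_ind: _ => // [u v Su Sv|j _]; first by rewrite -[u]scale1r; apply: SD.
by rewrite -[_ *: _]addr0; apply: SD.
Qed.

End Span.

Lemma ex_conj (R : nzRingType) q (P : nat -> set R) N a b y : nilfilter q P N ->
  a * b = 1 -> b * a = 1 -> ex q N (a * y * b) = a * ex q N y * b.
Proof.
move=> NF ab ba; apply/esym; apply: (@ex_morph _ _ q q N (fun y => a * y * b)).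
- by rewrite mulr1.
- by move=> u v; rewrite mulrBr mulrBl.
- by move=> u v; rewrite !mulrA -[_ * b * a]mulrA ba mulr1.
- by move=> k; rewrite -(nf_qC NF) -mulrA ab mulr1.
Qed.

Lemma ex_Mn (R : nzRingType) q (P : nat -> set R) N x k : nilfilter q P N ->
  P 1%N x -> ex q N (x *+ k) = ex q N x ^+ k.
Proof.
move=> NF Px; elim: k => [|k IHk]; first by rewrite mulr0n (ex0 NF) expr0.
rewrite mulrS (ex_add NF) ?IHk ?exprS //; first exact: (nf_Mn _ NF).
by rewrite mulrnAr mulrnAl.
Qed.

Section LogLie.
Variables (gT : groupType) (F : fieldType) (B : algType F) (rho : gT -> B).
Hypothesis F0 : [pchar F] =i pred0.
Hypothesis rhoM : forall x y, rho (x * y)%g = rho x * rho y.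
Hypothesis rho1 : rho 1%g = 1.
Variables (q : nat -> B) (P : nat -> set B) (N : nat) (H : set gT).
Hypotheses (NF : nilfilter q P N) (sH : is_subgroup H).
Hypothesis HP : forall g, H g -> P 1%N (rho g - 1).
Local Notation qp := (fun k => (q k)%:P).
Local Notation Pp := (fun d (u : {poly B}) => forall i, P d u`_i).
Local Notation "'log' g" := (lg q P N (rho g)) (at level 10).

Let NFp := nilfilter_poly NF.

Lemma rhoX x k : rho (x ^+ k)%g = rho x ^+ k.
Proof. by elim: k => [|k IHk]; rewrite ?expg0 ?rho1 // expgS rhoM IHk exprS. Qed.

Lemma log_inv g : H g -> rho (g^-1)%g = ex q N (- log g).
Proof.
move=> Hg; have [Pl El] := lgP NF (HP Hg).
have gV : rho g * rho (g^-1)%g = 1 by rewrite -rhoM mulgV rho1.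
by rewrite -[LHS]mul1r -(ex_Nl NF Pl) -mulrA El gV mulr1.
Qed.

Lemma poly_values (S : set B) (Z : {poly B}) :
  S 0 -> (forall a u v, S u -> S v -> S (a *: u + v)) ->
  (forall s : nat, S Z.[s%:R]) -> S Z`_1.
Proof.
move=> S0 SD SZ; pose c (i : 'I_(size Z).+2) := Z`_i.
rewrite -[Z`_1]/(c (Ordinal (isT : (1 < (size Z).+2)%N))).
apply: (coef_interpolation F0 S0 SD) => s.
have -> : \sum_(i < (size Z).+2) s%:R ^+ i *: c i = Z.[s%:R]; last exact: SZ.
rewrite (@horner_coef_wide _ (size Z).+2); last by rewrite -addn2 leq_addr.
by apply: eq_bigr => i _; rewrite -!natrX scaler_nat mulr_natr.
Qed.

Let PC u : P 1%N u -> Pp 1%N (u%:P * 'X).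
Proof.
move=> Pu i; rewrite coefMX; case: ifP => _; first exact: (nf_0 NF).
by rewrite coefC; case: ifP => // _; apply: (nf_0 NF).
Qed.

Let coef0M (u v : {poly B}) : (u * v)`_0 = u`_0 * v`_0.
Proof. by rewrite coefM big_ord1. Qed.

Let coef1M (u v : {poly B}) : (u * v)`_1 = u`_0 * v`_1 + u`_1 * v`_0.
Proof. by rewrite coefM !big_ord_recl big_ord0 addr0. Qed.

Let ex_lin0 u : (ex qp N (u%:P * 'X))`_0 = 1.
Proof. by rewrite ex_coef0 coefMX (ex0 NF). Qed.

Let ex_lin1 u : P 1%N u -> (ex qp N (u%:P * 'X))`_1 = u.
Proof.
by move=> Pu; rewrite (ex_coef1 NF (PC Pu)) coefMX ?coefC.
Qed.

Let ex_lin_horner u (s : nat) : (ex qp N (u%:P * 'X)).[s%:R] = ex q N (u *+ s).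
Proof. by rewrite ex_horner hornerMX hornerC mulr_natr. Qed.

(** The logarithm of [g^t h^s g^-t h^-s] is polynomial in [s] and [t], and the
    bracket is its coefficient at [s t]. *)
Lemma log_br g h : H g -> H h ->
  lspan [set log c | c in derived_subgroup H]%classic (comm_br (log g) (log h)).
Proof.
move=> Hg Hh; set S := lspan _; have [_ HM HV] := sH.
have S0 : S 0 by left.
have SD a u v : S u -> S v -> S (a *: u + v) by apply: lspan_lin.
have [PX EX] := lgP NF (HP Hg); have [PY EY] := lgP NF (HP Hh).
set X := log g in PX EX *; set Y := log h in PY EY *.
have HX k x : H x -> H (x ^+ k)%g.
  move=> Hx; elim: k => [|k IHk]; first by rewrite expg0; case: sH.
  by rewrite expgS; apply: HM.
pose a t := ex q N (X *+ t); pose b t := ex q N (- (X *+ t)).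
have PXt t : P 1%N (X *+ t) by apply: (nf_Mn _ NF).
have ab t : a t * b t = 1 by apply: (ex_N NF).
have ba t : b t * a t = 1 by apply: (ex_Nl NF).
have rhoXg x t : H x -> rho (x ^+ t)%g = ex q N (log x *+ t).
  by move=> Hx; rewrite rhoX (ex_Mn _ NF) ?(ex_lg NF) //; [apply: HP | apply: (nf_lg NF); apply: HP].
have rhoXV x t : H x -> rho (x ^+ t)^-1%g = ex q N (- (log x *+ t)).
  move=> Hx; rewrite log_inv; last exact: HX.
  by rewrite rhoXg // (lg_ex NF) //; apply: (nf_Mn _ NF); apply: (nf_lg NF); apply: HP.
have PU t : P 1%N (a t * Y * b t).
  apply: (@nf_M _ _ _ _ NF 1 0); first apply: (@nf_M _ _ _ _ NF 0 1) => //.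
    by rewrite -[a t](subrK 1); apply: (nf_D NF); [apply: (nf_S NF); apply: (ex_sub1 NF) | apply: (nf_1 NF)].
  rewrite -[b t](subrK 1); apply: (nf_D NF); last exact: (nf_1 NF).
  by apply: (nf_S NF); apply: (ex_sub1 NF); apply: (nf_N NF).
(* the coefficient of [s]: conjugating [h^s] by [g^t] conjugates [Y] *)
have key t : S (a t * Y * b t - Y).
  set U := _ * b t; have {}PU : P 1%N U by apply: PU.
  have PNY := nf_N NF PY.
  pose E := ex qp N (U%:P * 'X) * ex qp N ((- Y)%:P * 'X).
  have PE : Pp 1%N (E - 1).
    by apply: (nf_1M NFp); apply: (ex_sub1 NFp); apply: PC.
  have [PZ EZ] := lgP NFp PE; set Z := lg _ _ _ E in PZ EZ.
  have Z0 : Z`_0 = 0.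
    by apply: (ex_eq1 NF) => //; rewrite -ex_coef0 EZ coef0M !ex_lin0 mulr1.
  have <- : Z`_1 = U - Y.
    by rewrite -(ex_coef1 NF PZ Z0) EZ coef1M !ex_lin0 !ex_lin1 // mul1r mulr1 addrC.
  apply: poly_values => // s; apply: lspan_mem.
  exists (g ^+ t * (h ^+ s * ((g ^+ t)^-1 * (h ^+ s)^-1)))%g.
    have -> : (g ^+ t * (h ^+ s * ((g ^+ t)^-1 * (h ^+ s)^-1)) =
      [~ (g ^+ t)^-1, (h ^+ s)^-1])%g by rewrite commgE !invgK.
    by apply: derived_subgroup_comm; apply: HV; apply: HX.
  rewrite (lg_horner NF s PE) hornerM_nat !ex_lin_horner; congr lg.
  rewrite !rhoM !rhoXg // !rhoXV // mulrA mulrA; congr (_ * _); last by rewrite mulNrn.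
  rewrite /U -mulrnAl -mulrnAr (ex_conj _ NF) //.
(* the coefficient of [t] in the conjugate of [Y] is the bracket *)
pose V := ex qp N (X%:P * 'X) * Y%:P * ex qp N ((- X)%:P * 'X) - Y%:P.
have -> : comm_br X Y = V`_1.
  rewrite /V coefB !coef1M !coef0M !ex_lin0 !ex_lin1 //; last exact: (nf_N NF).
  rewrite !coefC /= mulr0 add0r subr0 mul1r mulr1 mulrN addrC; reflexivity.
apply: poly_values => // t; rewrite /V hornerD hornerN hornerC.
rewrite !hornerM_nat !ex_lin_horner hornerC mulNrn; exact: key.
Qed.

End LogLie.

(** * The ring of formal power series *)

Definition pser (F : fieldType) (n : nat) := fps F n.

HB.instance Definition _ (F : fieldType) (n : nat) := gen_eqMixin (pser F n).
HB.instance Definition _ (F : fieldType) (n : nat) := gen_choiceMixin (pser F n).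

Section PowerSeriesRing.
Variables (F : fieldType) (n : nat).
Local Notation A := (pser F n).
Implicit Types (f g h : A) (m k : 'X_{1..n}).

Definition ps_add f g : A := fun m => f m + g m.
Definition ps_opp f : A := fun m => - f m.
Definition ps_zero : A := fun m => 0.
Definition ps_one : A := fun m => (m == 0%MM)%:R.
Definition ps_scale (c : F) f : A := fun m => c * f m.
(** The coefficient at [m] involves the jets of order [|m|] only, so the ring
    laws are inherited from polynomials. *)
Definition ps_mul f g : A := fun m => (jet (mdeg m) f * jet (mdeg m) g)@_m.

Lemma ps_addA : associative ps_add.
Proof. by move=> f g h; apply: funext => m; rewrite /ps_add addrA. Qed.
Lemma ps_addC : commutative ps_add.
Proof. by move=> f g; apply: funext => m; rewrite /ps_add addrC. Qed.
Lemma ps_add0 : left_id ps_zero ps_add.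
Proof. by move=> f; apply: funext => m; rewrite /ps_add add0r. Qed.
Lemma ps_addN : left_inverse ps_zero ps_opp ps_add.
Proof. by move=> f; apply: funext => m; rewrite /ps_add addNr. Qed.

HB.instance Definition _ := GRing.isZmodule.Build A ps_addA ps_addC ps_add0 ps_addN.

Lemma ps_addE f g m : (f + g) m = f m + g m. Proof. by []. Qed.
Lemma ps_oppE f m : (- f) m = - f m. Proof. by []. Qed.
Lemma ps_subE f g m : (f - g) m = f m - g m. Proof. by []. Qed.
Lemma ps_0E m : (0 : A) m = 0. Proof. by []. Qed.

Lemma jetD d f g : jet d (f + g) = jet d f + jet d g.
Proof.
by apply/mpolyP => m; rewrite mcoeffD !coef_jet; case: ifP; rewrite ?addr0.
Qed.

Lemma ord_ge_any (p : {mpoly F[n]}) : ord_ge 0 p. Proof. by []. Qed.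

Lemma ps_mul_jet d f g m : (mdeg m <= d)%N -> ps_mul f g m = (jet d f * jet d g)@_m.
Proof.
move=> md; apply/eqP; rewrite eq_sym -subr_eq0 -mcoeffB; set e := mdeg m.
have -> : jet d f * jet d g - jet e f * jet e g =
    (jet d f - jet e f) * jet d g + jet e f * (jet d g - jet e g) by ring.
apply/eqP; suff: ord_ge e.+1 ((jet d f - jet e f) * jet d g + jet e f * (jet d g - jet e g)).
  by apply.
apply: ord_geD.
  by rewrite -[e.+1]addn0; apply: ord_geM; [apply: ord_ge_jetD | apply: ord_ge_any].
by rewrite -[e.+1]add0n; apply: ord_geM; [apply: ord_ge_any | apply: ord_ge_jetD].
Qed.

Lemma ord_ge_jet_mul d f g : ord_ge d.+1 (jet d (ps_mul f g) - jet d f * jet d g).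
Proof.
by move=> m; rewrite ltnS => md; rewrite mcoeffB coef_jet md (ps_mul_jet _ _ md) subrr.
Qed.

Lemma jet_one d : jet d ps_one = 1.
Proof.
apply/mpolyP => m; rewrite coef_jet mcoeff1 /ps_one.
by case: eqP => [->|_]; rewrite ?mdeg0 // if_same.
Qed.

Lemma ps_mulC : commutative ps_mul.
Proof. by move=> f g; apply: funext => m; rewrite /ps_mul mulrC. Qed.

Lemma ps_mulA : associative ps_mul.
Proof.
have E f g h m : ps_mul f (ps_mul g h) m =
    (jet (mdeg m) f * (jet (mdeg m) g * jet (mdeg m) h))@_m.
  apply/eqP; rewrite -subr_eq0 -mcoeffB -mulrBr; apply/eqP.
  have : ord_ge (0 + (mdeg m).+1) (jet (mdeg m) f *
      (jet (mdeg m) (ps_mul g h) - jet (mdeg m) g * jet (mdeg m) h)).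
    by apply: ord_geM; [apply: ord_ge_any | apply: ord_ge_jet_mul].
  by apply.
move=> f g h; apply: funext => m; rewrite E [in RHS]ps_mulC E.
by congr (_@__); ring.
Qed.

Lemma ps_mul1 : left_id ps_one ps_mul.
Proof. by move=> f; apply: funext => m; rewrite /ps_mul jet_one mul1r coef_jet leqnn. Qed.

Lemma ps_mulDl : left_distributive ps_mul ps_add.
Proof.
by move=> f g h; apply: funext => m; rewrite /ps_mul -/(f + g) jetD mulrDl mcoeffD.
Qed.

Lemma ps_one_neq0 : ps_one != 0.
Proof.
apply/eqP => /(congr1 (fun f : A => f 0%MM)) /eqP.
by rewrite /ps_one eqxx oner_eq0.
Qed.

HB.instance Definition _ := GRing.Zmodule_isComNzRing.Build A
  ps_mulA ps_mulC ps_mul1 ps_mulDl ps_one_neq0.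

Lemma ps_1E m : (1 : A) m = (m == 0%MM)%:R. Proof. by []. Qed.

Lemma ps_mulE d f g m : (mdeg m <= d)%N -> (f * g) m = (jet d f * jet d g)@_m.
Proof. exact: ps_mul_jet. Qed.

Lemma ord_ge_jetM d f g : ord_ge d.+1 (jet d (f * g) - jet d f * jet d g).
Proof. exact: ord_ge_jet_mul. Qed.

Lemma ps_scaleA a b f : ps_scale a (ps_scale b f) = ps_scale (a * b) f.
Proof. by apply: funext => m; rewrite /ps_scale mulrA. Qed.
Lemma ps_scale1 : left_id 1 ps_scale.
Proof. by move=> f; apply: funext => m; rewrite /ps_scale mul1r. Qed.
Lemma ps_scaleDr : right_distributive ps_scale +%R.
Proof. by move=> a f g; apply: funext => m; rewrite /ps_scale ps_addE mulrDr. Qed.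
Lemma ps_scaleDl f : {morph ps_scale^~ f : a b / a + b}.
Proof. by move=> a b; apply: funext => m; rewrite /ps_scale mulrDl. Qed.

HB.instance Definition _ := GRing.Zmodule_isLmodule.Build F A
  ps_scaleA ps_scale1 ps_scaleDr ps_scaleDl.

Lemma ps_scaleE c f m : (c *: f) m = c * f m. Proof. by []. Qed.

Lemma jetZ d c f : jet d (c *: f) = c *: jet d f.
Proof.
by apply/mpolyP => m; rewrite mcoeffZ !coef_jet; case: ifP; rewrite ?mulr0.
Qed.

Lemma ps_scaleAl c f g : c *: (f * g) = c *: f * g.
Proof.
apply: funext => m; rewrite ps_scaleE !(@ps_mulE (mdeg m)) // jetZ -scalerAl.
by rewrite mcoeffZ.
Qed.

HB.instance Definition _ := GRing.Lmodule_isLalgebra.Build F A ps_scaleAl.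
HB.instance Definition _ := GRing.Lalgebra_isComAlgebra.Build F A.

(** The monomials are well-ordered by the degree-lexicographic order, which is
    compatible with products: least monomials replace leading ones. *)
Definition lowest f m := f m != 0 /\ forall k, f k != 0 -> (m <= k)%O.

Lemma lowestP f : f != 0 -> exists m, lowest f m.
Proof.
move=> f0; have [m0 fm0] : exists m, f m != 0.
  apply: contrapT => H; case/eqP: f0; apply: funext => m; apply/eqP/negPn/negP => fm.
  by apply: H; exists m.
elim/(well_founded_ind (@ltom_wf n)): m0 fm0 => m IH fm.
have [[k km fk]|H] := pselect (exists2 k, (k < m)%O & f k != 0); first exact: IH fk.
exists m; split=> // k fk; rewrite leNgt; apply/negP => km; apply: H; by exists k.
Qed.

Lemma ps_mul_sum f g m : (f * g) m =
  \sum_(k : 'X_{1..n < (mdeg m).+1} | (k <= m)%MM) f k * g (m - k)%MM.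
Proof.
rewrite (@ps_mulE (mdeg m)) // [LHS](mcoeff_poly_mul_lin _ _ (ltnSn _)).
apply: eq_bigr => k _; rewrite !coef_jet -ltnS bmdeg.
by rewrite (leq_trans (mdegB _ _)).
Qed.

Lemma lowest_mul_coef f g a b :
    (forall k, f k != 0 -> (a <= k)%O) -> (forall k, g k != 0 -> (b <= k)%O) ->
  (f * g) (a + b)%MM = f a * g b.
Proof.
move=> fa gb; rewrite ps_mul_sum.
have ad : (mdeg a < (mdeg (a + b)).+1)%N by rewrite ltnS mdegD leq_addr.
rewrite (bigD1 (BMultinom ad)) /=; last exact: lem_addr.
have -> : (a + b - a = b)%MM by rewrite addmC addmK.
rewrite big1 ?addr0 // => k /andP[ka kE].
apply/eqP/negPn/negP; rewrite mulf_eq0 negb_or => /andP[/fa ak /gb bk].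
have {}ak : (a < bmnm k)%O.
  rewrite lt_neqAle ak andbT; apply: contraNneq kE => E; apply/eqP/val_inj => /=.
  by rewrite -E.
by have := ltmc_le_add ak bk; rewrite [X in (_ < X)%O]addmC submK ?[(b + a)%MM]addmC ?ltxx // addmC.
Qed.

Lemma lowest_mul f g a b : lowest f a -> lowest g b -> lowest (f * g) (a + b)%MM.
Proof.
move=> [fa la] [gb lb]; split; first by rewrite lowest_mul_coef // mulf_neq0.
move=> k; rewrite ps_mul_sum => fgk.
have [k' k'k fk'] : exists2 k' : 'X_{1..n}, (k' <= k)%MM & f k' * g (k - k')%MM != 0.
  apply: contrapT => H; case/eqP: fgk; apply: big1 => k' k'k.
  by apply/eqP/negPn/negP => fg; apply: H; exists k'.
move: fk'; rewrite mulf_eq0 negb_or => /andP[/la ak /lb bk].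
by rewrite -[k in (_ <= k)%O](submK k'k) addmC lem_add.
Qed.

(** Lowest monomials multiply to a nonzero coefficient. *)
Lemma ps_integral f g : f * g = 0 -> (f == 0) || (g == 0).
Proof.
move=> fg; apply/negPn/negP; rewrite negb_or => /andP[/lowestP[a la] /lowestP[b lb]].
by have [] := lowest_mul la lb; rewrite fg ps_0E eqxx.
Qed.

Definition ps_unit : pred A := fun f => `[< exists g, g * f = 1 >].
(** Inverses are chosen; non-units are left in place, as the structure of unit
    ring requires. *)
Definition ps_inv f : A := if pselect (exists g, g * f = 1) is left e then sval (cid e) else f.

Lemma ps_mulVf : {in ps_unit, left_inverse 1 ps_inv *%R}.
Proof. by move=> f; rewrite /ps_inv => /asboolP uf; case: pselect => // e; case: (cid e). Qed.
Lemma ps_unitPl f g : g * f = 1 -> ps_unit f.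
Proof. by move=> gf; apply/asboolP; exists g. Qed.
Lemma ps_invr_out : {in [predC ps_unit], ps_inv =1 id}.
Proof. by move=> f; rewrite /ps_inv => /asboolPn uf; case: pselect. Qed.

HB.instance Definition _ := GRing.ComNzRing_hasMulInverse.Build A
  ps_mulVf ps_unitPl ps_invr_out.
HB.instance Definition _ := GRing.ComUnitRing_isIntegral.Build A ps_integral.

(** * Partial derivatives, constants and the field of fractions *)

Definition ps_d (i : 'I_n) f : A := fun m => f (m + U_(i))%MM *+ (m i).+1.

Lemma ps_d_jet d i f m : (mdeg m < d)%N -> ps_d i f m = (mderiv i (jet d f))@_m.
Proof. by move=> md; rewrite mcoeff_deriv coef_jet mdegD mdeg1 addn1 md. Qed.

Lemma ps_dD i : {morph ps_d i : f g / f + g}.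
Proof. by move=> f g; apply: funext => m; rewrite /ps_d ps_addE mulrnDl. Qed.

Lemma ps_dZ i c f : ps_d i (c *: f) = c *: ps_d i f.
Proof. by apply: funext => m; rewrite ps_scaleE /ps_d ps_scaleE mulrnAr. Qed.

Lemma ord_ge_mderiv e i (p : {mpoly F[n]}) : ord_ge e.+1 p -> ord_ge e (mderiv i p).
Proof. by move=> pO m me; rewrite mcoeff_deriv pO ?mul0rn // mdegD mdeg1 addn1. Qed.

Lemma ps_dM i f g : ps_d i (f * g) = ps_d i f * g + f * ps_d i g.
Proof.
apply: funext => m; set d := (mdeg m).+1.
have md : (mdeg m < d)%N by [].
have jd h : ord_ge (mdeg m).+1 (jet d (ps_d i h) - mderiv i (jet d h)).
  by move=> k; rewrite ltnS => kd; rewrite mcoeffB coef_jet leqW // -ps_d_jet ?subrr.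
have jM : ord_ge d (mderiv i (jet d (f * g) - jet d f * jet d g)).
  exact/ord_ge_mderiv/ord_ge_jetM.
rewrite ps_addE !(@ps_mulE d) ?leqW // (ps_d_jet _ _ md).
apply/eqP; rewrite -subr_eq0 -mcoeffD -mcoeffB; apply/eqP.
have E : mderiv i (jet d (f * g)) - (jet d (ps_d i f) * jet d g + jet d f * jet d (ps_d i g)) =
   mderiv i (jet d (f * g) - jet d f * jet d g) - (jet d (ps_d i f) - mderiv i (jet d f)) * jet d g
    - jet d f * (jet d (ps_d i g) - mderiv i (jet d g)).
  by rewrite mderivB mderivM; ring.
rewrite E !mcoeffB jM // sub0r.
have H1 : ord_ge (d + 0) ((jet d (ps_d i f) - mderiv i (jet d f)) * jet d g).
  by apply: ord_geM; [apply: jd | apply: ord_ge_any].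
have H2 : ord_ge (0 + d) (jet d f * (jet d (ps_d i g) - mderiv i (jet d g))).
  by apply: ord_geM; [apply: ord_ge_any | apply: jd].
by rewrite H1 ?addn0 // H2 // !oppr0 addr0.
Qed.

Lemma ps_dC i j f : ps_d i (ps_d j f) = ps_d j (ps_d i f).
Proof.
apply: funext => m; rewrite /ps_d -!addmA [(U_(i) + U_(j))%MM]addmC.
by rewrite -!mulrnA !mnmDE !mnm1E [i == j]eq_sym; case: eqP => [->//|_]; rewrite !addn0 mulnC.
Qed.

Lemma ps_d1 i : ps_d i 1 = 0.
Proof. by apply: (addrI (ps_d i 1)); rewrite addr0 -{3}[1]mulr1 ps_dM mulr1 mul1r. Qed.

Definition ps_X (i : 'I_n) : A := @fps_var F n i.

Lemma ps_mulX_coef i f m : (ps_X i * f) (U_(i) + m)%MM = f m.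
Proof.
rewrite ps_mul_sum; have U1 : (mdeg U_(i)%MM < (mdeg (U_(i) + m)).+1)%N.
  by rewrite ltnS mdegD leq_addr.
rewrite (bigD1 (BMultinom U1)) /=; last exact: lem_addr.
have -> : (U_(i) + m - U_(i) = m)%MM by rewrite addmC addmK.
rewrite {1}/ps_X /fps_var eqxx mul1r big1 ?addr0 // => k /andP[_ kU].
rewrite /ps_X /fps_var; case: eqP => [kE|]; last by rewrite mul0r.
by case/eqP: kU; apply: val_inj.
Qed.

Lemma ps_mulX_coef0 i f m : m i = 0%N -> (ps_X i * f) m = 0.
Proof.
move=> mi; rewrite ps_mul_sum big1 // => k /mnm_lepP/(_ i).
rewrite mi leqn0 /ps_X /fps_var => /eqP ki; case: eqP => [kE|]; last by rewrite mul0r.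
by move: ki; rewrite kE mnm1E eqxx.
Qed.

(** Unlike [ps_d i], the Euler operator [x_i d_i] does not move monomials. *)
Lemma ps_euler i f : ps_X i * ps_d i f = (fun m => f m *+ m i) :> A.
Proof.
apply: funext => m; have [mi|mi] := posnP (m i); first by rewrite ps_mulX_coef0 // mi.
have Um : (U_(i) <= m)%MM.
  by apply/mnm_lepP => j; rewrite mnm1E; case: eqP => // <-.
have {Um} [m' ->] : exists m', m = (U_(i) + m')%MM.
  by exists (m - U_(i))%MM; rewrite addmC submK.
by rewrite ps_mulX_coef /ps_d [(m' + _)%MM]addmC mnmDE mnm1E eqxx add1n.
Qed.

Hypothesis F0 : [pchar F] =i pred0.

Lemma natr_inj : injective (fun k : nat => k%:R : F).
Proof.
move=> a b; wlog ab : a b / (a <= b)%N => [H|E].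
  by case: (leqP a b) => [/H//|/ltnW/H{}H E]; rewrite H.
have := (pcharf0P F).1 F0 (b - a)%N; rewrite natrB // E subrr eqxx => /esym.
by rewrite subn_eq0 => ba; apply/eqP; rewrite eqn_leq ab.
Qed.

(** The lowest monomial of a series is that of [x_i d_i f] whenever [x_i] occurs
    in it.  Hence the ratio of two series with proportional gradients is a
    constant: subtracting a multiple of one from the other would otherwise change
    the lowest monomial. *)
Lemma ps_ratio_constant f g : g != 0 ->
  (forall i, f * ps_d i g = g * ps_d i f) -> exists c : F, f = c *: g.
Proof.
move=> g0 fg; have [b lb] := lowestP g0.
have same h : h != 0 -> (forall i, h * ps_d i g = g * ps_d i h) -> lowest h b.
  move=> h0 hg; have [a la] := lowestP h0; suff -> : b = a by [].
  apply/mnmP => i; have := congr1 (fun u : A => (ps_X i * u) (a + b)%MM) (hg i) => /=.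
  rewrite mulrCA [in RHS]mulrCA !ps_euler lowest_mul_coef; last 2 first.
  - by case: la.
  - by move=> k gk; apply: lb.2; apply: contraNneq gk => ->; rewrite mul0rn.
  rewrite [in RHS](addmC a b) lowest_mul_coef; last 2 first.
  - by case: lb.
  - by move=> k hk; apply: la.2; apply: contraNneq hk => ->; rewrite mul0rn.
  rewrite mulrnAr mulrnAr [g b * _]mulrC => /eqP; rewrite -subr_eq0.
  rewrite -[X in X - _]mulr_natr -[X in _ - X]mulr_natr -mulrBr !mulf_eq0.
  rewrite (negPf la.1) (negPf lb.1) /= subr_eq0 => /eqP E.
  exact: natr_inj E.
exists (f b / g b); apply/eqP; rewrite -subr_eq0; apply/negPn/negP => h0.
have := same _ h0; case=> [i|hb _].
  by rewrite ps_dD -scaleN1r scalerA ps_dZ mulrDl mulrDr fg -scalerAl -scalerAr.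
by case/eqP: hb; rewrite ps_subE ps_scaleE divfK ?subrr //; case: lb.
Qed.

End PowerSeriesRing.

Lemma fraction_quot (R : idomainType) (x : {fraction R}) :
  exists pq : R * R, pq.2 != 0 /\ x = tofrac pq.1 / tofrac pq.2.
Proof.
elim/quotW: x => x; exists (\n_x, \d_x); split; first exact: denom_ratioP.
have d0 := denom_ratioP x.
apply: (canRL (mulfK _)); first by rewrite tofrac_eq0.
rewrite !piE; apply/eqmodP; rewrite /= FracField.equivfE.
by rewrite /FracField.mulf !numden_Ratio ?mulf_neq0 ?oner_neq0 // !mulr1 mulrC.
Qed.

Section FractionDerivation.
Variables (R : idomainType) (K : fieldType) (t : {rmorphism R -> K}).
Hypothesis t0 : forall p, (t p == 0) = (p == 0).
Hypothesis tq : forall x, exists pq : R * R, pq.2 != 0 /\ x = t pq.1 / t pq.2.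
Implicit Types (p q : R) (x y : K).

(** The quotient rule for a chosen representation as a fraction; [fderE] shows that
    the choice is irrelevant. *)
Definition fder (D : R -> R) x : K := let pq := sval (cid (tq x)) in
  t (D pq.1 * pq.2 - pq.1 * D pq.2) / t pq.2 ^+ 2.

Lemma t_inj : injective t.
Proof. by move=> p q /eqP; rewrite -subr_eq0 -rmorphB t0 subr_eq0 => /eqP. Qed.

Section OneDerivation.
Variable D : R -> R.
Hypotheses (DD : {morph D : p q / p + q}) (DM : forall p q, D (p * q) = D p * q + p * D q).

Lemma fderE p q : q != 0 -> fder D (t p / t q) = t (D p * q - p * D q) / t q ^+ 2.
Proof.
move=> q0; rewrite /fder; case: cid => -[p' q'] /= [q'0 E].
have /eqP : t p * t q' = t p' * t q by apply/eqP; rewrite -eqr_div ?t0 // E.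
rewrite -!rmorphM => /eqP/t_inj pq.
apply/eqP; rewrite eqr_div ?expf_neq0 ?t0 // -!rmorphXn -!rmorphM; apply/eqP; congr (t _).
have H := congr1 D pq; rewrite !DM in H.
have {}H : D p' * q = D p * q' + p * D q' - p' * D q by rewrite H addrK.
transitivity (D p' * q * (q * q') - p' * q * (D q' * q)); first by ring.
rewrite H -pq; transitivity (D p * q * q' ^+ 2 - p' * q * D q * q'); first by ring.
by rewrite -pq; ring.
Qed.

Lemma fder_t p : fder D (t p) = t (D p).
Proof.
have D1 : D 1 = 0 by apply: (addrI (D 1)); rewrite addr0 -{3}[1]mulr1 DM mulr1 mul1r.
rewrite -[t p]divr1 -(rmorph1 t) fderE ?oner_neq0 //.
by rewrite D1 mulr0 subr0 mulr1 rmorph1 expr1n divr1.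
Qed.

Lemma fderM x y : fder D (x * y) = fder D x * y + x * fder D y.
Proof.
have [[p q] [/= q0 ->]] := tq x; have [[p' q'] [/= q'0 ->]] := tq y.
rewrite mulf_div -!rmorphM !fderE ?mulf_neq0 //; rewrite !DM.
rewrite !(rmorphD, rmorphM, rmorphB); move: q0 q'0; rewrite -!t0 => q0 q'0.
by field; rewrite q0 q'0.
Qed.

Lemma fderD x y : fder D (x + y) = fder D x + fder D y.
Proof.
have [[p q] [/= q0 ->]] := tq x; have [[p' q'] [/= q'0 ->]] := tq y.
rewrite addf_div ?t0 // -!rmorphM -rmorphD !fderE ?mulf_neq0 //; rewrite DD !DM.
rewrite !(rmorphD, rmorphM, rmorphB); move: q0 q'0; rewrite -!t0 => q0 q'0.
by field; rewrite q0 q'0.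
Qed.

End OneDerivation.

Lemma fderC D E x : {morph D : p q / p + q} -> (forall p q, D (p * q) = D p * q + p * D q) ->
    {morph E : p q / p + q} -> (forall p q, E (p * q) = E p * q + p * E q) ->
  (forall p, D (E p) = E (D p)) -> fder D (fder E x) = fder E (fder D x).
Proof.
move=> DD DM ED EM DE; have [[p q] [/= q0 xE]] := tq x.
have xq : x * t q = t p by rewrite xE mulfVK ?t0.
have : fder D (fder E (x * t q)) = fder E (fder D (x * t q)).
  by rewrite xq !fder_t // DE.
rewrite (fderM EM x (t q)) (fderM DM x (t q)) !fder_t // (fderD DD DM) (fderD ED EM).
rewrite (fderM DM (fder E x)) (fderM DM x) (fderM EM (fder D x)) (fderM EM x) !fder_t //.
rewrite DE => /eqP; rewrite -subr_eq0 => /eqP H.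
have q1 : t q != 0 by rewrite t0.
by apply: (mulIf q1); apply/eqP; rewrite -subr_eq0 -H; apply/eqP; ring.
Qed.

End FractionDerivation.

Section FractionSeries.
Variables (F : fieldType) (n : nat).
Hypothesis F0 : [pchar F] =i pred0.
Local Notation A := (pser F n).
Local Notation K := {fraction A}.

Definition fr_d (i : 'I_n) : K -> K := fder (@fraction_quot A) (@ps_d F n i).

Let T0 (p : A) : (tofrac p == 0) = (p == 0). Proof. exact: tofrac_eq0. Qed.

Lemma fr_dD i x y : fr_d i (x + y) = fr_d i x + fr_d i y.
Proof. exact: (fderD T0 _ (@ps_dD _ _ i) (@ps_dM _ _ i)). Qed.

Lemma fr_dM i x y : fr_d i (x * y) = fr_d i x * y + x * fr_d i y.
Proof. exact: (fderM T0 _ (@ps_dM _ _ i)). Qed.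

Lemma fr_dC i j x : fr_d i (fr_d j x) = fr_d j (fr_d i x).
Proof.
exact: (fderC T0 _ _ (@ps_dD _ _ i) (@ps_dM _ _ i) (@ps_dD _ _ j) (@ps_dM _ _ j) (ps_dC i j)).
Qed.

Lemma fr_d_tofrac i (f : A) : fr_d i (tofrac f) = tofrac (ps_d i f).
Proof. exact: (fder_t T0 _ (@ps_dM _ _ i)). Qed.

Definition fr_const (c : F) : K := tofrac (c *: (1 : A)).

Lemma fr_constZ c f : fr_const c * tofrac f = tofrac (c *: f).
Proof. by rewrite /fr_const -tofracM -scalerAl mul1r. Qed.

Lemma fr_const0 : fr_const 0 = 0.
Proof. by rewrite /fr_const scale0r tofrac0. Qed.

Lemma fr_constD : {morph fr_const : c e / c + e}.
Proof. by move=> c e; rewrite /fr_const scalerDl tofracD. Qed.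

(** The constants of the field of fractions are those of [F]: for [x = f / g] the
    gradients of [f] and [g] are proportional. *)
Lemma fr_constantP x : (forall i, fr_d i x = 0) -> exists c, x = fr_const c.
Proof.
have [[p q] [/= q0 ->]] := fraction_quot x; move=> dx.
have tq0 : tofrac q != 0 by rewrite tofrac_eq0.
have [i|c pE] := ps_ratio_constant F0 (f := p) q0.
  have := dx i; rewrite /fr_d (fderE T0 _ (@ps_dM _ _ i)) // => /eqP.
  rewrite mulf_eq0 invr_eq0 expf_eq0 /= (negPf tq0) orbF tofrac_eq0 subr_eq0 => /eqP <-.
  exact: mulrC.
exists c; rewrite /fr_const; apply/(mulIf tq0); rewrite mulfVK // -tofracM; congr tofrac.
by rewrite -scalerAl mul1r.
Qed.

Lemma fr_constM : {morph fr_const : a b / a * b}.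
Proof. by move=> a b; rewrite /fr_const -tofracM -scalerAl mul1r scalerA. Qed.

Lemma fr_const1 : fr_const 1 = 1.
Proof. by rewrite /fr_const scale1r tofrac1. Qed.

Lemma ps_char0 : [pchar A] =i pred0.
Proof.
apply/pcharf0P => k; apply/idP/idP => [/eqP|/eqP-> //].
move=> /(congr1 (fun f : A => f 0%MM)).
have -> : (k%:R : A) 0%MM = k%:R.
  by elim: k => [//|k IHk]; rewrite !mulrS ps_addE IHk ps_1E eqxx.
by move=> /eqP; rewrite ps_0E ((pcharf0P F).1 F0).
Qed.

Lemma fr_char0 : [pchar K] =i pred0.
Proof.
apply/pcharf0P => k; rewrite -tofrac1 -tofracMn tofrac_eq0.
exact: (pcharf0P _).1 ps_char0 k.
Qed.

End FractionSeries.

(** * Operators on power series and their matrices on jets *)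

Lemma der_commutator (R : comPzRingType) (D E : R -> R) x y :
    {morph D : u v / u + v} -> (forall u v, D (u * v) = D u * v + u * D v) ->
    {morph E : u v / u + v} -> (forall u v, E (u * v) = E u * v + u * E v) ->
  D (E (x * y)) - E (D (x * y)) = (D (E x) - E (D x)) * y + x * (D (E y) - E (D y)).
Proof. by move=> DD DM ED EM; rewrite !(DM, EM, DD, ED); ring. Qed.

Section JetOperators.
Variables (F : fieldType) (n : nat).
Local Notation A := (pser F n).
Local Notation ps_X := (@ps_X F n).
Implicit Types (f g h : A) (m k : 'X_{1..n}) (T : A -> A).

Definition vanish e f := forall m, (mdeg m < e)%N -> f m = 0.

Definition ps_mon m : A := fun k => (k == m)%:R.

Lemma vanish_leq e e' f : (e' <= e)%N -> vanish e f -> vanish e' f.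
Proof. by move=> ee fe m me; apply: fe; apply: leq_trans ee. Qed.

Lemma vanishD e f g : vanish e f -> vanish e g -> vanish e (f + g).
Proof. by move=> fe ge m me; rewrite ps_addE fe // ge // addr0. Qed.

Lemma vanishN e f : vanish e f -> vanish e (- f).
Proof. by move=> fe m me; rewrite ps_oppE fe // oppr0. Qed.

Lemma vanishZ e c f : vanish e f -> vanish e (c *: f).
Proof. by move=> fe m me; rewrite ps_scaleE fe // mulr0. Qed.

Lemma vanish_sum e I (r : seq I) (P : pred I) (G : I -> A) :
  (forall i, P i -> vanish e (G i)) -> vanish e (\sum_(i <- r | P i) G i).
Proof. by move=> GP; elim/big_ind: _ => //; exact: vanishD. Qed.

Lemma vanishM e1 e2 f g : vanish e1 f -> vanish e2 g -> vanish (e1 + e2) (f * g).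
Proof.
move=> fe ge m me; rewrite ps_mul_sum big1 // => k km.
have [ke|ke] := ltnP (mdeg k) e1; first by rewrite fe ?mul0r.
rewrite ge ?mulr0 // -(ltn_add2l e1); apply: leq_ltn_trans me.
by rewrite -[m in (_ <= mdeg m)%N](submK km) mdegD addnC leq_add2l.
Qed.

Lemma vanish_d e i f : vanish e.+1 f -> vanish e (ps_d i f).
Proof. by move=> fe m me; rewrite /ps_d fe ?mul0rn // mdegD mdeg1 addn1. Qed.

Lemma vanish_all f : (forall e, vanish e f) -> f = 0.
Proof. by move=> fe; apply: funext => m; apply: (fe (mdeg m).+1). Qed.

Lemma ps_sumE I (r : seq I) (P : pred I) (G : I -> A) m :
  (\sum_(i <- r | P i) G i) m = \sum_(i <- r | P i) G i m.
Proof. by elim/big_rec2: _ => // i x y _ <-. Qed.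

Lemma vanish_decomp e f :
  vanish e (f - \sum_(k : 'X_{1..n < e}) f k *: ps_mon k).
Proof.
move=> m me; rewrite ps_subE ps_sumE (bigD1 (BMultinom me)) //=.
rewrite ps_scaleE /ps_mon eqxx mulr1 big1 ?addr0 ?subrr // => k km.
rewrite ps_scaleE; case: eqP => [E|]; last by rewrite mulr0.
by case/eqP: km; apply: val_inj.
Qed.

(** Operators that are linear and continuous for the adic topology, in the strong
    form needed to act on the space of [d]-jets for every [d]. *)
Record jet_op T : Prop := JetOp {
  jo_lin : forall c f g, T (c *: f + g) = c *: T f + T g;
  jo_vanish : forall e f, vanish e f -> vanish e (T f) }.

Lemma jo_D T f g : jet_op T -> T (f + g) = T f + T g.
Proof. by case=> TL _; rewrite -[f]scale1r TL !scale1r. Qed.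

Lemma jo_0 T : jet_op T -> T 0 = 0.
Proof. by move=> JT; apply: (addrI (T 0)); rewrite -jo_D // !addr0. Qed.

Lemma jo_Z T c f : jet_op T -> T (c *: f) = c *: T f.
Proof. by move=> JT; rewrite -[c *: f]addr0 (jo_lin JT) jo_0 // addr0. Qed.

Lemma jo_B T f g : jet_op T -> T (f - g) = T f - T g.
Proof. by move=> JT; rewrite jo_D // -scaleN1r jo_Z // scaleN1r. Qed.

Lemma jo_sum T I (r : seq I) (P : pred I) (G : I -> A) : jet_op T ->
  T (\sum_(i <- r | P i) G i) = \sum_(i <- r | P i) T (G i).
Proof. by move=> JT; apply: big_morph; [move=> *; exact: jo_D | exact: jo_0]. Qed.

Lemma jo_ext T T' : jet_op T -> jet_op T' -> (forall m, T (ps_mon m) = T' (ps_mon m)) ->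
  forall f, T f = T' f.
Proof.
move=> JT JT' TT f; apply/eqP; rewrite -subr_eq0; apply/eqP/vanish_all => e.
set s := \sum_(k : 'X_{1..n < e}) f k *: ps_mon k.
have E : T s = T' s.
  by rewrite !jo_sum //; apply: eq_bigr => k _; rewrite !jo_Z // TT.
have rv : vanish e (f - s) by apply: vanish_decomp.
move: (f - s) (subrK s f) rv => r <- rv.
rewrite (jo_D _ _ JT) (jo_D _ _ JT') E opprD addrACA subrr addr0.
by apply: vanishD; [|apply: vanishN]; apply: jo_vanish.
Qed.

Lemma ps_mon0 : ps_mon 0%MM = 1. Proof. by []. Qed.

Lemma ps_monUD i k : ps_mon (U_(i) + k)%MM = ps_X i * ps_mon k.
Proof.
apply: funext => m; have [mi|mi] := posnP (m i).
  rewrite ps_mulX_coef0 // /ps_mon; case: eqP => // mE.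
  by move: mi; rewrite mE mnmDE mnm1E eqxx.
have Um : (U_(i) <= m)%MM by apply/mnm_lepP => j; rewrite mnm1E; case: eqP => // <-.
have {Um} [m' ->] : exists m', m = (U_(i) + m')%MM.
  by exists (m - U_(i))%MM; rewrite addmC submK.
by rewrite ps_mulX_coef /ps_mon eqm_add2l.
Qed.

Definition mons d : seq 'X_{1..n} := [seq bmnm (b : 'X_{1..n < d.+1}) | b <- enum {: 'X_{1..n < d.+1}}].
(** One less than the number of monomials: square matrices form a nontrivial ring
    when their size is a successor. *)
Definition njets d := (size (mons d)).-1.

Lemma mem_mons d m : (m \in mons d) = (mdeg m <= d)%N.
Proof.
apply/mapP/idP => [[k _ ->]|md]; first by rewrite -ltnS bmdeg.
by exists (BMultinom (md : (mdeg m < d.+1)%N)); rewrite ?mem_enum.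
Qed.

Lemma uniq_mons d : uniq (mons d).
Proof. by rewrite map_inj_uniq ?enum_uniq //; exact: val_inj. Qed.

Lemma size_mons d : size (mons d) = (njets d).+1.
Proof.
rewrite /njets prednK //; case: (mons d) (mem_mons d 0%MM) => //.
by rewrite mdeg0.
Qed.

Definition mon d (i : 'I_(njets d).+1) := nth 0%MM (mons d) i.
Definition mid d m : 'I_(njets d).+1 := inord (index m (mons d)).

Lemma mon_deg d i : (mdeg (@mon d i) <= d)%N.
Proof. by rewrite -mem_mons mem_nth // size_mons. Qed.

Lemma mon_mid d m : (mdeg m <= d)%N -> mon (mid d m) = m.
Proof.
by move=> md; rewrite /mon inordK ?nth_index ?mem_mons // -size_mons index_mem mem_mons.
Qed.

Lemma mid_mon d i : mid d (@mon d i) = i.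
Proof. by apply: val_inj; rewrite /= inordK index_uniq ?uniq_mons ?size_mons. Qed.

(** The [d]-jet of [f] as a row vector, and below the matrix by which an operator
    acts on such rows from the right. *)
Definition jet_row d f : 'rV[F]_(njets d).+1 := \row_i f (mon i).

Definition jet_mx d T : 'M[F]_((njets d).+1) := \matrix_(i, j) T (ps_mon (mon i)) (mon j).

Lemma jet_rowE d f m : (mdeg m <= d)%N -> jet_row d f 0 (mid d m) = f m.
Proof. by move=> md; rewrite mxE mon_mid. Qed.

Lemma jet_row_eq0 d f : jet_row d f = 0 <-> vanish d.+1 f.
Proof.
split=> [/rowP f0 m|f0]; first by rewrite ltnS => md; rewrite -(jet_rowE _ md) f0 mxE.
by apply/rowP => i; rewrite !mxE f0 // ltnS mon_deg.
Qed.

Lemma jet_rowD d f g : jet_row d (f + g) = jet_row d f + jet_row d g.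
Proof. by apply/rowP => i; rewrite !mxE. Qed.

Lemma jet_rowB d f g : jet_row d (f - g) = jet_row d f - jet_row d g.
Proof. by apply/rowP => i; rewrite !mxE. Qed.

Lemma jet_rowZ d c f : jet_row d (c *: f) = c *: jet_row d f.
Proof. by apply/rowP => i; rewrite !mxE. Qed.

Lemma jet_row_sum d I (r : seq I) (P : pred I) (G : I -> A) :
  jet_row d (\sum_(i <- r | P i) G i) = \sum_(i <- r | P i) jet_row d (G i).
Proof.
by apply: big_morph; [exact: jet_rowD | apply/rowP => i; rewrite !mxE].
Qed.

Lemma jet_row_mon d (i : 'I_(njets d).+1) : jet_row d (ps_mon (mon i)) = delta_mx 0 i.
Proof.
apply/rowP => j; rewrite !mxE /ps_mon eqxx /=; congr (_%:R); congr (nat_of_bool _).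
by apply/eqP/eqP => [E|->//]; rewrite -(mid_mon j) E mid_mon.
Qed.

Lemma row_jet_mx d T i : row i (jet_mx d T) = jet_row d (T (ps_mon (mon i))).
Proof. by apply/rowP => j; rewrite !mxE. Qed.

Lemma jet_row_jet_mx d T f : jet_op T -> jet_row d (T f) = jet_row d f *m jet_mx d T.
Proof.
move=> JT; pose s := \sum_(i < (njets d).+1) f (mon i) *: ps_mon (mon i).
have fs : vanish d.+1 (f - s).
  apply/jet_row_eq0; rewrite jet_rowB jet_row_sum; apply/eqP; rewrite subr_eq0; apply/eqP.
  rewrite [LHS]row_sum_delta; apply: eq_bigr => i _.
  by rewrite jet_rowZ jet_row_mon mxE.
have E g : vanish d.+1 (f - g) -> jet_row d (T f) = jet_row d (T g) /\ jet_row d f = jet_row d g.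
  move=> fg; have H := (jo_vanish JT) _ _ fg; rewrite jo_B // in H.
  by split; apply/eqP; rewrite -subr_eq0 -jet_rowB; apply/eqP/jet_row_eq0.
have [-> _] := E s fs; rewrite jo_sum // jet_row_sum mulmx_sum_row; apply: eq_bigr => i _.
by rewrite jo_Z // jet_rowZ row_jet_mx mxE.
Qed.

Lemma jet_mx_eq d T M : (forall f, jet_row d (T f) = jet_row d f *m M) -> jet_mx d T = M.
Proof. by move=> H; apply/row_matrixP => i; rewrite row_jet_mx H jet_row_mon -rowE. Qed.

Lemma jet_mx_comp d T T' : jet_op T -> jet_op T' -> jet_mx d (T' \o T) = jet_mx d T *m jet_mx d T'.
Proof. by move=> JT JT'; apply: jet_mx_eq => f; rewrite /= !jet_row_jet_mx // mulmxA. Qed.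

Lemma jet_mx_id d : jet_mx d id = 1%:M.
Proof. by apply: jet_mx_eq => f; rewrite mulmx1. Qed.

Lemma jet_mx_D d T T' : jet_op T -> jet_op T' ->
  jet_mx d (fun f => T f + T' f) = jet_mx d T + jet_mx d T'.
Proof. by move=> JT JT'; apply: jet_mx_eq => f; rewrite jet_rowD !jet_row_jet_mx // mulmxDr. Qed.

Lemma jet_mx_Z d c T : jet_op T -> jet_mx d (fun f => c *: T f) = c *: jet_mx d T.
Proof. by move=> JT; apply: jet_mx_eq => f; rewrite jet_rowZ !jet_row_jet_mx // scalemxAr. Qed.

Lemma jet_mx_B d T T' : jet_op T -> jet_op T' ->
  jet_mx d (fun f => T f - T' f) = jet_mx d T - jet_mx d T'.
Proof. by move=> JT JT'; apply: jet_mx_eq => f; rewrite jet_rowB !jet_row_jet_mx // mulmxBr. Qed.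

(** * Formal vector fields *)

Definition ps_der (a : 'I_n -> A) f : A := \sum_i a i * ps_d i f.

Definition in_max_vf (a : 'I_n -> A) := forall i, a i 0%MM = 0.

Lemma ps_derD a : {morph ps_der a : f g / f + g}.
Proof.
by move=> f g; rewrite /ps_der -big_split; apply: eq_bigr => i _; rewrite ps_dD mulrDr.
Qed.

Lemma ps_derM a f g : ps_der a (f * g) = ps_der a f * g + f * ps_der a g.
Proof.
rewrite /ps_der mulr_suml mulr_sumr -big_split; apply: eq_bigr => i _ /=.
by rewrite ps_dM; ring.
Qed.

Lemma vanish1 f : f 0%MM = 0 -> vanish 1 f.
Proof. by move=> f0 m; rewrite ltnS leqn0 mdeg_eq0 => /eqP->. Qed.

Lemma jo_der a : in_max_vf a -> jet_op (ps_der a).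
Proof.
move=> a0; split=> [c f g|[//|e] f fe].
  rewrite ps_derD; congr (_ + _); rewrite /ps_der scaler_sumr; apply: eq_bigr => i _.
  by rewrite ps_dZ -scalerAr.
apply: vanish_sum => i _; rewrite -add1n; apply: vanishM; first exact: vanish1.
exact: vanish_d.
Qed.

Lemma ps_d_X i j : ps_d i (ps_X j) = (i == j)%:R.
Proof.
apply: funext => m; rewrite /ps_d /ps_X /fps_var.
have [->|ij] := eqVneq i j.
  rewrite /= mulr1n ps_1E -{2}[U_(j)%MM]add0m eqm_add2r.
  by case: eqP => [->|]; rewrite ?mul0rn // mnm0E.
case: eqP => [E|]; last by rewrite mul0rn.
have /mnmP/(_ i) := E; rewrite mnmDE !mnm1E eqxx eq_sym (negPf ij).
by rewrite addn1.
Qed.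

Lemma ps_der_X a i : ps_der a (ps_X i) = a i.
Proof.
rewrite /ps_der (bigD1 i) //= ps_d_X eqxx mulr1 big1 ?addr0 // => j ji.
by rewrite ps_d_X (negPf ji) mulr0.
Qed.

Lemma derivation_1 T : jet_op T -> (forall f g, T (f * g) = T f * g + f * T g) -> T 1 = 0.
Proof.
by move=> JT TM; apply: (addrI (T 1)); rewrite addr0 -{3}[1]mulr1 TM mulr1 mul1r.
Qed.

(** Both sides agree on monomials by the Leibniz rule, and both are continuous. *)
Lemma derivation_ps_der T : jet_op T -> (forall f g, T (f * g) = T f * g + f * T g) ->
  in_max_vf (fun i => T (ps_X i)) /\ forall f, T f = ps_der (fun i => T (ps_X i)) f.
Proof.
move=> JT TM; set a := fun i => _.
have a0 : in_max_vf a.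
  move=> i; apply: (jo_vanish JT (e := 1)); last by rewrite mdeg0.
  by apply: vanish1; apply: in_max_var.
split=> //; apply: jo_ext => // [|m]; first exact: jo_der.
elim/mnm_indU: m => [|i k IHk].
  rewrite ps_mon0 derivation_1 // derivation_1 //; [exact: jo_der | exact: ps_derM].
by rewrite ps_monUD TM ps_derM ps_der_X IHk.
Qed.

Definition ps_br (a b : 'I_n -> A) : 'I_n -> A :=
  fun i => ps_der a (b i) - ps_der b (a i).

Lemma ps_br_max a b : in_max_vf a -> in_max_vf b -> in_max_vf (ps_br a b).
Proof.
move=> a0 b0 i; have v c e : in_max_vf c -> in_max_vf e -> ps_der c (e i) 0%MM = 0.
  move=> c0 e0; apply: (jo_vanish (jo_der c0) (e := 1)); last by rewrite mdeg0.
  exact: vanish1.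
by rewrite /ps_br ps_subE !v // subrr.
Qed.

Lemma ps_der_br a b f : in_max_vf a -> in_max_vf b ->
  ps_der (ps_br a b) f = ps_der a (ps_der b f) - ps_der b (ps_der a f).
Proof.
move=> a0 b0; have [Ja Jb] := (jo_der a0, jo_der b0).
pose T f := ps_der a (ps_der b f) - ps_der b (ps_der a f).
have JT : jet_op T.
  split=> [c g h|e g ge]; rewrite /T.
    by rewrite (jo_lin Jb) (jo_lin Ja) (jo_lin Ja) (jo_lin Jb) scalerBr opprD addrACA.
  apply: vanishD; first exact: (jo_vanish Ja (jo_vanish Jb ge)).
  exact: (vanishN (jo_vanish Jb (jo_vanish Ja ge))).
have TM g h : T (g * h) = T g * h + g * T h.
  exact: (der_commutator g h (ps_derD a) (ps_derM a) (ps_derD b) (ps_derM b)).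
have [_ TE] := derivation_ps_der JT TM; rewrite -/(T f) TE.
by congr ps_der; apply: funext => i; rewrite /T !ps_der_X.
Qed.

(** Matrices act on rows from the right, which reverses the bracket. *)
Lemma jet_mx_ps_br d a b : in_max_vf a -> in_max_vf b ->
  jet_mx d (ps_der (ps_br a b)) = comm_br (jet_mx d (ps_der b)) (jet_mx d (ps_der a)).
Proof.
move=> a0 b0; have [Ja Jb] := (jo_der a0, jo_der b0).
apply: jet_mx_eq => f; rewrite ps_der_br // jet_rowB !jet_row_jet_mx // /comm_br -!mulmxE.
by rewrite mulmxBr !mulmxA.
Qed.

Lemma jet_mx_der_inj a : in_max_vf a -> (forall d, jet_mx d (ps_der a) = 0) -> forall i, a i = 0.
Proof.
move=> a0 H i; apply: vanish_all => e; apply: (@vanish_leq e.+1); first exact: leqnSn.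
by apply/jet_row_eq0; rewrite -(ps_der_X a i) jet_row_jet_mx ?H ?mulmx0 //; apply: jo_der.
Qed.

(** * Substitution operators *)

Definition pull (phi : fdiff F n) f : A := fps_comp f phi.

Lemma pull_jet phi f m d : (mdeg m <= d)%N ->
  pull phi f m = (jet d f \mPo jets d phi)@_m.
Proof. by apply: fps_compP; apply: fdiff_max. Qed.

Lemma jo_pull phi : jet_op (pull phi).
Proof.
split=> [c f g|e f fe m me].
  apply: funext => m; rewrite ps_addE ps_scaleE !(@pull_jet _ _ _ (mdeg m)) //.
  by rewrite jetD jetZ comp_mpolyD comp_mpolyZ mcoeffD mcoeffZ.
rewrite (@pull_jet _ _ _ (mdeg m)) //.
have : ord_ge e (jet (mdeg m) f \mPo jets (mdeg m) phi).
  apply: ord_ge_comp; last by apply: ord1_jets; apply: fdiff_max.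
  by move=> k ke; rewrite coef_jet fe // if_same.
exact.
Qed.

Lemma pullM phi f g : pull phi (f * g) = pull phi f * pull phi g.
Proof.
apply: funext => m; set d := mdeg m; rewrite (@pull_jet _ _ _ d) // (@ps_mulE _ _ d) //.
have jp h : ord_ge d.+1 (jet d (pull phi h) - (jet d h \mPo jets d phi)).
  by apply: ord_ge_jet_comp; apply: fdiff_max.
have j1 : Defs.ord1 (jets d phi) by apply: ord1_jets; apply: fdiff_max.
apply/eqP; rewrite -subr_eq0 -mcoeffB; apply/eqP.
have -> : (jet d (f * g) \mPo jets d phi) - jet d (pull phi f) * jet d (pull phi g) =
  ((jet d (f * g) - jet d f * jet d g) \mPo jets d phi)
  - (jet d (pull phi f) - (jet d f \mPo jets d phi)) * jet d (pull phi g)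
  - (jet d f \mPo jets d phi) * (jet d (pull phi g) - (jet d g \mPo jets d phi)).
  by rewrite comp_mpolyB rmorphM /=; ring.
have H0 : ord_ge d.+1 ((jet d (f * g) - jet d f * jet d g) \mPo jets d phi).
  by apply: ord_ge_comp => //; apply: ord_ge_jetM.
have H1 : ord_ge (d.+1 + 0) ((jet d (pull phi f) - (jet d f \mPo jets d phi)) * jet d (pull phi g)).
  by apply: ord_geM => //; apply: ord_ge_any.
have H2 : ord_ge (0 + d.+1) ((jet d f \mPo jets d phi) * (jet d (pull phi g) - (jet d g \mPo jets d phi))).
  by apply: ord_geM => //; apply: ord_ge_any.
by rewrite !mcoeffB H0 // H1 ?addn0 // H2 // !subr0.
Qed.

Lemma pull1 phi : pull phi 1 = 1.
Proof.
apply: funext => m; rewrite (@pull_jet _ _ _ (mdeg m)) // jet_one rmorph1.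
by rewrite mcoeff1.
Qed.

Lemma pull_X phi i : pull phi (ps_X i) = phi i.
Proof. by apply: fps_comp_idl; apply: fdiff_max. Qed.

(** Substitution reverses the order of composition; with matrices acting on rows
    from the right the order is restored in [jet_mx_pullM]. *)
Lemma pull_comp phi psi f : pull (phi * psi)%g f = pull psi (pull phi f).
Proof. by rewrite /pull fps_compA //; apply: fdiff_max. Qed.

Lemma pull_id f : pull 1%g f = f.
Proof. exact: fps_comp_idr. Qed.

Lemma jet_mx_pullM d phi psi : jet_mx d (pull (phi * psi)%g) = jet_mx d (pull phi) * jet_mx d (pull psi).
Proof.
rewrite -mulmxE -jet_mx_comp; [|exact: jo_pull..].
by congr jet_mx; apply: funext => f; rewrite pull_comp.
Qed.

Lemma jet_mx_pull1 d : jet_mx d (pull 1%g) = 1.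
Proof. by apply: jet_mx_eq => f; rewrite pull_id mulmx1. Qed.

Lemma jet_mx_pull_inj phi : (forall d, jet_mx d (pull phi) = 1) -> phi = 1%g.
Proof.
move=> H; apply: fdiffP => i.
have : pull phi (ps_X i) - ps_X i = 0.
  apply: vanish_all => e; apply: (@vanish_leq e.+1); first exact: leqnSn.
  by apply/jet_row_eq0; rewrite jet_rowB jet_row_jet_mx ?H ?mulmx1 ?subrr //; apply: jo_pull.
by move/eqP; rewrite subr_eq0 pull_X => /eqP.
Qed.

End JetOperators.

(** * Unipotent substitutions and their logarithms *)

Section Unipotent.
Variables (F : fieldType) (n : nat) (phi : fdiff F n).
Local Notation A := (pser F n).
Local Notation ps_X := (@ps_X F n).
Local Notation ps_mon := (@ps_mon F n).
Implicit Types (f g h : A) (m k : 'X_{1..n}).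

Definition pull_diff f : A := pull phi f - f.
Local Notation delta := pull_diff.

Lemma jo_delta : jet_op delta.
Proof.
have Jp := jo_pull phi; split=> [c f g|e f fe].
  by rewrite /delta (jo_lin Jp) opprD addrACA -scalerBr.
by apply: vanishD; [apply: (jo_vanish Jp) | apply: vanishN].
Qed.

Lemma jo_iter T c : jet_op T -> jet_op (iter c T : A -> A).
Proof.
move=> JT; elim: c => [|c IHc]; first by split.
split=> [a f g|e f fe] /=; first by rewrite (jo_lin IHc) (jo_lin JT).
exact: (jo_vanish JT (jo_vanish IHc fe)).
Qed.

Lemma delta_M f g : delta (f * g) = delta f * g + f * delta g + delta f * delta g.
Proof. by rewrite /delta pullM; move: (pull phi f) (pull phi g) => f' g'; ring. Qed.

Lemma delta_lin f : f 0%MM = 0 -> lin_part (fun _ : 'I_n => delta f) =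
  lin_part (fun _ : 'I_n => f) *m (lin_part phi - 1%:M).
Proof.
move=> f0; rewrite mulmxBr mulmx1 -lin_part_comp //; last exact: fdiff_max.
by apply/matrixP => i j; rewrite !mxE.
Qed.

(** In degree one substitution acts through the linear part. *)
Lemma delta_order1 c : (lin_part phi - 1%:M) ^+ c = 0 -> forall f, vanish 1 f ->
  vanish 2 (iter c delta f).
Proof.
move=> Lc f f1; have H j : lin_part (fun _ : 'I_n => iter j delta f) =
    lin_part (fun _ : 'I_n => f) *m (lin_part phi - 1%:M) ^+ j.
  elim: j => [|j IHj]; first by rewrite expr0 mulmx1.
  rewrite [iter _ _ _]/(delta (iter j delta f)) delta_lin.
    by rewrite IHj exprSr -mulmxE mulmxA.
  by apply: (jo_vanish (jo_iter j jo_delta) f1); rewrite mdeg0.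
move=> m; rewrite ltnS leq_eqVlt => /orP[/mdeg1P[i /eqP ->]|m0]; last first.
  exact: (jo_vanish (jo_iter c jo_delta) f1).
by have /matrixP/(_ i i) := H c; rewrite Lc mulmx0 !mxE.
Qed.

(** By the twisted Leibniz rule [delta_M], each application of [delta] to a product
    lets it fall on one of the two factors at least. *)
Lemma delta_prod a b e f g : vanish 1 f -> vanish e g ->
    vanish 2 (iter a delta f) -> vanish e.+1 (iter b delta g) ->
  vanish e.+2 (iter (a + b) delta (f * g)).
Proof.
have keep c j h : vanish j h -> vanish j (iter c delta h).
  by move=> hj; apply: (jo_vanish (jo_iter c jo_delta)).
have [N] := ubnP (a + b); elim: N => // N IHN in a b f g *; rewrite ltnS => abN f1 ge fa gb.
case: a abN fa => [|a] abN fa; first by apply: keep; rewrite -add2n; apply: vanishM.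
case: b abN gb => [|b] abN gb; first by apply: keep; rewrite -add1n; apply: vanishM.
have d1 : vanish 1 (delta f) by apply: (jo_vanish jo_delta).
have de : vanish e (delta g) by apply: (jo_vanish jo_delta).
rewrite iterSr in fa; rewrite iterSr in gb.
rewrite addSn iterSr delta_M !(jo_D _ _ (jo_iter _ jo_delta)); apply: vanishD; first apply: vanishD.
- by apply: IHN => //; rewrite iterSr.
- by rewrite -addSnnS; apply: IHN => //; [rewrite addSnnS | rewrite iterSr].
rewrite addnS iterS; apply: (jo_vanish jo_delta); apply: IHN => //.
by apply: leq_trans abN; rewrite addSn addnS ltnS leqnSn.
Qed.

(** A monomial of degree [e + 1] is a variable times a monomial of degree [e]. *)
Lemma delta_order : unipotent phi -> forall e, exists c, forall f, vanish e f ->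
  vanish e.+1 (iter c delta f).
Proof.
case=> k Lk; elim=> [|e [c Hc]].
  exists 1%N => f _; apply: vanish1; rewrite /= /delta ps_subE /pull fps_comp0 ?subrr //.
  exact: fdiff_max.
exists (k + c)%N => f fe; have JI := jo_iter (k + c) jo_delta.
set s := \sum_(m : 'X_{1..n < e.+2}) f m *: ps_mon m.
have rv : vanish e.+2 (f - s) by apply: vanish_decomp.
have sv : vanish e.+2 (iter (k + c) delta s).
  rewrite (jo_sum _ _ _ JI); apply: vanish_sum => m _; rewrite (jo_Z _ _ JI).
  have [me|me] := ltnP (mdeg m) e.+1; first by rewrite fe // scale0r.
  apply: vanishZ; have [i mi] : exists i, (0 < bmnm m i)%N.
    apply: contrapT => H; move: me; rewrite mdegE big1 // => i _; apply/eqP.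
    by rewrite -leqn0 leqNgt; apply/negP => mi; apply: H; exists i.
  have Um : (U_(i) <= bmnm m)%MM.
    by apply/mnm_lepP => j; rewrite mnm1E; case: eqP => // <-.
  have [m' mE] : exists m', bmnm m = (U_(i) + m')%MM.
    by exists (bmnm m - U_(i))%MM; rewrite addmC submK.
  have vm' : vanish e (ps_mon m').
    move=> l le; rewrite -[LHS]/((l == m')%:R); case: eqP => // lm.
    by move: me; rewrite mE mdegD mdeg1 -lm add1n ltnS leqNgt le.
  rewrite mE ps_monUD; apply: delta_prod => //.
  - by apply: vanish1; apply: in_max_var.
  - by apply: delta_order1 => //; apply: vanish1; apply: in_max_var.
  exact: Hc.
by rewrite -[f](subrK s) (jo_D _ _ JI); apply: vanishD => //; apply: (jo_vanish JI).
Qed.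

Lemma delta_nil : unipotent phi -> forall e, exists c, forall f, vanish e (iter c delta f).
Proof.
move=> U; elim=> [|e [c Hc]]; first by exists 0%N.
have [c' Hc'] := delta_order U e; exists (c' + c)%N => f; rewrite iterD.
exact: Hc'.
Qed.

Lemma jet_mx_pull_nil d : unipotent phi -> exists c, (jet_mx d (pull phi) - 1) ^+ c = 0.
Proof.
move=> U; have [c Hc] := delta_nil U d.+1; exists c.
have E : jet_mx d delta = jet_mx d (pull phi) - 1.
  rewrite -[1 in RHS](jet_mx_id F n d); apply: jet_mx_B; first exact: jo_pull.
  by split.
have H j : jet_mx d (iter j delta) = (jet_mx d (pull phi) - 1) ^+ j.
  elim: j => [|j IHj]; first by rewrite expr0 [LHS]jet_mx_id.
  by rewrite [iter j.+1 _]/(delta \o iter j delta) (jet_mx_comp d (jo_iter j jo_delta) jo_delta) IHj E exprSr.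
rewrite -H; apply: jet_mx_eq => f; rewrite mulmx0; exact/jet_row_eq0.
Qed.

End Unipotent.

Section LogVectorField.
Variables (F : fieldType) (n : nat) (phi : fdiff F n).
Hypothesis F0 : [pchar F] =i pred0.
Local Notation A := (pser F n).
Local Notation ps_X := (@ps_X F n).
Implicit Types (f g h : A) (m k : 'X_{1..n}).
Local Notation q d := (@invS F (njets n d)).

Lemma poly_nat_eq (p r : {poly F}) : (forall t : nat, p.[t%:R] = r.[t%:R]) -> p = r.
Proof.
move=> pr; apply/polyP => i; apply/eqP; rewrite -subr_eq0 -coefB; apply/eqP.
set s := p - r; have sv (t : nat) : s.[t%:R] = 0 by rewrite hornerD hornerN pr subrr.
pose c (j : 'I_(maxn i.+1 (size s))) : F^o := s`_j.
have ltm : (i < maxn i.+1 (size s))%N by rewrite leq_max leqnn.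
rewrite -[s`_i]/(c (Ordinal ltm)).
pose Z : set F^o := [set x | x = 0]%classic.
suff : Z (c (Ordinal ltm)) by [].
apply: (coef_interpolation F0) => //.
  by move=> a u v /= -> ->; rewrite scaler0 addr0.
move=> t; rewrite /Z /=; transitivity s.[t%:R]; last exact: sv.
rewrite (@horner_coef_wide _ (maxn i.+1 (size s))) ?leq_maxr //.
by apply: eq_bigr => j _; rewrite /c /GRing.scale /= mulrC.
Qed.

(** [p] is the coefficient at [m] of [f o phi^t] as a polynomial in [t]. *)
Definition orbit_poly f m (p : {poly F}) :=
  p`_0 = f m /\ forall t : nat, iter t (pull phi) f m = p.[t%:R].

Lemma orbit_poly_uniq f m p r : orbit_poly f m p -> orbit_poly f m r -> p = r.
Proof. by move=> [_ Hp] [_ Hr]; apply: poly_nat_eq => t; rewrite -Hp Hr. Qed.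

(** [phi^t] has matrix [ex (t z)] with [z] the logarithm, a polynomial in [t]. *)
Lemma log_orbit_poly d P N f m : nilfilter (q d) P N -> P 1%N (jet_mx d (pull phi) - 1) ->
  (mdeg m <= d)%N -> exists2 p, orbit_poly f m p &
    p`_1 = (jet_row d f *m lg (q d) P N (jet_mx d (pull phi))) 0 (mid d m).
Proof.
move=> NF Pu md; have [Pz zE] := lgP NF Pu; set z := lg _ _ _ _ in Pz zE *.
exists (\poly_(k < N.+2) (jet_row d f *m (ifact (q d) k * z ^+ k)) 0 (mid d m)); last first.
  rewrite coef_poly /= expr1 ifactS mulr1.
  suff -> : q d 0 = 1 by rewrite mul1r.
  by rewrite -[LHS]mulr1 -[RHS](nf_q NF 0).
split; first by rewrite coef_poly /= expr0 mulr1 mulmx1 jet_rowE.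
move=> t; have jt : jet_row d (iter t (pull phi) f) = jet_row d f *m jet_mx d (pull phi) ^+ t.
  elim: t => [|t IHt]; first by rewrite expr0 mulmx1.
  by rewrite iterS (jet_row_jet_mx d _ (jo_pull phi)) IHt exprSr -mulmxE mulmxA.
rewrite -(jet_rowE _ md) jt -zE -(ex_Mn _ NF Pz) (ex_pad NF (nf_Mn _ NF Pz)).
rewrite horner_poly mulmx_sumr summxE; apply: eq_bigr => k _.
rewrite [(z *+ t) ^+ k]exprMn_n mulrnAr (raddfMn (mulmx (jet_row d f))) mulmxnE -[LHS]mulr_natr natrX.
by [].
Qed.

(** The coefficients of [f o phi^t] are polynomial in [t]; the derivative at
    [t = 0] is a derivation in [f], whose matrices on jets are the logarithms. *)
Lemma log_vf :
    (forall d, exists P N, nilfilter (q d) P N /\ P 1%N (jet_mx d (pull phi) - 1)) ->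
  exists2 a, in_max_vf a & forall d P N, nilfilter (q d) P N ->
    P 1%N (jet_mx d (pull phi) - 1) -> jet_mx d (ps_der a) = lg (q d) P N (jet_mx d (pull phi)).
Proof.
move=> H; have ex f m : exists p, orbit_poly f m p.
  have [P [N [NF Pu]]] := H (mdeg m).
  by have [p Hp _] := log_orbit_poly f NF Pu (leqnn _); exists p.
pose pol f m := sval (cid (ex f m)); have polP f m : orbit_poly f m (pol f m) by apply: svalP.
pose T f : A := fun m => (pol f m)`_1.
have TE f m p : orbit_poly f m p -> T f m = p`_1.
  by move=> Hp; rewrite /T (orbit_poly_uniq (polP f m) Hp).
have Jp t := jo_iter t (jo_pull phi).
have JT : jet_op T.
  split=> [c f g|e f fe m me].
    apply: funext => m; rewrite (TE _ _ (c *: pol f m + pol g m)).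
      by rewrite coefD coefZ.
    have [[f0 Hf] [g0 Hg]] := (polP f m, polP g m).
    split=> [|t]; first by rewrite coefD coefZ f0 g0.
    by rewrite (jo_lin (Jp t)) ps_addE ps_scaleE Hf Hg hornerD hornerZ.
  rewrite (TE _ _ 0) ?coef0 //; split=> [|t]; first by rewrite coef0 fe.
  by rewrite horner0 (jo_vanish (Jp t) fe).
have TM f g : T (f * g) = T f * g + f * T g.
  apply: funext => m.
  pose r := \sum_(k : 'X_{1..n < (mdeg m).+1} | (k <= m)%MM) pol f k * pol g (m - k)%MM.
  have pM t : iter t (pull phi) (f * g) = iter t (pull phi) f * iter t (pull phi) g.
    by elim: t => // t IHt; rewrite !iterS IHt pullM.
  rewrite (TE _ _ r).
    rewrite coef_sum ps_addE !ps_mul_sum -big_split; apply: eq_bigr => k _ /=.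
    have [[f0 _] [g0 _]] := (polP f k, polP g (m - k)%MM).
    by rewrite coefM !big_ord_recl big_ord0 /= addr0 f0 g0 addrC.
  split=> [|t]; last first.
    rewrite pM ps_mul_sum horner_sum; apply: eq_bigr => k _.
    have [[_ Hf] [_ Hg]] := (polP f k, polP g (m - k)%MM).
    by rewrite hornerM Hf Hg.
  rewrite coef_sum ps_mul_sum; apply: eq_bigr => k _.
  have [[f0 _] [g0 _]] := (polP f k, polP g (m - k)%MM).
  by rewrite coefM big_ord1 f0 g0.
have [a0 Ta] := derivation_ps_der JT TM; exists (fun i => T (ps_X i)) => // d P N NF Pu.
have -> : ps_der (fun i => T (ps_X i)) = T by apply: funext => f; rewrite -Ta.
apply: jet_mx_eq => f; apply/rowP => i; rewrite mxE.
have [p Hp p1] := log_orbit_poly f NF Pu (mon_deg i).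
by rewrite (TE _ _ p Hp) p1 mid_mon.
Qed.

End LogVectorField.

(** * The upper bound *)

(** Membership in a subspace over the field of fractions becomes a system of
    equations with coefficients in the ring, which can be tested modulo powers of
    the maximal ideal. *)
Lemma common_denominator (R : idomainType) m n (M : 'M[{fraction R}]_(m, n)) :
  exists2 q : R, q != 0 & exists N : 'M[R]_(m, n), tofrac q *: M = map_mx (@tofrac R) N.
Proof.
pose f i j := sval (cid (fraction_quot (M i j))).
have fP i j : (f i j).2 != 0 /\ M i j = tofrac (f i j).1 / tofrac (f i j).2.
  exact: svalP (cid (fraction_quot (M i j))).
pose q := \prod_i \prod_j (f i j).2.
exists q; first by apply/prodf_neq0 => i _; apply/prodf_neq0 => j _; case: (fP i j).
exists (\matrix_(i, j) ((f i j).1 * (\prod_(l | l != j) (f i l).2) * \prod_(k | k != i) \prod_l (f k l).2)).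
apply/matrixP => i j; rewrite !mxE; have [q0 ->] := fP i j.
have cancel (K : fieldType) (a b c e : K) : c != 0 -> c * b * e * (a / c) = a * b * e.
  by move=> c0; field.
by rewrite /q (bigD1 i) //= (bigD1 j) //= !tofracM cancel // tofrac_eq0.
Qed.

(** The row spaces of the powers of [L] become stationary. *)
Lemma stable_rowspace (F : fieldType) e (L : 'M[F]_e.+1) :
  (exists k, L ^+ k = 0) \/
  exists2 y : 'rV[F]_e.+1, y != 0 & exists N0, forall N, (N0 <= N)%N -> (y <= L ^+ N)%MS.
Proof.
have ex : exists r, `[< exists k, \rank (L ^+ k) = r >].
  by exists (\rank (L ^+ 0)); apply/asboolP; exists 0%N.
case: (ex_minnP ex) => r /asboolP[k rk] rmin.
have sub N : (k <= N)%N -> (L ^+ N <= L ^+ k)%MS.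
  by move=> /subnK <-; rewrite exprD -mulmxE submxMl.
have eqs N : (k <= N)%N -> (L ^+ k <= L ^+ N)%MS.
  move=> kN; rewrite -(geq_leqif (mxrank_leqif_sup (sub _ kN))) rk.
  by apply: rmin; apply/asboolP; exists N.
have [L0|L0] := eqVneq (L ^+ k) 0; first by left; exists k.
right; have [i Li] : exists i, row i (L ^+ k) != 0.
  apply: contrapT => H; case/eqP: L0; apply/row_matrixP => i; rewrite row0.
  by apply/eqP/negPn/negP => Li; apply: H; exists i.
exists (row i (L ^+ k)) => //; exists k => N kN.
exact: submx_trans (row_sub i _) (eqs _ kN).
Qed.

Section UpperBound.
Variables (F : fieldType) (n : nat).
Hypothesis F0 : [pchar F] =i pred0.
Local Notation A := (pser F n).
Local Notation K := {fraction A}.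
Local Notation ps_X := (@ps_X F n).
Local Notation fr_d := (@fr_d F n).
Local Notation fr_const := (@fr_const F n).
Local Notation vf_br := (@vf_br K n fr_d).
Local Notation vf_act := (@vf_act K n fr_d).
Local Notation q d := (@invS F (njets n d)).
Implicit Types (f g h : A) (a b : 'I_n -> A) (phi psi : fdiff F n).

Let dD := @fr_dD F n.
Let dM := @fr_dM F n.
Let brA : lie_axioms vf_br := vf_br_lie dD dM (@fr_dC F n).

Definition to_frac a : 'rV[K]_n := \row_i tofrac (a i).

Lemma to_frac_act a f : vf_act (to_frac a) (tofrac f) = tofrac (ps_der a f).
Proof.
rewrite /ps_der rmorph_sum; apply: eq_bigr => i _ /=.
by rewrite mxE fr_d_tofrac -tofracM.
Qed.

Lemma to_frac_br a b : vf_br (to_frac a) (to_frac b) = to_frac (ps_br a b).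
Proof. by apply/rowP => i; rewrite !mxE !to_frac_act -tofracB. Qed.

Lemma to_frac_inj a b : to_frac a = to_frac b -> a = b.
Proof.
move=> /rowP ab; apply: funext => i; apply/eqP; rewrite -tofrac_eq.
by have := ab i; rewrite !mxE => ->.
Qed.

Lemma to_fracD a b : to_frac a + to_frac b = to_frac (fun i => a i + b i).
Proof. by apply/rowP => i; rewrite !mxE tofracD. Qed.

Lemma to_fracB a b : to_frac a - to_frac b = to_frac (fun i => a i - b i).
Proof. by apply/rowP => i; rewrite !mxE tofracB. Qed.

Lemma to_frac0 : to_frac (fun _ => 0) = 0.
Proof. by apply/rowP => i; rewrite !mxE tofrac0. Qed.

Lemma to_fracZ c a : fr_const c *: to_frac a = to_frac (fun i => c *: a i).
Proof. by apply/rowP => i; rewrite !mxE fr_constZ. Qed.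

Lemma map_fr_constM m p r (M : 'M[F]_(m, p)) (M' : 'M[F]_(p, r)) :
  map_mx fr_const (M *m M') = map_mx fr_const M *m map_mx fr_const M'.
Proof.
apply/matrixP => i j; rewrite !mxE (big_morph _ (@fr_constD F n) (@fr_const0 F n)).
by apply: eq_bigr => k _; rewrite !mxE fr_constM.
Qed.

Lemma act_const u c : vf_act u (fr_const c) = 0.
Proof.
apply: big1 => i _; rewrite fr_d_tofrac ps_dZ.
by rewrite ps_d1 scaler0 tofrac0 mulr0.
Qed.

Lemma ps_der_add a b : ps_der (fun i => a i + b i) = (fun f => ps_der a f + ps_der b f).
Proof.
by apply: funext => f; rewrite /ps_der -big_split; apply: eq_bigr => i _; rewrite mulrDl.
Qed.

Lemma ps_der_scale c a : ps_der (fun i => c *: a i) = (fun f => c *: ps_der a f).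
Proof.
apply: funext => f; rewrite /ps_der scaler_sumr; apply: eq_bigr => i _.
by rewrite -scalerAl.
Qed.

Lemma in_max_vfD a b : in_max_vf a -> in_max_vf b -> in_max_vf (fun i => a i + b i).
Proof. by move=> a0 b0 i; rewrite ps_addE a0 b0 addr0. Qed.

Lemma in_max_vfZ c a : in_max_vf a -> in_max_vf (fun i => c *: a i).
Proof. by move=> a0 i; rewrite ps_scaleE a0 mulr0. Qed.

Lemma jet_mx_der_lin d c a b : in_max_vf a -> in_max_vf b ->
  jet_mx d (ps_der (fun i => c *: a i + b i)) = c *: jet_mx d (ps_der a) + jet_mx d (ps_der b).
Proof.
move=> a0 b0; have ca0 := in_max_vfZ c a0.
rewrite (ps_der_add (fun i => c *: a i)) jet_mx_D; [|exact: jo_der..].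
by rewrite ps_der_scale jet_mx_Z //; apply: jo_der.
Qed.

Lemma jet_mx_der0 d : jet_mx d (ps_der (fun _ : 'I_n => (0 : A))) = 0.
Proof.
apply: jet_mx_eq => f; rewrite mulmx0; apply/jet_row_eq0.
by rewrite /ps_der big1 // => i _; rewrite mul0r.
Qed.

Lemma jet_mx_der_vanish d a : in_max_vf a -> jet_mx d (ps_der a) = 0 -> forall i, vanish d.+1 (a i).
Proof.
move=> a0 ad i; apply/jet_row_eq0; rewrite -(ps_der_X a i) jet_row_jet_mx ?ad ?mulmx0 //.
exact: jo_der.
Qed.

Variables (G : set (fdiff F n)) (l : nat).
Hypotheses (sG : is_subgroup G) (uG : unipotent_set G).
Hypothesis Gl : derived l G = [set 1%g]%classic.

Let rho d phi : 'M[F]_((njets n d).+1) := jet_mx d (pull phi).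

Let flag d : {PN : (nat -> set 'M[F]_((njets n d).+1)) * nat |
  [/\ nilfilter (q d) PN.1 PN.2, forall j c M, PN.1 j M -> PN.1 j (c *: M) &
     forall phi, G phi -> PN.1 1%N (rho d phi - 1)]}.
Proof.
apply: cid.
have [|U [U0 US U1 Ug]] := kolchin_flag (jet_mx_pullM d) (jet_mx_pull1 F n d) sG Gl.
  by move=> phi /uG/jet_mx_pull_nil.
exists ((fun j M => forall k, (U (k + j)%N *m M <= U k)%MS), (njets n d).+1).
split=> /=.
- exact: flag_nilfilter.
- by move=> j c M PM k; rewrite -scalemxAr scalemx_sub.
by move=> phi Gphi k; rewrite addn1; apply: Ug.
Qed.

Let filt d := (sval (flag d)).1.
Local Notation P d := (@filt d).
Let N d := (sval (flag d)).2.

Let NF d : nilfilter (q d) (P d) (N d). Proof. by case: (svalP (flag d)). Qed.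
Let PZ d j c M : P d j M -> P d j (c *: M).
Proof. by case: (svalP (flag d)) => _ + _; apply. Qed.
Let Prho d phi : G phi -> P d 1%N (rho d phi - 1).
Proof. by case: (svalP (flag d)) => _ _; apply. Qed.

Local Notation log d phi := (lg (q d) (P d) (N d) (rho d phi)).

Let logspan k d : set 'M[F]_((njets n d).+1) :=
  lspan [set log d phi | phi in derived k G]%classic.
Local Notation logs k d := (@logspan k d).

Let logs_br k d x y : logs k d x -> logs k d y -> logs k.+1 d (comm_br x y).
Proof.
have cA := comm_br_lie 'M[F]_((njets n d).+1).
have linl (c : F) u v w : @comm_br 'M[F]_((njets n d).+1) (c *: u + v) w =
    c *: comm_br u w + comm_br v w.
  by rewrite (lie_brDl cA); congr (_ + _); rewrite /comm_br -scalerAl -scalerAr scalerBr.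
have skl : is_subgroup (derived k G) by apply: derived_group.
have kG phi : derived k G phi -> G phi by apply: derived_sub.
move=> Lx Ly; elim: Lx => [|c _ v [phi Hphi <-] _ IH].
  by rewrite (lie_br0l cA); left.
rewrite linl; apply: lspan_lin => //; elim: Ly => [|e _ w [psi Hpsi <-] _ IH'].
  by rewrite (lie_br0r cA); left.
rewrite (lie_brC cA) linl opprD -scalerN -!(lie_brC cA); apply: lspan_lin => //.
apply: (log_br F0 (jet_mx_pullM d) (jet_mx_pull1 F n d) (NF d) skl) => // g /kG.
exact: Prho.
Qed.

Let logs_P d x : logs 0 d x -> P d 1%N x.
Proof.
apply: lspan_ind_lin => [|c u v Pu Pv|_ [phi Gphi <-]].
- exact: (nf_0 (NF d)).
- by apply: (nf_D (NF d)) => //; apply: PZ.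
by apply: (nf_lg (NF d)); apply: Prho.
Qed.

Let vfs k : set ('I_n -> A) :=
  [set a | in_max_vf a /\ forall d, logs k d (jet_mx d (ps_der a))]%classic.

Let S : set 'rV[K]_n := [set to_frac a | a in vfs 0]%classic.

Let logs_sub k d x : logs k.+1 d x -> logs k d x.
Proof.
apply: lspan_ind_lin => [|c u v|_ [phi Gphi <-]]; first by left.
  exact: lspan_lin.
by apply: lspan_mem; exists phi => //; apply: derived_subgroup_sub Gphi; apply: derived_group.
Qed.

Let vfs_lin k c a b : vfs k a -> vfs k b -> vfs k (fun i => c *: a i + b i).
Proof.
move=> [a0 Ha] [b0 Hb]; split; first by apply: in_max_vfD => //; apply: in_max_vfZ.
by move=> d; rewrite jet_mx_der_lin //; apply: (lspan_lin c (Ha d) (Hb d)).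
Qed.

Let vfs_br k a b : vfs k a -> vfs k b -> vfs k.+1 (ps_br a b).
Proof.
move=> [a0 Ha] [b0 Hb]; split; first exact: ps_br_max.
by move=> d; rewrite jet_mx_ps_br //; apply: logs_br.
Qed.

Let vfs0 k : vfs k (fun _ => 0).
Proof. by split=> [i //|d]; rewrite jet_mx_der0; left. Qed.

Let SL : lie_ring vf_br S.
Proof.
split=> [|_ _ [a Ha <-] [b Hb <-]|_ _ [a Ha <-] [b Hb <-]].
- by exists (fun _ => 0); rewrite ?to_frac0 //; apply: vfs0.
- rewrite to_fracB; exists (fun i => -1 *: b i + a i); first exact: vfs_lin.
  by congr to_frac; apply: funext => i; rewrite scaleN1r addrC.
rewrite to_frac_br; exists (ps_br a b) => //; have [i0 H] := vfs_br Ha Hb.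
by split=> // d; apply: logs_sub.
Qed.

Let ser_vfs k u : lie_ser vf_br k S u -> exists2 a, vfs k a & u = to_frac a.
Proof.
elim: k u => [|k IHk] u; first by case=> a Ha <-; exists a.
elim=> [|v w s /IHk[a Ha ->] /IHk[b Hb ->] _ [c Hc ->]].
  by exists (fun _ => 0); rewrite ?to_frac0 //; apply: vfs0.
rewrite to_frac_br to_fracD; exists (fun i => 1 *: ps_br a b i + c i).
  by apply: vfs_lin => //; apply: vfs_br.
by congr to_frac; apply: funext => i; rewrite scale1r.
Qed.

Let log1 d : log d 1%g = 0.
Proof.
rewrite /rho jet_mx_pull1 -(ex0 (NF d)) (lg_ex (NF d)) //; exact: (nf_0 (NF d)).
Qed.

Let SS : lie_solvable vf_br S.
Proof.
exists l => u /ser_vfs[a [a0 Ha] ->]; rewrite -to_frac0; congr to_frac.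
apply: funext => i; apply: (jet_mx_der_inj a0) => d; move: (Ha d).
apply: (lspan_ind_lin (Q := [set x | x = 0]%classic)) => // [c u' v /= -> ->|x [phi]].
  by rewrite scaler0 addr0.
by rewrite Gl => -> <- /=; apply: log1.
Qed.

Let comb e (y : 'I_e -> 'I_n -> A) (c : 'rV[F]_e) : 'I_n -> A :=
  fun i => \sum_k c 0 k *: y k i.

Let comb_vfs e (y : 'I_e -> 'I_n -> A) c : (forall k, vfs 0 (y k)) -> vfs 0 (comb y c).
Proof.
move=> Hy; split=> [i|d].
  by rewrite /comb ps_sumE big1 // => k _; rewrite ps_scaleE; case: (Hy k) => -> _; rewrite mulr0.
have -> : jet_mx d (ps_der (comb y c)) = \sum_k c 0 k *: jet_mx d (ps_der (y k)).
  apply: jet_mx_eq => f; rewrite mulmx_sumr.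
  have -> : ps_der (comb y c) f = \sum_k c 0 k *: ps_der (y k) f.
    rewrite /ps_der /comb; under eq_bigr do rewrite mulr_suml.
    rewrite exchange_big; apply: eq_bigr => k _; rewrite scaler_sumr.
    by apply: eq_bigr => i _; rewrite -scalerAl.
  rewrite jet_row_sum; apply: eq_bigr => k _; rewrite jet_rowZ -scalemxAr jet_row_jet_mx //.
  by apply: jo_der; case: (Hy k).
elim/big_ind: _ => [|u v Hu Hv|k _]; first by left.
  by rewrite -[u]scale1r; apply: lspan_lin.
rewrite -[_ *: _]addr0; case: (Hy k) => _ H.
exact: (lspan_lin _ (H d) (LSpan0 _)).
Qed.

(** Brackets with an element of the Lie algebra are topologically nilpotent,
    while a subspace over the fraction field is closed: a combination of the
    [Y k] on which the action is invertible lies in that subspace. *)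
Lemma vfs_ad_nilpotent : ad_nilpotent fr_d S.
Proof.
move=> e Y m W _ L [z Hz <-] SY free stab rel cst.
pose y k := sval (cid2 (SY k)).
have Hy k : vfs 0 (y k) by rewrite /y; case: cid2.
have yE k : to_frac (y k) = row k Y by rewrite /y; case: cid2.
pose L0 : 'M[F]_e.+1 := \matrix_(k, i) sval (cid (fr_constantP F0 (cst k i))).
have LE : L = map_mx fr_const L0.
  by apply/matrixP => k i; rewrite !mxE; case: cid.
case: (stable_rowspace L0) => [[k Lk]|[y0 y00 [N0 Hy0]]].
  exists k; rewrite LE.
  have -> : map_mx fr_const L0 ^+ k = map_mx fr_const (L0 ^+ k).
    elim: (k) => [|j IHj]; last by rewrite !exprSr IHj -!mulmxE map_fr_constM.
    rewrite !expr0; apply/matrixP => i j; rewrite !mxE.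
    by case: eqP => _ /=; rewrite ?mulr1n ?fr_const1 ?mulr0n ?fr_const0.
  by rewrite Lk; apply/matrixP => i j; rewrite !mxE fr_const0.
exfalso; case/eqP: y00.
have combE c : to_frac (comb y c) = map_mx fr_const c *m Y.
  rewrite mulmx_sum_row; apply/rowP => i; rewrite mxE /comb rmorph_sum summxE.
  apply: eq_bigr => k _ /=; rewrite -yE !mxE -fr_constZ; by [].
have adW c : (vf_br (to_frac z) (to_frac (comb y c)) - to_frac (comb y (c *m L0)) <= W)%MS.
  rewrite !combE (vf_br_mulmx dD dM (@fr_dC F n)).
  have -> : \row_i vf_act (to_frac z) ((map_mx fr_const c) 0 i) = 0.
    by apply/rowP => i; rewrite !mxE act_const.
  rewrite mul0mx add0r.
  have -> : map_mx fr_const (c *m L0) *m Y =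
      \sum_k (map_mx fr_const c) 0 k *: (row k L *m Y).
    rewrite map_fr_constM -LE.
    rewrite -mulmxA mulmx_sum_row; apply: eq_bigr => k _; by rewrite row_mul.
  by rewrite -sumrB; apply: summx_sub => k _; rewrite -scalerBr scalemx_sub // rel.
have iterE j a : iter j (vf_br (to_frac z)) (to_frac a) = to_frac (iter j (ps_br z) a).
  by elim: j => [//|j IHj]; rewrite !iterS IHj to_frac_br.
have adWn j x : (to_frac (iter j (ps_br z) (comb y x)) - to_frac (comb y (x *m L0 ^+ j)) <= W)%MS.
  elim: j => [|j IHj]; first by rewrite expr0 mulmx1 subrr sub0mx.
  rewrite iterS -to_frac_br exprSr -mulmxE mulmxA.
  have := addmx_sub (stab _ IHj) (adW (x *m L0 ^+ j)).
  by rewrite (lie_brBr brA) subrKA.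
have [q0 q00 [Q QE]] := common_denominator (cokermx W).
have inW (a : 'I_n -> A) : (to_frac a <= W)%MS <-> forall j, \sum_i a i * Q i j = 0.
  have E : tofrac q0 *: (to_frac a *m cokermx W) = map_mx (@tofrac A) (\row_j \sum_i a i * Q i j).
    rewrite scalemxAr QE; apply/rowP => j; rewrite !mxE rmorph_sum; apply: eq_bigr => i _ /=.
    by rewrite !mxE tofracM.
  rewrite submxE; split=> [/eqP aW j|H].
    move/rowP/(_ j): E; rewrite aW scaler0 !mxE => /esym/eqP.
    by rewrite tofrac_eq0 => /eqP.
  have : tofrac q0 *: (to_frac a *m cokermx W) == 0.
    by rewrite E; apply/eqP/rowP => j; rewrite !mxE H tofrac0.
  by rewrite scaler_eq0 tofrac_eq0 (negPf q00).
(* [y0 = c' L0^M] for every large [M], so modulo [W] the combination [y0] of the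
   fields [y k] is an [M]-fold bracket with [z], which vanishes to high order *)
have y0W : (to_frac (comb y y0) <= W)%MS.
  apply/inW => j; apply: vanish_all => d; apply: (@vanish_leq _ _ d.+1); first exact: leqnSn.
  pose M := maxn N0 (N d); have /submxP[c' cE] := Hy0 M (leq_maxl _ _).
  have := adWn M c'; rewrite -cE; set b := iter M _ _.
  rewrite to_fracB => /inW/(_ j) H.
  have -> : \sum_i comb y y0 i * Q i j = \sum_i b i * Q i j.
    apply/esym/eqP; rewrite -subr_eq0 -sumrB -[X in _ == X]H; apply/eqP.
    by apply: eq_bigr => i _; rewrite mulrBl.
  have [b0 bd] : in_max_vf b /\ jet_mx d (ps_der b) = 0.
    have Hc := comb_vfs c' Hy; have [z0 Pz] := Hz.
    suff [b0 Pb] : in_max_vf b /\ P d M.+1 (jet_mx d (ps_der b)).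
      by split=> //; apply: (nf_big0 (NF d) _ Pb); apply: leqW; apply: leq_maxr.
    rewrite /b; elim: (M) => [|k [k0 Pk]] /=.
      by case: Hc => c0 Hc; split=> //; apply: logs_P.
    split; first exact: ps_br_max.
    rewrite jet_mx_ps_br // /comm_br; have PPz := logs_P (Pz d).
    apply: (nf_D (NF d)); first by rewrite -[k.+2]addn1; apply: (nf_M (NF d)).
    by apply: (nf_N (NF d)); rewrite -[k.+2]add1n; apply: (nf_M (NF d)).
  apply: vanish_sum => i _; rewrite -[d.+1]addn0; apply: vanishM => //.
  exact: jet_mx_der_vanish.
have := free (map_mx fr_const y0); rewrite -combE => /(_ y0W)/rowP E.
apply/rowP => i; apply/eqP; have /eqP := E i; rewrite !mxE tofrac_eq0 => /eqP H.
by have := congr1 (fun f : A => f 0%MM) H; rewrite /= ps_scaleE ps_1E eqxx mulr1 ps_0E => ->.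
Qed.

Let ser_scale k c u : lie_ser vf_br k S u -> lie_ser vf_br k S (fr_const c *: u).
Proof.
have brZ (v w : 'rV[K]_n) : fr_const c *: vf_br v w = vf_br v (fr_const c *: w).
  by rewrite (vf_brZr dM) act_const scale0r add0r.
elim: k u => [|k IHk] u.
  case=> a Ha <-; rewrite to_fracZ; exists (fun i => c *: a i + 0) => /=.
    by apply: vfs_lin => //; apply: vfs0.
  by congr to_frac; apply: funext => i; rewrite addr0.
have Z0 : fr_const c *: (0 : 'rV[K]_n) = 0 by apply/rowP => i; rewrite !mxE mulr0.
have ZD (v w : 'rV[K]_n) : fr_const c *: (v + w) = fr_const c *: v + fr_const c *: w.
  by apply/rowP => i; rewrite !mxE mulrDr.
elim=> [|v w s Hv Hw _ IH]; first by rewrite Z0; case: (lie_ser_ring brA k.+1 SL).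
rewrite ZD brZ; apply: (lie_ringD (lie_ser_ring brA k.+1 SL)) IH.
by apply: lie_der_br Hv (IHk _ Hw).
Qed.

Let mats k d : set 'M[F]_((njets n d).+1) :=
  [set jet_mx d (ps_der a) | a in [set a | in_max_vf a /\ lie_ser vf_br k S (to_frac a)]]%classic.

Let S_vfs a : S (to_frac a) -> vfs 0 a.
Proof. by case=> b Hb /to_frac_inj <-. Qed.

Let mats_lin k d c x y : @mats k d x -> @mats k d y -> @mats k d (c *: x + y).
Proof.
case=> a [a0 Ha] <- [b [b0 Hb] <-]; exists (fun i => c *: a i + b i).
  split; first by apply: in_max_vfD => //; apply: in_max_vfZ.
  rewrite -to_fracD -to_fracZ; apply: (lie_ringD (lie_ser_ring brA k SL)) => //.
  exact: ser_scale.
by rewrite jet_mx_der_lin.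
Qed.

Let mats0 k d : @mats k d 0.
Proof.
exists (fun _ => 0); last exact: jet_mx_der0.
by split=> //; rewrite to_frac0; case: (lie_ser_ring brA k SL).
Qed.

Let mats_br k d x y : @mats k d x -> @mats k d y -> @mats k.+1 d (comm_br x y).
Proof.
case=> a [a0 Ha] <- [b [b0 Hb] <-]; exists (ps_br b a); last by rewrite jet_mx_ps_br.
split; first exact: ps_br_max.
by rewrite -to_frac_br; apply: lie_der_br.
Qed.

Let mats_sub k d x : @mats k.+1 d x -> @mats k d x.
Proof.
case=> a [a0 Ha] <-; exists a => //; split=> //.
by apply: (lie_ser_leq brA (leqnSn k) SL).
Qed.

Let mats_ring k d : lie_ring (@comm_br _) (@mats k d).
Proof.
split=> [|x y Hx Hy|x y Hx Hy]; first exact: mats0.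
  by rewrite addrC -scaleN1r; apply: mats_lin.
by apply: mats_sub; apply: mats_br.
Qed.

Let mats_der k d x : lie_der (@comm_br _) (@mats k d) x -> @mats k.+1 d x.
Proof.
elim=> [|u v w Hu Hv _ Hw]; first exact: mats0.
by rewrite -[comm_br u v]scale1r; apply: mats_lin => //; apply: mats_br.
Qed.

Let mats_q k d j x : @mats k d x -> @mats k d (q d j * x).
Proof.
move=> Hx; rewrite /invS -mulmxE mul_scalar_mx -[_ *: x]addr0.
by apply: mats_lin => //; apply: mats0.
Qed.

Let mats_P k d x : @mats k d x -> P d 1%N x.
Proof.
case=> a [a0 Ha] <-; apply: logs_P; have [_] : vfs 0 a; last exact.
by apply: S_vfs; apply: (lie_ser_sub brA SL) Ha.
Qed.

(** Campbell-Hausdorff puts the group commutator of [psi] and [chi] at the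
    exponential of an element of the derived ring; the set of all [phi] with
    logarithm in the [k]-th term is a subgroup by the product formula. *)
Lemma log_derived k phi : derived k G phi -> forall d, @mats k d (log d phi).
Proof.
elim: k phi => [|k IHk] phi.
  move=> Gphi d; have [|a a0 aE] := log_vf F0 (phi := phi).
    by move=> d'; exists (P d'), (N d'); split; [exact: NF | apply: Prho].
  have Ea d' : jet_mx d' (ps_der a) = log d' phi by apply: aE; [exact: NF | apply: Prho].
  exists a; last exact: Ea.
  split=> //; exists a => //; split=> // d'.
  by rewrite Ea; apply: lspan_mem; exists phi.
have kG psi : derived k G psi -> G psi by apply: derived_sub.
have [G1 GM GV] := sG.
have rhoM d psi chi : rho d (psi * chi)%g = rho d psi * rho d chi := jet_mx_pullM d psi chi.
have rhoV d psi : G psi -> rho d (psi^-1)%g = ex (q d) (N d) (- log d psi).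
  exact: (log_inv (jet_mx_pullM d) (jet_mx_pull1 F n d) (NF d) (@Prho d)).
pose Q psi := G psi /\ forall d, @mats k.+1 d (log d psi).
suff H : derived k.+1 G phi -> Q phi by case/H.
apply: derived_subgroup_ind => [|psi chi Hpsi Hchi].
  split=> [|psi chi [Gpsi Hpsi] [Gchi Hchi]|psi [Gpsi Hpsi]].
  - by split=> // d; rewrite log1; apply: mats0.
  - split=> [|d]; first exact: GM.
    have [z [Hz _ zE]] := campbell_hausdorff (NF d) (mats_ring k.+1 d)
      (@mats_q k.+1 d) (@mats_P k.+1 d) (Hpsi d) (Hchi d).
    have -> : log d (psi * chi)%g = z; last by [].
    rewrite rhoM.
    rewrite -(ex_lg (NF d) (Prho d Gpsi)) -(ex_lg (NF d) (Prho d Gchi)) -zE.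
    by rewrite (lg_ex (NF d)) //; apply: mats_P Hz.
  split=> [|d]; first exact: GV.
  rewrite rhoV // (lg_ex (NF d)); last by apply: (nf_N (NF d)); apply: mats_P (Hpsi d).
  exact: (lie_ringN (mats_ring k.+1 d)).
have [Gpsi Gchi] := (kG _ Hpsi, kG _ Hchi).
split=> [|d].
  by rewrite commgE; exact: (GM _ _ (GV _ Gpsi) (GM _ _ (GV _ Gchi) (GM _ _ Gpsi Gchi))).
have [z Hz zE] := campbell_hausdorff_comm (NF d) (mats_ring k d)
  (@mats_q k d) (@mats_P k d) (IHk _ Hpsi d) (IHk _ Hchi d).
have -> : log d [~ psi, chi]%g = z; last exact: mats_der.
have {}zE : rho d [~ psi, chi]%g = ex (q d) (N d) z.
  rewrite zE commgE !rhoM !rhoV // !mulrA.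
  by rewrite (ex_lg (NF d) (Prho d Gpsi)) (ex_lg (NF d) (Prho d Gchi)).
rewrite zE (lg_ex (NF d)) //.
by apply: mats_P; apply: mats_der Hz.
Qed.

Lemma derived_trivial phi : (0 < n)%N -> derived (2 * n - 1) G phi -> phi = 1%g.
Proof.
move=> n0 Hphi; apply: jet_mx_pull_inj => d.
have Gphi : G phi by apply: derived_sub Hphi.
rewrite -[LHS](ex_lg (NF d) (Prho d Gphi)).
have [a [a0 Ha] <-] := log_derived Hphi d.
have := vf_solvable_length (fr_char0 n F0) dD dM (@fr_dC F n) n0 SL SS vfs_ad_nilpotent Ha.
rewrite -to_frac0 => /to_frac_inj ->.
by rewrite jet_mx_der0 (ex0 (NF d)).
Qed.

End UpperBound.

Theorem unipotent_solvable_length (F : fieldType) (n : nat) (G : set (fdiff F n)) :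
    [pchar F] =i pred0 -> (0 < n)%N ->
    is_subgroup G -> unipotent_set G -> is_solvable G ->
  exists2 l : nat, soluble_length G = Some l & (l <= 2 * n - 1)%N.
Proof.
move=> F0 n0 sG uG; rewrite /is_solvable; case El: (soluble_length G) => [l|//] _.
exists l => //; have [Gl lmin] := (soluble_lengthP G l).1 El.
apply: lmin; apply/seteqP; split=> phi; first exact: (derived_trivial F0 sG uG Gl n0).
by move=> ->; have [] := derived_group (2 * n - 1) sG.
Qed.

(** * Rational series and triangular diffeomorphisms *)

Section Units.
Variables (F : fieldType) (n : nat).
Local Notation A := (pser F n).
Implicit Types (f g : A) (phi psi : fdiff F n).

Lemma ps_coef0M f g : (f * g) 0%MM = f 0%MM * g 0%MM.
Proof.
by have := @lowest_mul_coef _ _ f g 0%MM 0%MM; rewrite addm0; apply=> k _; apply: le0m.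
Qed.

(** The geometric series, cut off at each degree. *)
Lemma ps_unit1B f : f 0%MM = 0 -> 1 - f \is a GRing.unit.
Proof.
move=> f0; have vf k : vanish k (f ^+ k).
  elim: k => [//|k IHk]; rewrite exprS -add1n; apply: vanishM IHk.
  exact: vanish1.
pose g : A := fun m => (\sum_(k < (mdeg m).+1) f ^+ k) m.
apply/unitrPr; exists g; apply/eqP; rewrite -subr_eq0; apply/eqP/vanish_all => e.
have ge : vanish e (g - \sum_(k < e) f ^+ k).
  move=> m me; rewrite ps_subE /g -(subnKC me) big_split_ord /= ps_addE.
  rewrite [X in _ - (_ + X)]ps_sumE [X in _ - (_ + X)]big1 ?addr0 ?subrr // => k _.
  by apply: (vf (_ + _)%N); rewrite addSn ltnS leq_addr.
have -> : (1 - f) * g - 1 = (1 - f) * (g - \sum_(k < e) f ^+ k) - f ^+ e.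
  have -> : f ^+ e = 1 + (f - 1) * \sum_(k < e) f ^+ k by rewrite -subrX1; ring.
  by ring.
apply: vanishD (vanishN (vf e)); rewrite -[e]add0n; exact: vanishM.
Qed.

Lemma ps_unitE f : (f \is a GRing.unit) = (f 0%MM != 0).
Proof.
apply/idP/idP => [/divrr/(congr1 (fun h : A => h 0%MM))|f0].
  rewrite ps_coef0M ps_1E eqxx => /eqP; apply: contraTneq => ->.
  by rewrite mul0r eq_sym oner_eq0.
have -> : f = (f 0%MM)%:A * (1 - (1 - (f 0%MM)^-1 *: f)).
  by rewrite subKr -scalerAr mulr_algl scalerA mulVf // scale1r.
rewrite unitrM; apply/andP; split; last first.
  by rewrite ps_unit1B // ps_subE ps_1E eqxx ps_scaleE mulVf // subrr.
apply/unitrPr; exists ((f 0%MM)^-1)%:A.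
by rewrite mulr_algl scalerA mulfV // scale1r.
Qed.

Lemma ps_unit_coef1 f : f 0%MM = 1 -> f \is a GRing.unit.
Proof. by move=> f1; rewrite ps_unitE f1 oner_neq0. Qed.

Lemma ps_coef0V f : f^-1 0%MM = (f 0%MM)^-1.
Proof.
have [uf|nuf] := boolP (f \is a GRing.unit); last first.
  by rewrite invr_out //; move: nuf; rewrite ps_unitE negbK => /eqP->; rewrite invr0.
apply: (@mulfI _ (f 0%MM)); first by rewrite -ps_unitE.
by rewrite -ps_coef0M divrr // mulfV -?ps_unitE // ps_1E eqxx.
Qed.

Lemma pull_coef0 phi f : pull phi f 0%MM = f 0%MM.
Proof. exact/fps_comp0/fdiff_max. Qed.

Lemma pullD phi f g : pull phi (f + g) = pull phi f + pull phi g.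
Proof. exact/jo_D/jo_pull. Qed.
Lemma pullB phi f g : pull phi (f - g) = pull phi f - pull phi g.
Proof. exact/jo_B/jo_pull. Qed.
Lemma pullZ phi c f : pull phi (c *: f) = c *: pull phi f.
Proof. exact/jo_Z/jo_pull. Qed.

Lemma pullN phi f : pull phi (- f) = - pull phi f.
Proof. by rewrite -scaleN1r pullZ scaleN1r. Qed.

Lemma pullV phi f : pull phi f^-1 = (pull phi f)^-1.
Proof.
have [uf|nuf] := boolP (f \is a GRing.unit); last first.
  by rewrite !invr_out // ps_unitE pull_coef0 -ps_unitE.
have uf' : pull phi f \is a GRing.unit by rewrite ps_unitE pull_coef0 -ps_unitE.
by apply: (mulrI uf'); rewrite -pullM !divrr // pull1.
Qed.

Lemma fdiff_mulE phi psi i : (phi * psi)%g i = pull psi (phi i) :> A.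
Proof. by []. Qed.

End Units.

Section Rational.
Variables (F : fieldType) (n : nat).
Local Notation A := (pser F n).
Local Notation ps_X := (@ps_X F n).
Implicit Types (f g a c : A) (phi psi : fdiff F n) (i j : 'I_n) (k : nat).

(** The expansions of the rational functions of [x_0, ..., x_(k-1)] that are
    regular at the origin.  The presentation by generators makes stability under
    substitution, and later convergence, provable by induction.  The inverse of a
    non-unit is that series itself, so the last rule adds nothing else. *)
Inductive rational k : A -> Prop :=
| rational_const (c : F) : rational k c%:A
| rational_X i : (i < k)%N -> rational k (ps_X i)
| rational_D f g : rational k f -> rational k g -> rational k (f + g)
| rational_M f g : rational k f -> rational k g -> rational k (f * g)
| rational_V f : rational k f -> rational k f^-1.

Lemma rational0 k : rational k 0.
Proof. by rewrite -(scale0r (1 : A)); apply: rational_const. Qed.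
Lemma rational1 k : rational k 1.
Proof. by rewrite -(scale1r (1 : A)); apply: rational_const. Qed.
Lemma rationalZ k (c : F) f : rational k f -> rational k (c *: f).
Proof. by move=> rf; rewrite -mulr_algl; apply: rational_M rf; apply: rational_const. Qed.
Lemma rationalN k f : rational k f -> rational k (- f).
Proof. by rewrite -scaleN1r; apply: rationalZ. Qed.
Lemma rationalB k f g : rational k f -> rational k g -> rational k (f - g).
Proof. by move=> rf rg; apply: rational_D => //; apply: rationalN. Qed.

Lemma rational_leq k l f : (k <= l)%N -> rational k f -> rational l f.
Proof.
move=> kl; elim=> [c|i ik|g h _ rg _ rh|g h _ rg _ rh|g _ rg].
- exact: rational_const.
- by apply: rational_X; apply: leq_trans kl.
- exact: rational_D.
- exact: rational_M.
exact: rational_V.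
Qed.

Lemma ps_dV0 j f : ps_d j f = 0 -> ps_d j f^-1 = 0.
Proof.
have [uf|/invr_out-> //] := boolP (f \is a GRing.unit); move=> f0.
have := ps_d1 F j; rewrite -(divrr uf) ps_dM f0 mul0r add0r => /eqP.
rewrite mulf_eq0 => /orP[/eqP f00|/eqP //].
by move: uf; rewrite f00 unitr0.
Qed.

Lemma ps_d_const j (c : F) : ps_d j (c%:A : A) = 0.
Proof. by rewrite ps_dZ ps_d1 scaler0. Qed.

Lemma ps_dB j f g : ps_d j (f - g) = ps_d j f - ps_d j g.
Proof. by rewrite -scaleN1r ps_dD ps_dZ scaleN1r. Qed.

Lemma ps_X_neq0 i : ps_X i != 0.
Proof.
apply/eqP => /(congr1 (ps_d i)); rewrite ps_d_X eqxx => /eqP.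
by rewrite -[X in ps_d i X](scale0r (1 : A)) ps_dZ scale0r oner_eq0.
Qed.

Lemma rational_d k f j : (k <= j)%N -> rational k f -> ps_d j f = 0.
Proof.
move=> kj; elim=> [c|i ik|g h _ rg _ rh|g h _ rg _ rh|g _ rg].
- exact: ps_d_const.
- by rewrite ps_d_X; case: eqP => // E; move: ik; rewrite -E ltnNge kj.
- by rewrite ps_dD rg rh addr0.
- by rewrite ps_dM rg rh mul0r mulr0 addr0.
exact: ps_dV0.
Qed.

Lemma rational_pull k l phi f : (forall j, (j < k)%N -> rational l (phi j)) ->
  rational k f -> rational l (pull phi f).
Proof.
move=> Hphi; elim=> [c|i ik|g h _ rg _ rh|g h _ rg _ rh|g _ rg].
- by rewrite pullZ pull1; apply: rational_const.
- by rewrite pull_X; apply: Hphi.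
- by rewrite pullD; apply: rational_D.
- by rewrite pullM; apply: rational_M.
by rewrite pullV; apply: rational_V.
Qed.

Lemma rational_pull_fix k phi f : (forall j, (j < k)%N -> phi j = ps_X j) ->
  rational k f -> pull phi f = f.
Proof.
move=> Hphi; elim=> [c|i ik|g h _ rg _ rh|g h _ rg _ rh|g _ rg].
- by rewrite pullZ pull1.
- by rewrite pull_X; apply: Hphi.
- by rewrite pullD rg rh.
- by rewrite pullM rg rh.
by rewrite pullV rg.
Qed.

(** Birational maps: each coordinate is acted upon by affine maps over the rational
    functions of the preceding ones, which accounts for two steps of the derived
    series; the first coordinate is acted upon by the parabolic maps
    [x / (1 - t x)], which account for one. *)
Definition triangular (phi : 'I_n -> fps F n) := forall i,
  if i == 0%N :> nat then exists t : F, (phi i : A) * (1 - t *: ps_X i) = ps_X i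
  else exists c a, [/\ rational i c, rational i a, c 0%MM = 1, a 0%MM = 0 &
                       (phi i : A) = c * ps_X i + a].

Lemma parabolic_unit (t : F) i : 1 - t *: ps_X i \is a GRing.unit.
Proof. by rewrite ps_unit1B // ps_scaleE /ps_X in_max_var mulr0. Qed.

Lemma triangular_rational (phi : 'I_n -> fps F n) i : triangular phi -> rational i.+1 (phi i).
Proof.
move=> /(_ i); case: ifP => [/eqP i0 [t E]|_ [c [a [rc ra _ _ ->]]]].
  have -> : (phi i : A) = ps_X i / (1 - t *: ps_X i).
    by apply: (mulIr (parabolic_unit t i)); rewrite E mulrVK // parabolic_unit.
  apply: rational_M; first by apply: rational_X.
  by apply/rational_V/rationalB/rationalZ/rational_X => //; apply: rational1.
by apply: rational_D (rational_leq _ ra) => //; apply: rational_M (rational_leq _ rc) _ => //; apply: rational_X.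
Qed.

Lemma triangular_max (phi : 'I_n -> fps F n) i : triangular phi -> phi i 0%MM = 0.
Proof.
move=> /(_ i); case: ifP => [_ [t /(congr1 (fun f : A => f 0%MM))]|_ [c [a [_ _ _ a0 ->]]]].
  by rewrite ps_coef0M ps_subE ps_1E eqxx ps_scaleE /ps_X in_max_var mulr0 subr0 mulr1.
by rewrite ps_addE ps_coef0M /ps_X in_max_var mulr0 a0 addr0.
Qed.

Lemma coef0_bool (b : bool) : (b%:R : A) 0%MM = b%:R.
Proof. by case: b => //; rewrite -[true%:R in LHS]/(1 : A) ps_1E eqxx. Qed.

Lemma coef1_ps_d f j : f U_(j)%MM = ps_d j f 0%MM.
Proof. by rewrite /ps_d add0m mnm0E mulr1n. Qed.

Lemma triangular_lin (phi : 'I_n -> fps F n) i j : triangular phi -> (i <= j)%N ->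
  phi i U_(j)%MM = (i == j)%:R.
Proof.
move=> tphi ij; have phi0 := triangular_max i tphi; have X0 : ps_X i 0%MM = 0 by apply: in_max_var.
rewrite (coef1_ps_d (phi i)).
have := tphi i; case: ifP => [_ [t /(congr1 (fun f => ps_d j f 0%MM))]|_ [c [a [rc ra c1 _ ->]]]].
  rewrite ps_dM ps_dB ps_d1 ps_dZ ps_d_X ps_addE !ps_coef0M phi0 mul0r addr0.
  rewrite ps_subE ps_scaleE X0 mulr0 subr0 ps_1E eqxx mulr1 => ->.
  by rewrite coef0_bool eq_sym.
rewrite ps_dD (rational_d ij ra) addr0 ps_dM (rational_d ij rc) mul0r add0r ps_d_X ps_coef0M c1 mul1r.
by rewrite coef0_bool eq_sym.
Qed.

Lemma triangular_unit (phi : 'I_n -> fps F n) : triangular phi -> lin_part phi \in unitmx.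
Proof.
move=> tphi; have trig : is_trig_mx (lin_part phi).
  by apply/is_trig_mxP => i j ij; rewrite mxE triangular_lin // 1?ltnW // -val_eqE (ltn_eqF ij).
rewrite unitmxE (det_trig trig) big1 ?unitr1 // => i _.
by rewrite mxE triangular_lin ?eqxx.
Qed.

Definition triangular_diff (phi : 'I_n -> fps F n) (tphi : triangular phi) : fdiff F n :=
  FDiff (fun i => triangular_max i tphi) (triangular_unit tphi).

Lemma triangular_unipotent phi : triangular phi -> unipotent phi.
Proof.
move=> tphi; exists n; have H k i j : (i < j + k)%N ->
    ((lin_part phi - 1%:M) ^+ k) i j = 0.
  elim: k i j => [|k IHk] i j ij.
    by rewrite expr0 mxE -val_eqE ltn_eqF // -[X in (_ < X)%N]addn0.
  rewrite exprS -mulmxE mxE big1 // => l _; have [li|il] := ltnP l i.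
    by rewrite IHk ?mulr0 //; move: ij; rewrite addnS ltnS; apply: leq_trans.
  by rewrite !mxE triangular_lin // subrr mul0r.
by apply/matrixP => i j; rewrite H ?mxE // ltn_addl.
Qed.

(** The parameter [t] of [x / (1 - t x)] is additive. *)
Lemma parabolic_mul phi psi i (t s : F) :
  (phi i : A) * (1 - t *: ps_X i) = ps_X i -> (psi i : A) * (1 - s *: ps_X i) = ps_X i ->
  ((phi * psi)%g i : A) * (1 - (t + s) *: ps_X i) = ps_X i.
Proof.
move=> phiE psiE; rewrite fdiff_mulE; have := congr1 (pull psi) phiE.
rewrite pullM pullB pull1 pullZ pull_X => E.
have -> : 1 - (t + s) *: ps_X i = (1 - s *: ps_X i) - t *: ps_X i by rewrite scalerDl; ring.
rewrite -[RHS]psiE -E -!mulrA; congr (_ * _).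
by rewrite mulrBl mul1r -scalerAl psiE.
Qed.

Lemma triangular_mul phi psi : triangular phi -> triangular psi -> triangular (phi * psi)%g.
Proof.
move=> tphi tpsi i; have := tphi i; have := tpsi i.
have rpsi k f : rational k f -> rational k (pull psi f).
  apply: rational_pull => j jk; apply: rational_leq jk _; exact: triangular_rational.
case: ifP => [_ [s psiE] [t phiE]|_ [c' [a' [rc' ra' c1' a0' psiE]]] [c [a [rc ra c1 a0 phiE]]]].
  by exists (t + s); apply: parabolic_mul phiE psiE.
exists (pull psi c * c'), (pull psi c * a' + pull psi a); split.
- by apply: rational_M rc'; apply: rpsi.
- by apply: rational_D; [apply: rational_M ra'|]; apply: rpsi.
- by rewrite ps_coef0M pull_coef0 c1 mul1r.
- by rewrite ps_addE ps_coef0M !pull_coef0 a0 a0' mulr0 addr0.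
by rewrite fdiff_mulE [in LHS]phiE pullD pullM pull_X psiE; ring.
Qed.

Lemma triangular1 : triangular (1%g : fdiff F n).
Proof.
move=> i; case: ifP => _; first by exists 0; rewrite scale0r subr0 mulr1.
exists 1, 0; rewrite mul1r addr0 ps_1E eqxx; split=> //; [exact: rational1 | exact: rational0].
Qed.

(** Requiring the inverse to be of the same form leaves only stability under
    composition to be proved. *)
Definition triangular_group : set (fdiff F n) :=
  [set phi : fdiff F n | triangular phi /\ triangular phi^-1%g]%classic.

Lemma triangular_group_subgroup : is_subgroup triangular_group.
Proof.
split=> [|phi psi [t1 t2] [s1 s2]|phi [t1 t2]].
- by split; rewrite ?invg1; apply: triangular1.
- by split; rewrite ?invMg; apply: triangular_mul.
by split; rewrite ?invgK.
Qed.

(** * Solvability of the triangular group *)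

Definition fixes k phi := forall j, (j < k)%N -> phi j = ps_X j.

Lemma pullK phi f : pull phi^-1%g (pull phi f) = f.
Proof. by rewrite -pull_comp mulgV pull_id. Qed.

Lemma fixes_inv k phi : fixes k phi -> fixes k phi^-1%g.
Proof. by move=> fphi j jk; rewrite -[RHS](pullK phi) pull_X fphi // pull_X. Qed.

Lemma fixes_mul k phi psi : fixes k phi -> fixes k psi -> fixes k (phi * psi)%g.
Proof. by move=> fphi fpsi j jk; rewrite fdiff_mulE fphi // pull_X fpsi. Qed.

Definition translates i phi :=
  fixes i phi /\ exists2 a, rational i a & (phi i : A) = ps_X i + a.

Lemma translates_subgroup i : is_subgroup [set phi : fdiff F n | translates i phi]%classic.
Proof.
split=> [|phi psi [fphi [a ra phiE]] [fpsi [b rb psiE]]|phi [fphi [a ra phiE]]].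
- by split=> //; exists 0; [apply: rational0 | rewrite addr0].
- split; first exact: fixes_mul.
  exists (b + a); first exact: rational_D.
  by rewrite fdiff_mulE phiE pullD pull_X psiE (rational_pull_fix fpsi ra) addrA.
split; first exact: fixes_inv.
exists (- a); first exact: rationalN.
rewrite -[in RHS](pullK phi (ps_X i)) pull_X phiE pullD pull_X.
by rewrite (rational_pull_fix (fixes_inv fphi) ra) addrK.
Qed.

Lemma fixed_subgroup i : is_subgroup [set phi : fdiff F n | phi i = ps_X i]%classic.
Proof.
split=> [//|phi psi /= phiE psiE|phi /= phiE]; first by rewrite -[LHS]/(pull psi (phi i)) phiE pull_X.
by rewrite -[RHS](pullK phi) pull_X phiE pull_X.
Qed.

(** Parameters add up, so the first coordinate of [x y] is that of [y x]. *)
Lemma fixed_commutator_parabolic i (x y : fdiff F n) : i = 0%N :> nat ->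
  triangular_group x -> triangular_group y -> ([~ x, y]%g) i = ps_X i.
Proof.
move=> i0 Gx Gy; have [_ GM GV] := triangular_group_subgroup.
have par z : triangular_group z -> exists t : F, (z i : A) * (1 - t *: ps_X i) = ps_X i.
  by case=> /(_ i); rewrite i0 eqxx.
have [[t xt] [s ys]] := (par _ Gx, par _ Gy).
have [|r zr] := par [~ x, y]%g.
  by rewrite commgE; exact: (GM _ _ (GV _ Gx) (GM _ _ (GV _ Gy) (GM _ _ Gx Gy))).
have := parabolic_mul xt ys; rewrite mulg_swap.
rewrite -{2}(parabolic_mul (parabolic_mul ys xt) zr) => /mulfI H.
have X0 := ps_X_neq0 i.
suff r0 : r = 0 by move: zr; rewrite r0 scale0r subr0 mulr1.
have /H/eqP : (y * x * [~ x, y])%g i != 0 :> A.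
  apply: contraNneq X0 => zi0; rewrite -(parabolic_mul (parabolic_mul ys xt) zr).
  by rewrite zi0 mul0r.
rewrite (inj_eq (addrI 1)) (inj_eq oppr_inj) -subr_eq0 -scalerBl.
by rewrite scaler_eq0 (negPf X0) orbF [s + t]addrC opprD addrA subrr sub0r oppr_eq0 => /eqP.
Qed.

Lemma fixes_comm k phi psi : fixes k phi -> fixes k psi -> fixes k [~ phi, psi]%g.
Proof.
move=> fphi fpsi; rewrite commgE.
exact: (fixes_mul (fixes_inv fphi) (fixes_mul (fixes_inv fpsi) (fixes_mul fphi fpsi))).
Qed.

Lemma affine_mul i phi psi c a c' a' : rational i c -> rational i a -> fixes i psi ->
    (phi i : A) = c * ps_X i + a -> (psi i : A) = c' * ps_X i + a' ->
  ((phi * psi)%g i : A) = c * c' * ps_X i + (c * a' + a).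
Proof.
move=> rc ra fpsi phiE psiE; rewrite fdiff_mulE phiE pullD pullM pull_X psiE.
by rewrite (rational_pull_fix fpsi rc) (rational_pull_fix fpsi ra); ring.
Qed.

Lemma affine_coef i c a : rational i c -> rational i a -> ps_d i (c * ps_X i + a) = c.
Proof.
move=> rc ra; rewrite ps_dD ps_dM (rational_d (leqnn i) rc) (rational_d (leqnn i) ra).
by rewrite ps_d_X eqxx mul0r add0r addr0 mulr1.
Qed.

(** The coefficient of [x_i] is multiplicative on the maps that fix the previous
    coordinates. *)
Lemma translates_commutator i (x y : fdiff F n) : i != 0%N :> nat ->
  triangular_group x -> triangular_group y -> fixes i x -> fixes i y ->
  translates i [~ x, y]%g.
Proof.
move=> i0 Gx Gy fx fy; have [_ GM GV] := triangular_group_subgroup.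
have aff z : triangular_group z -> exists c a,
    [/\ rational i c, rational i a, c 0%MM = 1 & (z i : A) = c * ps_X i + a].
  by case=> /(_ i); rewrite (negPf i0) => -[c [a [rc ra c1 _ zE]]] _; exists c, a.
have [[c [a [rc ra c1 xE]]] [c' [a' [rc' ra' c1' yE]]]] := (aff _ Gx, aff _ Gy).
have [|c2 [a2 [rc2 ra2 _ zE]]] := aff [~ x, y]%g.
  by rewrite commgE; exact: (GM _ _ (GV _ Gx) (GM _ _ (GV _ Gy) (GM _ _ Gx Gy))).
split; first exact: fixes_comm.
exists a2 => //; rewrite zE; suff -> : c2 = 1 by rewrite mul1r.
have := affine_mul rc ra fy xE yE; rewrite mulg_swap.
have rcc : rational i (c' * c) by apply: rational_M.
have raa : rational i (c' * a + a') by apply: rational_D ra'; apply: rational_M.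
rewrite (affine_mul rcc raa (fixes_comm fx fy) (affine_mul rc' ra' fx yE xE) zE).
move/(congr1 (ps_d i)); rewrite !affine_coef //; last 4 first.
- exact: rational_M.
- by apply: rational_D ra; apply: rational_M.
- exact: rational_M.
- by apply: rational_D raa; apply: rational_M.
rewrite [c * c']mulrC -[RHS]mulr1; apply: mulfI.
apply/eqP => /(congr1 (fun f : A => f 0%MM)) /eqP.
by rewrite ps_coef0M c1 c1' mulr1 oner_eq0.
Qed.

Lemma fixed_commutator i (x y : fdiff F n) :
  translates i x -> translates i y -> [~ x, y]%g i = ps_X i.
Proof.
move=> Tx Ty; have [_ TM TV] := translates_subgroup i.
have [fx [a ra xE]] := Tx; have [fy [a' ra' yE]] := Ty.
have [_ [a2 _ zE]] : translates i [~ x, y]%g.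
  by rewrite commgE; exact: (TM _ _ (TV _ Tx) (TM _ _ (TV _ Ty) (TM _ _ Tx Ty))).
have fz := fixes_comm fx fy; rewrite zE.
have := congr1 (fun w : fdiff F n => w i : A) (mulg_swap x y).
rewrite !fdiff_mulE xE yE !pullD !pull_X xE yE.
rewrite (rational_pull_fix fy ra) (rational_pull_fix fx ra') pullD pull_X.
rewrite zE (rational_pull_fix fz ra) (rational_pull_fix fz ra') => E.
have -> : a2 = ps_X i + a2 + a + a' - (ps_X i + a' + a) by ring.
by rewrite -E subrr addr0.
Qed.

Lemma derived_fixes k phi : derived (2 * k) triangular_group phi -> fixes k phi.
Proof.
have sG := triangular_group_subgroup; elim: k phi => [//|k IHk] phi.
set H := derived (2 * k) triangular_group in IHk.
have sH : is_subgroup H := derived_group (2 * k) sG.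
have dH x : derived_subgroup H x -> H x by apply: derived_subgroup_sub.
have HG x : H x -> triangular_group x by apply: derived_sub.
rewrite mulnS -[derived _ _]/(derived_subgroup (derived_subgroup H)) => Hphi j.
rewrite ltnS leq_eqVlt => /predU1P[jk|]; last first.
  exact: (IHk _ (dH _ (derived_subgroup_sub (derived_subgroup_group H) Hphi))).
have [j0|j0] := eqVneq (j : nat) 0%N.
  apply: (derived_subgroup_ind (fixed_subgroup j) _ Hphi) => x y Hx Hy.
  by apply: fixed_commutator_parabolic => //; apply/HG/dH.
apply: (derived_subgroup_ind (fixed_subgroup j) _ Hphi) => x y Hx Hy.
have T : forall z, derived_subgroup H z -> translates j z.
  apply: (derived_subgroup_ind (translates_subgroup j)) => u v Hu Hv.
  by apply: translates_commutator => //; [exact: HG | exact: HG | rewrite jk; exact: IHk..].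
by apply: fixed_commutator; apply: T.
Qed.

Lemma triangular_group_solvable : is_solvable triangular_group.
Proof.
rewrite /is_solvable /soluble_length; case: pselect => // -[].
exists (2 * n)%N; apply/asboolP/seteqP; split=> phi.
  by move=> /derived_fixes fphi; apply: fdiffP => i; apply: fphi.
by move=> ->; have [] := derived_group (2 * n) triangular_group_subgroup.
Qed.

End Rational.

(** * Derived length of the triangular group *)

Section LowerBound.
Variables (F : fieldType) (n : nat).
Local Notation A := (pser F n).
Local Notation ps_X := (@ps_X F n).
Local Notation triangular_group := (@triangular_group F n).
Implicit Types (f g a b c h : A) (phi psi T : fdiff F n) (i j : 'I_n) (k : nat).

Definition affine i c a phi := [/\ rational i c, rational i a, c 0%MM = 1,
  (phi i : A) = c * ps_X i + a & forall j, j != i -> phi j = ps_X j].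

Lemma affine_fixes i c a phi : affine i c a phi -> fixes i phi.
Proof. by case=> _ _ _ _ H j ji; apply: H; rewrite -val_eqE (ltn_eqF ji). Qed.

Lemma affine_eq i c a c' a' phi : affine i c a phi -> c = c' -> a = a' -> affine i c' a' phi.
Proof. by move=> H <- <-. Qed.

Lemma affine_inv i c a phi : affine i c a phi -> affine i c^-1 (- (c^-1 * a)) phi^-1%g.
Proof.
move=> Hphi; have [rc ra c1 phiE H] := Hphi; have fphi := fixes_inv (affine_fixes Hphi).
split=> [|||| j ji].
- exact: rational_V.
- by apply/rationalN/rational_M => //; apply: rational_V.
- by rewrite ps_coef0V c1 invr1.
- have := pullK phi (ps_X i); rewrite pull_X phiE pullD pullM pull_X.
  rewrite (rational_pull_fix fphi rc) (rational_pull_fix fphi ra) => E.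
  apply: (mulrI (ps_unit_coef1 c1)); rewrite mulrDr mulrN !mulVKr ?ps_unit_coef1 //.
  by rewrite -E addrK.
by rewrite -[RHS](pullK phi) pull_X H // pull_X.
Qed.

Lemma affine_comp i c a phi c' a' psi : affine i c a phi -> affine i c' a' psi ->
  affine i (c * c') (c * a' + a) (phi * psi)%g.
Proof.
move=> Hphi Hpsi; have [rc ra c1 phiE H] := Hphi; have [rc' ra' c1' psiE H'] := Hpsi.
split=> [|||| j ji].
- exact: rational_M.
- by apply: rational_D ra; apply: rational_M.
- by rewrite ps_coef0M c1 c1' mulr1.
- exact: (affine_mul rc ra (affine_fixes Hpsi) phiE psiE).
by rewrite fdiff_mulE H // pull_X H'.
Qed.

Lemma affine_group i c a phi : i != 0%N :> nat -> affine i c a phi -> triangular_group phi.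
Proof.
have tri c' a' psi : i != 0%N :> nat -> affine i c' a' psi -> triangular psi.
  move=> i0 [rc ra c1 psiE H] j; have [->|ji] := eqVneq j i.
    rewrite (negPf i0); exists c', a'; split=> //.
    by have := fdiff_max psi i; rewrite (psiE) ps_addE ps_coef0M /ps_X in_max_var mulr0 add0r.
  by rewrite H //; apply: triangular1.
by move=> i0 Hphi; split; [apply: tri Hphi | apply: tri (affine_inv Hphi)].
Qed.

Lemma affine_exists i c a : i != 0%N :> nat -> rational i c -> rational i a ->
  c 0%MM = 1 -> a 0%MM = 0 -> exists phi, affine i c a phi.
Proof.
move=> i0 rc ra c1 a0; pose phi j : fps F n := if j == i then c * ps_X i + a else ps_X j.
have tphi : triangular phi.
  move=> j; rewrite /phi; have [->|ji] := eqVneq j i; last exact: triangular1.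
  by rewrite (negPf i0); exists c, a; split.
exists (triangular_diff tphi); split=> //=; rewrite /phi ?eqxx // => j /negPf->//.
Qed.

(** [T] acts on the ring generated by the coordinates before [x_i] only, and so
    normalizes the affine maps in [x_i] over that ring. *)
Lemma affine_commutator i c a phi T : i != 0%N :> nat ->
    (forall j, (j < i)%N -> rational i (T j)) ->
    (forall j, (i <= j)%N -> T j = ps_X j) ->
    affine i c a phi ->
  affine i (c^-1 * pull T c) (c^-1 * (pull T a - a)) [~ phi, T]%g.
Proof.
move=> i0 Tlow Thigh Hphi; have [rc ra c1 phiE H] := Hphi.
have a0 : a 0%MM = 0.
  by have := fdiff_max phi i; rewrite phiE ps_addE ps_coef0M /ps_X in_max_var mulr0 add0r.
have [||||phi' Hphi'] := @affine_exists i (pull T c) (pull T a) i0.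
- exact: rational_pull Tlow rc.
- exact: rational_pull Tlow ra.
- by rewrite pull_coef0.
- by rewrite pull_coef0.
have swap : (phi * T = T * phi')%g.
  have [_ _ _ phiE' H'] := Hphi'; apply: fdiffP => j; rewrite !fdiff_mulE.
  have [ij|ji] := leqP i j.
    rewrite [in RHS]Thigh // pull_X; have [->|ji] := eqVneq j i.
      by rewrite phiE phiE' pullD pullM pull_X Thigh.
    by rewrite H // H' // pull_X Thigh.
  rewrite H -?val_eqE ?(ltn_eqF ji) // pull_X.
  by rewrite (rational_pull_fix (affine_fixes Hphi')) //; apply: Tlow.
rewrite commgE swap mulKg.
by apply: affine_eq (affine_comp (affine_inv Hphi) Hphi') _ _ => //; ring.
Qed.

Lemma affine_scale_translate_commutator i c a phi psi :
  affine i c 0 phi -> affine i 1 a psi -> affine i 1 ((1 - c^-1) * a) [~ phi, psi]%g.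
Proof.
move=> Hphi Hpsi; have uc : c \is a GRing.unit by case: Hphi => _ _ /ps_unit_coef1.
rewrite commgE.
apply: (affine_eq (affine_comp (affine_inv Hphi) (affine_comp (affine_inv Hpsi) (affine_comp Hphi Hpsi)))).
  by rewrite invr1 mul1r mulr1 mulVr.
by rewrite invr1 !mul1r mulr0 oppr0 !addr0 mulrDr mulKr // mulrN mulrBl mul1r.
Qed.

Lemma derived_leq (G : set (fdiff F n)) k l phi : is_subgroup G -> (k <= l)%N ->
  derived l G phi -> derived k G phi.
Proof.
move=> sG; elim: l => [|l IHl]; first by rewrite leqn0 => /eqP->.
rewrite leq_eqVlt => /predU1P[->//|kl] Hphi; apply: IHl => //.
exact: (derived_subgroup_sub (derived_group l sG)).
Qed.

Definition delta T f : A := pull T f - f.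
Definition quotient_by T f : A := f^-1 * pull T f.

(** [m + 1] commutators with [T] bring the scaling by [c] and the translation by
    [a] down the derived series together with [T], and one more step is the
    commutator of the two. *)
Lemma climb i m c a T : i != 0%N :> nat ->
    (forall j, (j < i)%N -> rational i (T j)) ->
    (forall j, (i <= j)%N -> T j = ps_X j) -> derived m triangular_group T ->
    rational i c -> rational i a -> c 0%MM = 1 -> a 0%MM = 0 ->
    iter m.+1 (quotient_by T) c != 1 -> iter m.+1 (delta T) a != 0 ->
  exists2 b, b != 0 & exists2 phi, affine i 1 b phi & derived m.+2 triangular_group phi.
Proof.
move=> i0 Tlow Thigh HT rc ra c1 a0 cN1 aN0.
have sG := triangular_group_subgroup F n.
have one0 : (1 : A) 0%MM = 1 by rewrite ps_1E eqxx.
have [phi0 Hphi0] := affine_exists i0 rc (rational0 F n i) c1 (erefl _).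
have [psi0 Hpsi0] := affine_exists i0 (rational1 F n i) ra one0 a0.
have HTk k : (k <= m)%N -> derived k triangular_group T.
  by move=> km; apply: derived_leq HT.
have scale k : (k <= m.+1)%N -> exists2 phi,
    affine i (iter k (quotient_by T) c) 0 phi & derived k triangular_group phi.
  elim: k => [_|k IHk km]; first by exists phi0 => //; apply: affine_group Hphi0.
  have [phi Hphi dphi] := IHk (ltnW km).
  exists [~ phi, T]%g; last by apply: derived_subgroup_comm => //; apply: HTk.
  apply: affine_eq (affine_commutator i0 Tlow Thigh Hphi) _ _ => //.
  by rewrite jo_0 ?subr0 ?mulr0 //; apply: jo_pull.
have translate k : (k <= m.+1)%N -> exists2 psi,
    affine i 1 (iter k (delta T) a) psi & derived k triangular_group psi.
  elim: k => [_|k IHk km]; first by exists psi0 => //; apply: affine_group Hpsi0.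
  have [psi Hpsi dpsi] := IHk (ltnW km).
  exists [~ psi, T]%g; last by apply: derived_subgroup_comm => //; apply: HTk.
  apply: affine_eq (affine_commutator i0 Tlow Thigh Hpsi) _ _ => /=.
    by rewrite pull1 invr1 mulr1.
  by rewrite invr1 mul1r.
have [[phi Hphi dphi] [psi Hpsi dpsi]] := (scale _ (leqnn _), translate _ (leqnn _)).
exists ((1 - (iter m.+1 (quotient_by T) c)^-1) * iter m.+1 (delta T) a).
  rewrite mulf_neq0 // subr_eq0 eq_sym; apply: contraNneq cN1 => E.
  by rewrite -[iter _ _ _]invrK E invr1.
exists [~ phi, psi]%g; first exact: affine_scale_translate_commutator.
exact: derived_subgroup_comm.
Qed.

Lemma coef0_1BX i : (1 - ps_X i) 0%MM = 1.
Proof. by rewrite ps_subE ps_1E eqxx /ps_X in_max_var subr0. Qed.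

Lemma rational_1BX i : rational i.+1 (1 - ps_X i).
Proof. by apply: rationalB (rational1 _ _ _) _; apply: rational_X. Qed.

Lemma parabolic_exists i0 : i0 = 0%N :> nat ->
  exists2 T, triangular_group T &
    (T i0 : A) * (1 - ps_X i0) = ps_X i0 /\ forall j, j != i0 -> T j = ps_X j.
Proof.
move=> i00.
have P t : exists2 T : fdiff F n, triangular T & (T i0 : A) * (1 - t *: ps_X i0) = ps_X i0 /\
   forall j, j != i0 -> T j = ps_X j.
  pose T j : fps F n := if j == i0 then ps_X i0 / (1 - t *: ps_X i0) else ps_X j.
  have E : (T i0 : A) * (1 - t *: ps_X i0) = ps_X i0.
    by rewrite /T eqxx mulrVK // parabolic_unit.
  have tT : triangular T.
    move=> j; have [->|ji] := eqVneq j i0; first by rewrite i00 eqxx; exists t.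
    by rewrite /T (negPf ji); apply: triangular1.
  by exists (triangular_diff tT) => //; split=> // j /negPf ji; rewrite /= /T ji.
have [T tT [TE TX]] := P 1; have [S tS [SE SX]] := P (-1).
exists T; last by split=> //; rewrite -[X in 1 - X]scale1r.
split=> //; suff -> : T^-1%g = S by [].
have TS : (T * S = 1)%g.
  apply: fdiffP => j; have [->|ji] := eqVneq j i0.
    by have := parabolic_mul TE SE; rewrite subrr scale0r subr0 mulr1.
  by rewrite fdiff_mulE TX // pull_X SX.
by rewrite -[S](mulKg T) TS mulg1.
Qed.

Lemma parabolic_moves T i0 : (T i0 : A) * (1 - ps_X i0) = ps_X i0 -> (T i0 : A) - ps_X i0 != 0.
Proof.
move=> TE; rewrite subr_eq0; apply: contraTneq (ps_X_neq0 F i0) => E.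
move: TE; rewrite E mulrBr mulr1 => /eqP; rewrite -subr_eq0 addrAC subrr sub0r oppr_eq0.
by rewrite mulf_eq0 orbb negbK.
Qed.

(** At the bottom of the ladder [T] is [x_0 / (1 - x_0)].  It is only known to lie
    in the group itself, so a single commutator with it is available. *)
Lemma climb_parabolic i0 i : i0 = 0%N :> nat -> i = 1%N :> nat ->
  exists2 b, b != 0 & exists2 phi, affine i 1 b phi & derived 2 triangular_group phi.
Proof.
move=> i00 i1; pose y := 1 - ps_X i0.
have uy : y \is a GRing.unit by apply/ps_unit_coef1/coef0_1BX.
have [T GT [TE TX]] := parabolic_exists i00.
have Ti0 := parabolic_moves TE.
have i0S : i0.+1 = i by rewrite i00 i1.
apply: (@climb i 0 y (ps_X i0) T) => //=.
- by rewrite i1.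
- move=> j; rewrite i1 ltnS leqn0 => /eqP j0; apply: (@rational_leq _ _ j.+1); first by rewrite j0.
  by apply: triangular_rational; case: GT.
- by move=> j; rewrite i1 => j0; apply: TX; rewrite -val_eqE /= i00 -lt0n.
- by rewrite -i0S; apply: rational_1BX.
- by rewrite -i0S; apply: rational_X.
- exact: coef0_1BX.
- exact: in_max_var.
- rewrite /quotient_by pullB pull1 pull_X; apply: contra Ti0 => /eqP E.
  have : y * (y^-1 * (1 - (T i0 : A))) = y by rewrite E mulr1.
  by rewrite mulVKr // /y => /addrI/oppr_inj ->; rewrite subrr.
by rewrite /delta pull_X.
Qed.

Hypothesis F0 : [pchar F] =i pred0.

Section Iterates.
Variables (i : 'I_n) (b : A) (T : fdiff F n).
Hypotheses (b0 : b != 0) (HT : affine i 1 b T).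
Let y := 1 - ps_X i.

Let Ti : (T i : A) = ps_X i + b.
Proof. by case: HT => _ _ _ ->; rewrite mul1r. Qed.
Let rb : rational i b. Proof. by case: HT. Qed.
Let Tb : pull T b = b.
Proof. exact: rational_pull_fix (affine_fixes HT) rb. Qed.
Let uy : y \is a GRing.unit. Proof. exact/ps_unit_coef1/coef0_1BX. Qed.
Let Ty : pull T y = y - b.
Proof. by rewrite pullB pull1 pull_X Ti /y; ring. Qed.

(** The poles of the iterated differences of [1 / y] move along the orbit of
    the translation, so that they never cancel. *)
Lemma delta_recursion k :
  (y - b *+ k.+1) * iter k.+1 (delta T) y^-1 = b *+ k.+1 * iter k (delta T) y^-1.
Proof.
elim: k => [|k IHk] /=.
  have uTy : pull T y \is a GRing.unit by rewrite ps_unitE pull_coef0 -ps_unitE.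
  rewrite /delta pullV mulr1n -Ty mulrBr mulrV //.
  by apply: (mulIr uy); rewrite mulrBl mul1r !mulrVK // Ty; ring.
move: IHk => /=; set g := delta T _; set h := iter k _ _ => IHk.
have := congr1 (pull T) IHk; rewrite !pullM pullB Ty.
have TnM l : pull T (b *+ l) = b *+ l by rewrite -scaler_nat pullZ Tb.
rewrite !TnM => E; rewrite /delta -/(delta T h) -/g !mulrSr mulrBr.
have -> : y - (b *+ k + b + b) = y - b - (b *+ k + b) by ring.
rewrite -mulrSr {}E; have gE : g = pull T h - h by [].
have -> : (y - b - b *+ k.+1) * g = (y - b *+ k.+1) * g - b * g by ring.
by rewrite IHk gE; ring.
Qed.

Lemma iter_delta_neq0 k : iter k (delta T) y^-1 != 0.
Proof.
elim: k => [|k IHk]; first by rewrite /= invr_eq0; apply: contraTneq uy => ->; rewrite unitr0.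
have bk : b *+ k.+1 != 0.
  by rewrite -scaler_nat scaler_eq0 negb_or b0 ((pcharf0P F).1 F0).
have := mulf_neq0 bk IHk; rewrite -delta_recursion; apply: contraNneq => ->.
by rewrite mulr0.
Qed.

Lemma ps_dV j f : f \is a GRing.unit -> ps_d j f^-1 = - (ps_d j f * f^-1 * f^-1).
Proof.
move=> uf; apply: (mulrI uf); have := ps_d1 F j; rewrite -(divrr uf) ps_dM => /eqP.
by rewrite addrC addr_eq0 => /eqP->; rewrite mulrN [in RHS]mulrC mulrVK.
Qed.

(** The chain rule, for a map that changes [x_i] by a quantity free of [x_i] and
    nothing else. *)
Lemma pull_derivative f : rational n f -> ps_d i (pull T f) = pull T (ps_d i f).
Proof.
have pull0 : pull T 0 = 0 by apply/jo_0/jo_pull.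
elim=> [c|j _|g h _ rg _ rh|g h _ rg _ rh|g _ rg].
- by rewrite pullZ pull1 ps_d_const pull0.
- have [->|ji] := eqVneq j i.
    by rewrite pull_X Ti ps_dD (rational_d (leqnn i) rb) addr0 ps_d_X eqxx pull1.
  by case: HT => _ _ _ _ /(_ j ji); rewrite pull_X => ->; rewrite ps_d_X eq_sym (negPf ji) pull0.
- by rewrite pullD !ps_dD rg rh pullD.
- by rewrite pullM !ps_dM rg rh pullD !pullM.
have [ug|ng] := boolP (g \is a GRing.unit); last by rewrite invr_out.
have uTg : pull T g \is a GRing.unit by rewrite ps_unitE pull_coef0 -ps_unitE.
by rewrite pullV !ps_dV // rg -scaleN1r -[in RHS]scaleN1r pullZ !pullM !pullV.
Qed.

(** The logarithmic derivative turns the multiplicative difference operator into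
    the additive one. *)
Lemma quotient_log_derivative k (c := iter k (quotient_by T) y) :
  [/\ rational n c, c \is a GRing.unit & ps_d i c = - iter k (delta T) y^-1 * c].
Proof.
rewrite {}/c; elim: k => [|k] /=.
  split=> //; first by apply: rational_leq (rational_1BX i).
  by rewrite mulNr mulVr // /y ps_dB ps_d1 ps_d_X eqxx sub0r.
set c := iter k _ y; set w := iter k _ _ => -[rc uc dc].
have uTc : pull T c \is a GRing.unit by rewrite ps_unitE pull_coef0 -ps_unitE.
split=> [||].
- apply: rational_M (rational_V rc) _; apply: rational_pull rc => j jn.
  have [->|ji] := eqVneq j i; last first.
    by case: HT => _ _ _ _ /(_ j ji) ->; apply: rational_X.
  rewrite Ti; apply: rational_D (rational_X _ _) (rational_leq _ rb) => //; exact: ltnW.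
- by rewrite unitrM unitrV uc.
by rewrite /quotient_by ps_dM ps_dV // dc mulrK // pull_derivative // dc pullM pullN /delta; ring.
Qed.

Lemma quotient_neq1 k : iter k (quotient_by T) y != 1.
Proof.
have [_ _ dc] := quotient_log_derivative k; apply: contra_neq (iter_delta_neq0 k) => c1.
by apply: oppr_inj; rewrite oppr0; move: dc; rewrite c1 ps_d1 mulr1.
Qed.

End Iterates.

(** Scalings start from [y = 1 - x_i], translations from [1 / y - 1], which
    vanishes at the origin. *)
Lemma climb_translation i i' b T : i' = i.+1 :> nat -> b != 0 -> affine i 1 b T ->
  derived (2 * i) triangular_group T ->
  exists2 b', b' != 0 & exists2 phi, affine i' 1 b' phi & derived (2 * i') triangular_group phi.
Proof.
move=> i'E b0 HT dT; have [_ rb _ TE TX] := HT; pose y := 1 - ps_X i.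
have uy : y \is a GRing.unit by apply/ps_unit_coef1/coef0_1BX.
rewrite [in (2 * i')%N]i'E mulnS; apply: (@climb i' (2 * i) y (y^-1 - 1) T); rewrite ?i'E //.
- move=> j; rewrite ltnS => ji; have [E|ji'] := eqVneq j i.
    rewrite E TE mul1r; apply: rational_D (rational_X _ _) (rational_leq _ rb) => //; exact: leqnSn.
  by rewrite TX //; apply: rational_X.
- by move=> j ij; apply: TX; rewrite -val_eqE gtn_eqF.
- exact: rational_1BX.
- by apply/rationalB/rational1/rational_V/rational_1BX.
- exact: coef0_1BX.
- by rewrite /y ps_subE ps_coef0V coef0_1BX invr1 ps_1E eqxx subrr.
- exact: (quotient_neq1 b0 HT).
rewrite iterSr; have -> : delta T (y^-1 - 1) = delta T y^-1.
  by rewrite /delta pullB pull1; ring.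
by rewrite -iterSr; apply: (iter_delta_neq0 b0 HT).
Qed.

Lemma derived_translation i : i != 0%N :> nat ->
  exists2 b, b != 0 & exists2 phi, affine i 1 b phi & derived (2 * i) triangular_group phi.
Proof.
case: i => i; elim: i => [//|[|i] IHi] ilt _.
  exact: (@climb_parabolic (Ordinal (ltn_trans (ltn0Sn 0) ilt))).
have [b b0 [T HT dT]] := IHi (ltnW ilt) isT.
exact: climb_translation HT dT.
Qed.

Lemma derived_nontrivial : (0 < n)%N ->
  exists2 phi, phi != 1%g & derived (2 * n - 2) triangular_group phi.
Proof.
move=> n0; have nP : (n.-1 < n)%N by rewrite prednK.
(* for [n = 1] the group is abelian and the element is [x_0 / (1 - x_0)] *)
have -> : (2 * n - 2 = 2 * n.-1)%N by rewrite -{1}(prednK n0) mulnS addKn.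
have [n1|n1] := eqVneq n.-1 0%N.
  have [T GT [TE _]] := @parabolic_exists (Ordinal nP) n1.
  exists T; last by rewrite n1.
  by apply: contraNneq (parabolic_moves TE) => ->; rewrite subrr.
have [b b0 [phi [_ _ _ phiE _] dphi]] := @derived_translation (Ordinal nP) n1.
exists phi => //; apply: contraNneq b0 => phi1.
by move: phiE; rewrite phi1 mul1r => /eqP; rewrite eq_sym -subr_eq0 addrAC subrr add0r.
Qed.

End LowerBound.

(** * Convergence of rational series *)

Section JetNorm.
Variables (R : realFieldType) (F : fieldType) (n : nat) (nu : F -> R).
Hypotheses (nu0 : nu 0 = 0) (nu1 : nu 1 = 1) (nu_ge0 : forall x, 0 <= nu x).
Hypotheses (nuM : forall x y, nu (x * y) = nu x * nu y).
Hypotheses (nuD : forall x y, nu (x + y) <= nu x + nu y).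
Local Notation A := (pser F n).
Implicit Types (f g : A) (r : R) (d : nat).

(** The value at the radius [r] of the majorant of the [d]-jet of [f], for an
    absolute value [nu] on the field of coefficients. *)
Definition jet_norm d r f := \sum_(m : 'X_{1..n < d.+1}) nu (f m) * r ^+ mdeg m.

Let nu_sum I (s : seq I) (P : pred I) (G : I -> F) :
  nu (\sum_(i <- s | P i) G i) <= \sum_(i <- s | P i) nu (G i).
Proof.
elim/big_rec2: _ => [|i x y _ H]; first by rewrite nu0.
by apply: le_trans (nuD _ _) _; rewrite lerD2l.
Qed.

Lemma jet_norm_ge0 d r f : 0 <= r -> 0 <= jet_norm d r f.
Proof. by move=> r0; apply: sumr_ge0 => m _; rewrite mulr_ge0 ?exprn_ge0. Qed.

Lemma jet_norm_leq d r r' f : 0 <= r -> r <= r' -> jet_norm d r f <= jet_norm d r' f.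
Proof.
move=> r0 rr; apply: ler_sum => m _; rewrite ler_wpM2l //.
by apply: lerXn2r => //; rewrite nnegrE ?(le_trans r0 rr).
Qed.

Lemma jet_normD d r f g : 0 <= r -> jet_norm d r (f + g) <= jet_norm d r f + jet_norm d r g.
Proof.
move=> r0; rewrite -big_split /=; apply: ler_sum => m _.
by rewrite -mulrDl ler_wpM2r ?exprn_ge0 // ps_addE nuD.
Qed.

Lemma jet_normZ d r c f : jet_norm d r (c *: f) = nu c * jet_norm d r f.
Proof. by rewrite mulr_sumr; apply: eq_bigr => m _; rewrite ps_scaleE nuM mulrA. Qed.

Let sum_at_most_one d (m0 : 'X_{1..n}) (x : R) : 0 <= x ->
  \sum_(m : 'X_{1..n < d.+1} | bmnm m == m0) x <= x.
Proof.
move=> x0; have [lt|ge] := ltnP (mdeg m0) d.+1.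
  by rewrite (big_pred1 (BMultinom lt)).
rewrite big_pred0 // => m; apply/eqP => E.
by have := bmdeg m; rewrite E ltnNge ge.
Qed.

Lemma jet_norm_mon d r m0 : 0 <= r -> jet_norm d r (ps_mon F m0) <= r ^+ mdeg m0.
Proof.
move=> r0; apply: le_trans (sum_at_most_one d m0 (exprn_ge0 _ r0)).
rewrite [X in _ <= X]big_mkcond; apply: ler_sum => m _.
by rewrite /ps_mon; case: eqP => [->|_]; rewrite ?nu1 ?mul1r // nu0 mul0r.
Qed.

Lemma jet_norm_mul d r f g : 0 <= r ->
  jet_norm d r (f * g) <= jet_norm d r f * jet_norm d r g.
Proof.
move=> r0; pose G (kl : 'X_{1..n < d.+1} * 'X_{1..n < d.+1}) :=
  (nu (f kl.1) * r ^+ mdeg kl.1) * (nu (g kl.2) * r ^+ mdeg kl.2).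
have G0 kl : 0 <= G kl by rewrite !mulr_ge0 ?exprn_ge0.
have -> : jet_norm d r f * jet_norm d r g = \sum_kl G kl.
  rewrite mulr_suml -(pair_bigA _ (fun k l => G (k, l))) /=.
  by apply: eq_bigr => k _; rewrite mulr_sumr.
have step (m : 'X_{1..n < d.+1}) :
    nu ((f * g) m) * r ^+ mdeg m <= \sum_(kl : 'X_{1..n < d.+1} * 'X_{1..n < d.+1} | bmnm m == (bmnm kl.1 + bmnm kl.2)%MM) G kl.
  have md (k : 'X_{1..n < d.+1}) : (mdeg k <= d)%N by rewrite -ltnS bmdeg.
  have -> := etrans (ps_mulE f g (md m)) (mcoeff_poly_mul (jet d f) (jet d g) (bmdeg m)).
  apply: le_trans (ler_wpM2r (exprn_ge0 _ r0) (nu_sum _ _ _)) _.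
  rewrite mulr_suml; apply: ler_sum => kl /eqP mE.
  rewrite !coef_jet !md nuM [in r ^+ _]mE mdegD exprD /G.
  by rewrite le_eqVlt; apply/orP; left; apply/eqP; ring.
apply: le_trans (ler_sum _ (fun m _ => step m)) _.
rewrite (exchange_big_dep xpredT) //=; apply: ler_sum => kl _.
exact: sum_at_most_one.
Qed.

(** A series whose jets have bounded norm for some radius converges absolutely on
    the polydisc of that radius. *)
Definition bounded f := exists r B : R, 0 < r /\ forall d, jet_norm d r f <= B.

Lemma bounded_mon c m0 : bounded (c *: ps_mon F m0).
Proof.
exists 1, (nu c); split=> [|d]; first exact: ltr01.
rewrite jet_normZ -[X in _ <= X]mulr1 ler_wpM2l //.
by have := jet_norm_mon d m0 (@ler01 R); rewrite expr1n.
Qed.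

Lemma bounded_common f g : bounded f -> bounded g -> exists r B C : R,
  0 < r /\ forall d, jet_norm d r f <= B /\ jet_norm d r g <= C.
Proof.
move=> [r [B [r0 HB]]] [s [C [s0 HC]]]; exists (Num.min r s), B, C.
have m0 : 0 < Num.min r s by rewrite lt_min r0.
split=> // d; split; [apply: le_trans (HB d)|apply: le_trans (HC d)];
  apply: jet_norm_leq; rewrite ?(ltW m0) // ge_min lexx ?orbT //.
Qed.

Lemma boundedD f g : bounded f -> bounded g -> bounded (f + g).
Proof.
move=> bf bg; have [r [B [C [r0 H]]]] := bounded_common bf bg.
exists r, (B + C); split=> // d; have [HB HC] := H d.
by apply: le_trans (jet_normD d f g (ltW r0)) _; apply: lerD.
Qed.

Lemma boundedM f g : bounded f -> bounded g -> bounded (f * g).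
Proof.
move=> bf bg; have [r [B [C [r0 H]]]] := bounded_common bf bg.
exists r, (B * C); split=> // d; have [HB HC] := H d; have r0' := ltW r0.
by apply: le_trans (jet_norm_mul d f g r0') _; apply: ler_pM; rewrite ?jet_norm_ge0.
Qed.

Lemma bounded_const (c : F) : bounded c%:A.
Proof. exact: bounded_mon c 0%MM. Qed.

(** Without constant term every monomial gains a factor [t]. *)
Lemma jet_norm_shrink d r t f : f 0%MM = 0 -> 0 <= r -> 0 <= t <= 1 ->
  jet_norm d (t * r) f <= t * jet_norm d r f.
Proof.
move=> f0 r0 /andP[t0 t1]; rewrite mulr_sumr; apply: ler_sum => m _.
have [->|m0] := eqVneq (bmnm m) 0%MM; first by rewrite f0 nu0 !mul0r mulr0.
rewrite exprMn mulrA mulrA ler_wpM2r ?exprn_ge0 // mulrC ler_wpM2r //.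
rewrite -mdeg_eq0 in m0; case: (mdeg m) m0 => // k _.
by rewrite exprS ler_piMr // exprn_ile1.
Qed.

(** With [f = f(0) (1 - s)] and [s(0) = 0] the inverse [g] of [f] satisfies
    [g = 1 / f(0) + s g], where the norm of [s] is at most [1/2] on a small
    polydisc. *)
Lemma boundedV f : bounded f -> bounded f^-1.
Proof.
move=> bf; have [uf|nuf] := boolP (f \is a GRing.unit); last by rewrite invr_out.
set c := f 0%MM; have c0 : c != 0 by rewrite -ps_unitE.
pose s : A := 1 + (- c^-1)%:A * f.
have s0 : s 0%MM = 0.
  by rewrite /s mulr_algl ps_addE ps_1E eqxx ps_scaleE mulNr mulVf // subrr.
have gE : f^-1 = (c^-1)%:A + s * f^-1.
  by rewrite /s mulrDl mul1r -mulrA mulrV // mulr1 scaleNr addrCA subrr addr0.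
have [r [B [r0 HB]]] : bounded s.
  apply: boundedD; last by apply: boundedM bf; apply: bounded_const.
  by rewrite -(scale1r (1 : A)); apply: bounded_const.
have B0 : 0 <= B by apply: le_trans (HB 0%N); apply/jet_norm_ge0/ltW.
(* [B + 1] instead of [B], which may be zero *)
pose t := (2 * (B + 1))^-1.
have B1 : 0 < B + 1 by rewrite ltr_wpDl.
have t0 : 0 < t by rewrite invr_gt0 mulr_gt0.
have t1 : t <= 1.
  rewrite invf_le1 ?mulr_gt0 // -[1 in X in X <= _]mulr1.
  by apply: ler_pM; rewrite ?ler01 // ?ler1n // lerDr.
have tB : t * B <= 2^-1.
  rewrite /t invfM -mulrA ler_piMr ?invr_ge0 //.
  by rewrite mulrC ler_pdivrMr // mul1r lerDl.
exists (t * r), (2 * nu c^-1); split=> [|d]; first exact: mulr_gt0.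
have tr0 : 0 <= t * r by rewrite mulr_ge0 ?ltW.
set N := jet_norm _ _ _; have N0 : 0 <= N by apply: jet_norm_ge0.
have : N <= nu c^-1 + 2^-1 * N.
  rewrite {1}/N gE; apply: le_trans (jet_normD _ _ _ tr0) _; apply: lerD.
    rewrite jet_normZ -[X in _ <= X]mulr1 ler_wpM2l //.
    by have := jet_norm_mon d 0%MM tr0; rewrite mdeg0 expr0.
  apply: le_trans (jet_norm_mul _ _ _ tr0) _; rewrite ler_wpM2r //.
  apply: le_trans (jet_norm_shrink d s0 (ltW r0) _) _; first by rewrite (ltW t0).
  by apply: le_trans tB; rewrite ler_wpM2l // ltW.
rewrite -lerBlDr => H; rewrite -ler_pdivrMl //; apply: le_trans H.
rewrite le_eqVlt; apply/orP; left; apply/eqP.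
have two : 2 != 0 :> R by rewrite pnatr_eq0.
by field.
Qed.

Lemma rational_bounded k f : rational k f -> bounded f.
Proof.
elim=> [c|i _|g h _ bg _ bh|g h _ bg _ bh|g _ bg].
- exact: bounded_const.
- by rewrite -[ps_X _ _]scale1r; apply: bounded_mon.
- exact: boundedD.
- exact: boundedM.
exact: boundedV.
Qed.

End JetNorm.

Section Convergence.
Variables (R : realType) (n : nat).
Local Notation nu := (@Normc.normc R).

Let normc_ge0 x : 0 <= nu x.
Proof. by case: x => a b; apply: sqrtr_ge0. Qed.

Lemma bounded_convergent (f : pser R[i] n) : bounded nu f -> convergent_fps f.
Proof.
move=> [r [B [r0 HB]]]; exists r => // z zr; rewrite /summable.
apply: le_lt_trans (ltry B); apply: ge_ereal_sup => _ [X [finX _] <-].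
rewrite fsbig_finite //= sumEFin lee_fin.
set s := finmap.enum_fset (fset_set X); pose d := \max_(m <- s) mdeg m.
apply: le_trans (HB d).
have term (m : 'X_{1..n}) :
    `|nu (f m * \prod_i z i ^+ m i)| <= nu (f m) * r ^+ mdeg m.
  rewrite ger0_norm // Normc.normcM ler_wpM2l // mdegE expr_sum.
  elim/big_ind2: _ => [|x a y b Hx Hy|i _].
  - by rewrite Normc.normc1.
  - by rewrite Normc.normcM; apply: ler_pM.
  have -> : nu (z i ^+ m i) = nu (z i) ^+ m i.
    by elim: (m i) => [|k IHk]; rewrite ?expr0 ?Normc.normc1 // !exprS Normc.normcM IHk.
  by apply: lerXn2r; rewrite ?nnegrE ?(ltW r0) ?(ltW (zr i)).
apply: le_trans (ler_sum _ (fun m _ => term m)) _.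
have us : uniq s by apply: finmap.fset_uniq.
have sd (m : 'X_{1..n}) : m \in s -> (mdeg m < d.+1)%N.
  by move=> ms; rewrite ltnS /d; apply: leq_bigmax_seq.
have -> : \sum_(m <- s) nu (f m) * r ^+ mdeg m =
    \sum_(k : 'X_{1..n < d.+1} | bmnm k \in s) nu (f k) * r ^+ mdeg k.
  transitivity (\sum_(m <- [seq bmnm k | k <- [seq k <- index_enum 'X_{1..n < d.+1} | bmnm k \in s]])
    nu (f m) * r ^+ mdeg m); last by rewrite big_map big_filter.
  apply: perm_big; apply: uniq_perm => //.
    by rewrite map_inj_uniq ?filter_uniq ?index_enum_uniq //; apply: val_inj.
  move=> m; apply/idP/mapP => [ms|[k]]; last by rewrite mem_filter => /andP[ks _] ->.
  by exists (BMultinom (sd m ms)) => //; rewrite mem_filter ms mem_index_enum.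
rewrite [X in _ <= X](bigID (fun k : 'X_{1..n < d.+1} => bmnm k \in s)) /= lerDl.
by apply: sumr_ge0 => k _; rewrite mulr_ge0 // exprn_ge0 // ltW.
Qed.

Lemma rational_convergent k (f : pser R[i] n) : rational k f -> convergent_fps f.
Proof.
move=> rf; apply: bounded_convergent; apply: rational_bounded rf => //.
- exact: Normc.normc0.
- exact: Normc.normc1.
- exact: Normc.normcM.
exact: le_normcD.
Qed.

Lemma triangular_group_convergent : (@triangular_group R[i] n `<=` @convergent_diff R n)%classic.
Proof. by move=> phi [tphi _] i; apply: rational_convergent (triangular_rational i tphi). Qed.

End Convergence.

Theorem theorem1p4 (R : realType) (n : nat) (hn : (0 < n)%N) :
  (forall G : set (fdiff R[i] n),
     is_subgroup G -> unipotent_set G -> is_solvable G ->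
     exists2 l : nat, soluble_length G = Some l & (l <= 2 * n - 1)%N) /\
  (exists G : set (fdiff R[i] n),
     [/\ is_subgroup G, (G `<=` @convergent_diff R n)%classic,
         unipotent_set G, is_solvable G &
         soluble_length G = Some (2 * n - 1)%N]).
Proof.
have C0 : [pchar R[i]] =i pred0 := pchar_num R[i].
split=> [G sG uG|]; first exact: unipotent_solvable_length.
have sG := triangular_group_subgroup R[i] n.
have uG : unipotent_set (@triangular_group R[i] n).
  by move=> phi [/triangular_unipotent].
have solG := @triangular_group_solvable R[i] n.
exists (@triangular_group R[i] n); split=> //; first exact: triangular_group_convergent.
have [l El ln] := unipotent_solvable_length C0 hn sG uG solG.
rewrite El; congr Some; apply/eqP; rewrite eqn_leq ln /= leqNgt; apply/negP => ll.
have [Gl _] := (soluble_lengthP _ _).1 El.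
have [phi /eqP phi1 dphi] := derived_nontrivial C0 hn; apply: phi1.
have : derived l (@triangular_group R[i] n) phi.
  apply: derived_leq dphi => //; lia.
by rewrite Gl.
Qed.
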